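(* Let $n\in\mathbb{N}$ and $0<1/n\ll\varepsilon\ll\eta\ll 1$. Then, for every $\eta$-good graph $G$ on $n$ vertices, there exists an integer $\ell$ with $(1-\varepsilon)n\le 3\ell\le n$ such that $G\supseteq Z_\ell$.
   Context: Graphs are finite and simple; $[k]=\{1,\dots,k\}$; $G\supseteq Z_\ell$ means that $G$ contains a (not necessarily induced) copy of $Z_\ell$. Hierarchy notation: a result holding ''whenever $0<1/n\ll a\ll b\ll 1$'' means constants are chosen from right to left: there are an absolute constant $c_0\in(0,1]$ and non-decreasing functions $f,g:(0,1]\to(0,1]$ such that the result holds whenever $b\le c_0$, $a\le f(b)$ and $1/n\le g(a)$. $\eta$-good: let $v_1,\dots,v_n$ be an ordering of $V(G)$ with $d_G(v_i)\le d_G(v_j)$ whenever $i\le j$. A graph $G$ on $n$ vertices is $\eta$-good if $d_G(v_i)\ge(1/3+\eta)n+i+1$ for all $1\le i\le n/3$. The $\ell$-triangle cycle $Z_\ell$ is the graph with vertex set $[\ell]\times[3]$ such that for all $1\le i\le\ell$ and distinct $1\le j,j'\le3$ we have $(i,j)(i,j')\in E(Z_\ell)$ and $(i,j)(i+1,j')\in E(Z_\ell)$, where addition in the first coordinate is modulo $\ell$ (and there are no other edges). *)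

(* Defs.v *)
From mathcomp Require Import all_boot all_order all_algebra.
From mathcomp Require Import reals.

Set Implicit Arguments.
Unset Strict Implicit.
Unset Printing Implicit Defensive.

Import Order.TTheory GRing.Theory Num.Theory.
Local Open Scope ring_scope.

Record sgraph (T : finType) := SGraph {
  adj :> rel T;
  adj_sym : symmetric adj;
  adj_irrefl : irreflexive adj
}.

Definition degree (T : finType) (G : sgraph T) (x : T) : nat :=
  #|[set y | G x y]|.

(* Not necessarily induced copies: non-edges of [H] are unconstrained. *)
Definition contains (S T : finType) (G : sgraph T) (H : sgraph S) : Prop :=
  exists2 f : S -> T, injective f & forall x y, H x y -> G (f x) (f y).

(* The l-triangle cycle.  [ordS i] is the successor of [i] modulo [l]. *)
Definition tricycle_rel (l : nat) : rel ('I_l * 'I_3) :=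
  fun x y => (x.2 != y.2) &&
    [|| x.1 == y.1, y.1 == ordS x.1 | x.1 == ordS y.1].

Fact tricycle_sym l : symmetric (@tricycle_rel l).
Proof.
move=> x y; rewrite /tricycle_rel (eq_sym x.2) (eq_sym x.1 y.1).
by rewrite [X in _ || X]orbC.
Qed.

Fact tricycle_irrefl l : irreflexive (@tricycle_rel l).
Proof. by move=> x; rewrite /tricycle_rel eqxx. Qed.

Definition tricycle (l : nat) : sgraph ('I_l * 'I_3)%type :=
  SGraph (@tricycle_sym l) (@tricycle_irrefl l).

(* The ordering v_1, ..., v_n is [v] with indices shifted by one: v_i is [v k]
   with i = k.+1.  Different orderings by degree give the same degree sequence, so
   it does not matter which one is used. *)
Definition eta_good (R : realType) (eta : R) (T : finType) (G : sgraph T) :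
    Prop :=
  exists v : 'I_#|T| -> T,
    [/\ bijective v,
        forall i j : 'I_#|T|, (i <= j)%N -> (degree G (v i) <= degree G (v j))%N
      & forall k : 'I_#|T|, k.+1%:R <= #|T|%:R / 3 :> R ->
          (1 / 3 + eta) * #|T|%:R + k.+1%:R + 1 <= (degree G (v k))%:R].

(* [f] restricts to a non-decreasing function from (0,1] to (0,1]. *)
Definition hierarchy_fun (R : realType) (f : R -> R) : Prop :=
  (forall x, 0 < x <= 1 -> 0 < f x <= 1) /\
  (forall x y, 0 < x -> x <= y -> y <= 1 -> f x <= f y).

(* Main.v *)
(* The regularity lemma is replaced by the following elementary scheme.

   Split V(G) by degree rank into M strata of equal size.  A transversal of the
   strata chosen at random induces, up to a few vertices, a graph F on M vertices
   satisfying the same degree-sequence condition (second moment method), so by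
   pigeonhole and the Kovari-Sos-Turan-Erdos theorem for M-partite M-uniform
   hypergraphs G contains complete blow-ups of such graphs F with clusters of any
   fixed size.  If each of them is also required to look like G to almost all
   vertices, then what remains after removing some of them still satisfies the
   degree condition, and almost all of V(G) is covered by disjoint blow-ups.

   In F call a vertex big if its degree exceeds 2M/3.  All triangles containing a
   big vertex lie in one component K of the graph of triangles of F, where two
   ordered triangles are adjacent if they may follow each other in a triangle
   cycle.  Every weighting of V(F) giving weight at least beta to each triangle of
   K has total weight at least beta M / 3, hence (by always adding a lightest
   triangle) there is an almost uniform fractional triangle tiling inside K, and a
   closed walk through K with these multiplicities covers almost all of the
   blow-up.  Finally consecutive blow-ups are joined by short chains of triangles:
   three big vertices of G always have linearly many common neighbours. *)

Require Import Defs.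
From mathcomp Require Import all_boot all_order all_algebra.
From mathcomp Require Import reals boolp.
From mathcomp Require Import zify ring lra.

Set Implicit Arguments.
Unset Strict Implicit.
Unset Printing Implicit Defensive.

Import Order.TTheory GRing.Theory Num.Theory.

(** An [eta]-good graph is [eps]-good for every [eps <= eta], so a single parameter has to be
    treated. The difficulty is the order of the remaining choices. The cluster size depends on the
    number [M] of strata and is fixed before n; hence the number of blow-ups grows with n, and each
    removal disturbs the strata that remain. The disturbance is measured by the sum over all
    vertices of the change of [mdeg]. A blow-up and the rest from which it is taken have almost the
    same [mdeg], so the errors merely add up, and [g1] is small enough in terms of [eps] and [gam]
    to keep their total harmless. The chains pose a second problem: their inner vertices are found
    anywhere in G and may hit clusters of any block. The tours therefore leave a fixed reserve in
    each cluster, and the chains are chosen one after the other so that no cluster loses more than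
    this reserve. *)

(* The adjacencies between consecutive triangles of a triangle cycle; in
   particular [zstep e t t] says that [t] is a triangle. *)
Definition zstep (A : Type) (e : A -> A -> bool) (t u : A * A * A) : bool :=
  let: (a, b, c) := t in let: (a', b', c') := u in
  [&& e a b', e a c', e b a', e b c', e c a' & e c b'].

Definition occ (A : eqType) (t : A * A * A) (v : A) : nat :=
  (t.1.1 == v) + (t.1.2 == v) + (t.2 == v).

Definition load (A : eqType) (L : seq (A * A * A)) (v : A) : nat :=
  \sum_(t <- L) occ t v.

Lemma zstep_sym (A : Type) (e : A -> A -> bool) : symmetric e ->
  symmetric (zstep e).
Proof.
move=> s [[a b] c] [[a' b'] c'] /=; rewrite (s a') (s a') (s b') (s b') (s c') (s c').
by do 6!case: (e _ _).
Qed.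

Lemma occ_tri (T : finType) (F : sgraph T) t v : zstep F t t -> occ t v <= 1.
Proof.
case: t => [[a b] c] /= /and5P[ab ac _ bc _].
have d x y : F x y -> (x == y) = false.
  by move=> xy; apply/negP => /eqP e; rewrite e adj_irrefl in xy.
rewrite /occ /=; case: (a =P v) => [<-|_].
  by rewrite ![_ == a]eq_sym (d _ _ ab) (d _ _ ac).
case: (b =P v) => [<-|_]; first by rewrite [_ == b]eq_sym (d _ _ bc).
by case: (c == v).
Qed.

Lemma load_size (T : finType) (F : sgraph T) L v :
  all (fun t => zstep F t t) L -> load L v <= size L.
Proof.
elim: L => [|t L IH] /=; rewrite /load ?big_nil // big_cons => /andP[h /IH].
by have := occ_tri v h; rewrite /load; lia.
Qed.

Lemma load_cat (A : eqType) (L1 L2 : seq (A * A * A)) v :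
  load (L1 ++ L2) v = load L1 v + load L2 v.
Proof. exact: big_cat. Qed.

(** * Triangles in graphs with a large degree sequence *)

Section GoodGraph.
Local Open Scope nat_scope.

Variables (J : finType) (F : sgraph J) (r : J -> nat).
Hypothesis r_inj : injective r.
Hypothesis F_good : forall k, #|J| + minn (3 * (r k).+1) #|J| < 3 * degree F k.

Let m := #|J|.
Let N x := [set y | F x y].
Let big k := m <= 3 * (r k).+1.

Lemma card_rank_lt (A : {set J}) q :
  (forall z, z \in A -> r z < q) -> #|A| <= q.
Proof.
case: q => [|q] Aq.
  rewrite leqn0 cards_eq0; apply/eqP/setP => z; rewrite inE.
  by apply/negP => /Aq.
have inj : {in A &, injective (fun z => inord (r z) : 'I_q.+1)}.
  move=> y z yA zA /(congr1 val); rewrite /= !inordK ?Aq //.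
  exact: r_inj.
by rewrite -(card_in_imset inj) -[X in _ <= X]card_ord max_card.
Qed.

Lemma card_small : 3 * #|[set k | ~~ big k]| <= m.
Proof.
have: #|[set k | ~~ big k]| <= m %/ 3.
  apply: card_rank_lt => z; rewrite inE /big -ltnNge => h.
  by rewrite leq_divRL // mulnC ltnW.
lia.
Qed.

Lemma deg_big x : big x -> 2 * m < 3 * #|N x|.
Proof. by move=> bx; have := F_good x; rewrite /degree -/m -/(N x) /big in bx *; lia. Qed.

Lemma deg_small x : ~~ big x -> m + 3 * (r x).+1 < 3 * #|N x|.
Proof.
by move=> bx; have := F_good x; rewrite /degree -/m -/(N x) /big in bx *; lia.
Qed.

Lemma card_setI_ge (A B : {set J}) : #|A| + #|B| <= #|A :&: B| + m.
Proof. by rewrite -cardsUI addnC leq_add2l max_card. Qed.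

Lemma common3 x y z : big x -> big y -> big z ->
  exists c, [/\ F x c, F y c & F z c].
Proof.
move=> /deg_big bx /deg_big b_y /deg_big bz.
have h1 := card_setI_ge (N x) (N y).
have h2 := card_setI_ge (N x :&: N y) (N z).
have /card_gt0P[c] : 0 < #|N x :&: N y :&: N z| by lia.
by rewrite !inE => /andP[/andP[? ?] ?]; exists c.
Qed.

(** More than a third of all vertices are common neighbours, and at most a third are not big. *)
Lemma common2_big x y : big x -> big y ->
  exists c, [/\ F x c, F y c & big c].
Proof.
move=> /deg_big bx /deg_big b_y.
have h1 := card_setI_ge (N x) (N y).
have h2 := card_setI_ge (N x :&: N y) [set k | big k].
have h3 : #|[set k | big k]| + #|[set k | ~~ big k]| = m.
  rewrite /m -(cardsC [set k | big k]); congr (_ + _).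
  by apply: eq_card => z; rewrite !inE.
have := card_small => h4.
have /card_gt0P[c] : 0 < #|N x :&: N y :&: [set k | big k]| by lia.
by rewrite !inE => /andP[/andP[? ?] ?]; exists c.
Qed.

Lemma big_triangle : 0 < m ->
  exists t : J * J * J, [&& zstep F t t, big t.1.1 & big t.1.2].
Proof.
move=> m0.
have h3 : #|[set k | big k]| + #|[set k | ~~ big k]| = m.
  rewrite /m -(cardsC [set k | big k]); congr (_ + _).
  by apply: eq_card => z; rewrite !inE.
have h4 := card_small.
have /card_gt0P[a] : 0 < #|[set k | big k]| by lia.
rewrite inE => ba.
have [b [ab _ bb]] := common2_big ba ba.
have [c [ac bc _]] := common3 ba bb bb.
exists (a, b, c) => /=.
by rewrite ab ac bc (adj_sym F b) ab (adj_sym F c) ac (adj_sym F c) bc ba bb.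
Qed.

(** The two degrees force more than [(r x).+1] common neighbours, and [r] is injective, so not all
    of them have rank at most [r x]. *)
Lemma higher_rank x y : ~~ big x -> big y ->
  exists z, [/\ F x z, F y z & r x < r z].
Proof.
move=> /deg_small sx /deg_big b_y.
have h1 := card_setI_ge (N x) (N y).
have h2 := card_setI_ge (N x :&: N y) [set k | r x < r k].
have h3 : #|[set k | r x < r k]| + #|[set k | r k < (r x).+1]| = m.
  rewrite /m -(cardsC [set k | r x < r k]); congr (_ + _).
  by apply: eq_card => z; rewrite !inE -leqNgt ltnS.
have h4 : #|[set k | r k < (r x).+1]| <= (r x).+1.
  by apply: card_rank_lt => z; rewrite inE.
have /card_gt0P[c] : 0 < #|N x :&: N y :&: [set k | r x < r k]| by lia.
by rewrite !inE => /andP[/andP[? ?] ?]; exists c.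
Qed.

(** * The component of triangles that contains all big vertices *)

Definition estep : rel (J * J * J) :=
  fun t u => [&& zstep F t t, zstep F u u & zstep F t u].

Section Component.
Variable t0 : J * J * J.
Hypothesis t0_tri : zstep F t0 t0.
Hypothesis t0_big : big t0.1.1 && big t0.1.2.

Let C t := connect estep t0 t.

Definition in_comp (a b c : J) :=
  [|| C (a, b, c), C (a, c, b), C (b, a, c), C (b, c, a), C (c, a, b)
    | C (c, b, a)].
Let K := in_comp.

Lemma compC12 a b c : K a b c -> K b a c.
Proof. by case/or4P => [|||/or3P[]] h; rewrite /K /in_comp h ?orbT. Qed.

Lemma compC23 a b c : K a b c -> K a c b.
Proof. by case/or4P => [|||/or3P[]] h; rewrite /K /in_comp h ?orbT. Qed.

Lemma connect_tri t : C t -> zstep F t t.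
Proof.
case/connectP => p; elim/last_ind: p t => [|p u _] t /=; first by move=> _ ->.
by rewrite rcons_path last_rcons => /andP[_ /and3P[_ ? _]] ->.
Qed.

Lemma comp_tri a b c : K a b c -> [&& F a b, F a c & F b c].
Proof.
have s := adj_sym F.
case/or4P => [|||/or3P[]] /connect_tri /=; move/and5P => [+ + + + /andP[]];
  rewrite ?(s b a) ?(s c a) ?(s c b).
all: by move=> h1 h2 h3 h4 h5 h6; rewrite ?h1 ?h2 ?h3 ?h4 ?h5 ?h6.
Qed.

(** Replacing one vertex in its position is a step of [estep]; the six cases are the orders in which
    the given triangle may have been reached. *)
Lemma comp_swap a b c x : K a b c -> F a x -> F b x -> K a b x.
Proof.
move=> Kc ax bx; have s := adj_sym F.
have /and3P[ab ac bc] := comp_tri Kc.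
have ba : F b a by rewrite s.
have ca : F c a by rewrite s.
have cb : F c b by rewrite s.
have xa : F x a by rewrite s.
have xb : F x b by rewrite s.
have st t u : C t -> estep t u -> C u.
  by move=> h1 h2; apply: connect_trans h1 (connect1 h2).
case/or4P: Kc => [|||/or3P[]] h; rewrite /K /in_comp.
- by rewrite (st _ (a, b, x) h) ?orbT // /estep /= ab ac bc ba ca cb xa xb ax bx.
- by rewrite (st _ (a, x, b) h) ?orbT // /estep /= ab ac bc ba ca cb xa xb ax bx.
- by rewrite (st _ (b, a, x) h) ?orbT // /estep /= ab ac bc ba ca cb xa xb ax bx.
- by rewrite (st _ (b, x, a) h) ?orbT // /estep /= ab ac bc ba ca cb xa xb ax bx.
- by rewrite (st _ (x, a, b) h) ?orbT // /estep /= ab ac bc ba ca cb xa xb ax bx.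
- by rewrite (st _ (x, b, a) h) ?orbT // /estep /= ab ac bc ba ca cb xa xb ax bx.
Qed.

(** Triangles with a common edge lie in the same component, so membership is a property of edges,
    and any triangle on such an edge passes it on to its other two edges. *)
Let E a b := exists c, K a b c.

Lemma E_sym a b : E a b -> E b a.
Proof. by case=> c /compC12; exists c. Qed.

Lemma E_tri a b c : E a b -> F a c -> F b c -> K a b c.
Proof. by case=> d h ac bc; apply: comp_swap h ac bc. Qed.

Lemma E_next a b c : E a b -> F a c -> F b c -> E b c.
Proof. by move=> h1 h2 h3; exists a; apply/compC23/compC12/E_tri. Qed.

(** With a common neighbour z of the three vertices, the triangles abz and zbd share the edge bz. *)
Lemma E_pivot a b d : big a -> big b -> big d -> F b a -> F b d ->
  E a b -> E b d.
Proof.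
move=> ba bb bd ab bd' Eab.
have [z [az bz dz]] := common3 ba bb bd.
apply: (E_next (a := z)) => //; last by rewrite adj_sym.
by apply: E_sym; apply: E_next Eab _ _.
Qed.

(** Starting from the edge ab of [t0], pivot at b to a big common neighbour of b and d, from there
    to d, and finally at d to c. *)
Lemma E_big c d : big c -> big d -> F c d -> E c d.
Proof.
move: t0_tri t0_big; case t0E: t0 => [[a b] e].
move=> /= tri /andP[ba bb] bc bd cd.
have Eab : E a b.
  by exists e; rewrite /K /in_comp /C t0E connect0.
have ab : F a b by case/and5P: tri.
have [e' [be de be']] := common2_big bb bd.
have Ebe : E b e' by apply: (E_pivot (a := a)) => //; rewrite adj_sym.
have Eed : E e' d.
  by apply: (E_pivot (a := b)) => //; rewrite adj_sym.
by apply: E_sym; apply: (E_pivot (a := e')) => //; rewrite adj_sym.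
Qed.

(* If [x] is not big, [xy] lies in a triangle with a vertex of larger rank than [x]. *)
Lemma E_one_big x y : big y -> F x y -> E x y.
Proof.
move=> b_y; have [k le_k] := ubnP (m - r x); elim: k => // k IH in x le_k *.
move=> xy; case: (boolP (big x)) => [bx|sx]; first exact: E_big.
have [z [xz yz rz]] := higher_rank sx b_y.
have rzm : r x < m by rewrite /big -ltnNge in sx; lia.
have : E z y by apply: IH; [lia|rewrite adj_sym].
move=> /(E_next (c := x)); rewrite adj_sym => /(_ xz).
by rewrite adj_sym => /(_ xy) /E_sym.
Qed.

Lemma comp_big a b c : big a -> F a b -> F a c -> F b c -> K a b c.
Proof.
move=> ba ab ac bc; apply: E_tri => //; apply: E_sym; apply: E_one_big => //.
by rewrite adj_sym.
Qed.

End Component.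

Lemma sum_nat_mem (A : {set J}) : \sum_v (v \in A : nat) = #|A|.
Proof. by rewrite -sum1_card [RHS]big_mkcond; apply: eq_bigr => v _; case: (v \in A). Qed.

Lemma sum_balance (w w' g h : J -> nat) : (forall v, w' v + g v = w v + h v) ->
  \sum_v w' v + \sum_v g v = \sum_v w v + \sum_v h v.
Proof. by move=> e; rewrite -!big_split; apply: eq_bigr => v _; exact: e. Qed.

(** * Weightings of the vertices that cover the component *)

Section Cover.
Variable K : J -> J -> J -> bool.
Hypothesis K12 : forall a b c, K a b c -> K b a c.
Hypothesis K23 : forall a b c, K a b c -> K a c b.
Hypothesis K_swap : forall a b c x, K a b c -> F a x -> F b x -> K a b x.
Hypothesis K_big : forall a b c, big a -> F a b -> F a c -> F b c -> K a b c.

Lemma K_link a b c x : K a b c ->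
  [/\ F x a -> F x b -> K x a b, F x a -> F x c -> K x a c
    & F x b -> F x c -> K x b c].
Proof.
move=> k; split; rewrite !(adj_sym F x) => h1 h2.
- exact/K12/K23/(K_swap k).
- exact/K12/K23/(K_swap (K23 k)).
- exact/K12/K23/(K_swap (K23 (K12 k))).
Qed.

Lemma max_rank (A : {set J}) : 0 < #|A| ->
  exists2 x, x \in A & forall y, y \in A -> r y <= r x.
Proof.
by case/card_gt0P => i iA; case: (@arg_maxnP _ i (mem A) r iA) => x; exists x.
Qed.

(** Let y be a zero of largest rank in [N u]. A common neighbour of [u] and y forms with them a
    triangle of [K] with two zeros, so it has weight at least [beta]. If y is not big, there are
    more than [(r y).+1] common neighbours, and at most [(r y).+1] zeros. If y is big, they fill at
    least half of [N u] and are disjoint from the zeros. *)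
Lemma zero_link (w : J -> nat) beta u : big u -> w u = 0 -> 0 < beta ->
  (forall a b c, K a b c -> beta <= w a + w b + w c) ->
  exists Y : {set J}, [/\ Y \subset N u, forall v, v \in Y -> beta <= w v
    & #|[set v in N u | w v == 0]| <= #|Y|].
Proof.
move=> bu wu b0 wK; set Z := [set v in N u | _].
case: (posnP #|Z|) => [->|Z0]; first by exists set0; split=> // [|v]; rewrite ?sub0set // inE.
have [y yZ ymax] := max_rank Z0.
have := yZ; rewrite !inE => /andP[uy /eqP wy].
exists (N u :&: N y); have wY v : v \in N u :&: N y -> beta <= w v.
  rewrite !inE => /andP[uv yv].
  by have := wK _ _ _ (K_big bu uy uv yv); rewrite wu wy.
split=> //; first exact: subsetIl.
have h1 := card_setI_ge (N u) (N y); have h2 := deg_big bu.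
case: (boolP (big y)) => [/deg_big h3|/deg_small h3]; last first.
  have : #|Z| <= (r y).+1 by apply: card_rank_lt => z /ymax.
  lia.
have : #|Z| + #|N u :&: N y| <= #|N u|.
  rewrite -cardsUI [X in _ + X](_ : _ = 0) ?addn0; last first.
    apply/eqP; rewrite cards_eq0; apply/eqP/setP => v; rewrite [RHS]inE.
    apply/negP; rewrite in_setI => /andP[+ /wY]; rewrite inE => /andP[_ /eqP ->].
    by rewrite leqn0 => /eqP b0'; rewrite b0' in b0.
  apply: subset_leq_card; apply/subsetP => v; rewrite in_setU => /orP[].
    by rewrite inE => /andP[].
  by rewrite in_setI => /andP[].
have := subset_leq_card (subsetIl (N u) (N y)).
have := card_setI_ge (N u) (N y).
have := max_card (mem (N u)); rewrite -/m.
lia.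
Qed.

(* The dual linear program, by descent on the total weight of a counterexample:
   - if no weight is 0, lower all weights by 1 and [beta] by 3;
   - if a big vertex [x] has weight 0, edges inside [N x] have weight at least
     [beta], so one can lower [beta] by 2 and the weights on [N x] by 1, except for
     the zeros there, whose share is taken by the set of [zero_link];
   - otherwise let [x] be a zero of largest rank: lower the weights on [N x] by 1,
     raise the zeros outside [N x] by 1 and lower [beta] by 1; there are at most
     [(r x).+1] zeros, and [3 * #|N x|] exceeds [m + 3 * (r x).+1]. *)
Lemma cover_bound (w : J -> nat) beta :
  (forall a b c, K a b c -> beta <= w a + w b + w c) ->
  m * beta <= 3 * \sum_v w v.
Proof.
have [k] := ubnP (\sum_v w v); elim: k => // k IH in w beta *.
rewrite ltnS => wk wK; rewrite leqNgt; apply/negP => cex.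
have b0 : 0 < beta by lia.
have m0 : 0 < m by lia.
case: (posnP #|[set v | w v == 0]|) => [/eqP Z0|Z0].
  have w0 v : 0 < w v.
    rewrite lt0n; apply/negP => wv; move: Z0; rewrite cards_eq0 => /eqP/setP/(_ v).
    by rewrite !inE wv.
  have wm : m <= \sum_v w v.
    by rewrite /m -sum1_card; apply: leq_sum => v _.
  have := @sum_balance w (fun v => w v - 1) (fun=> 1) (fun=> 0) _.
  rewrite sum1_card sum_nat_const -/m muln0 addn0 => bal.
  have {}bal : \sum_v (w v - 1) + m = \sum_v w v.
    by apply: bal => v; have := w0 v; lia.
  have : m * (beta - 3) <= 3 * \sum_v (w v - 1).
    apply: IH; first lia.
    move=> a b c /wK; have := w0 a; have := w0 b; have := w0 c; lia.
  nia.
have [x xZ xmax] := max_rank Z0.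
move: xZ; rewrite inE => /eqP wx.
case: (boolP (big x)) => [bx|sx].
  have [Y [YN wY ZY]] := zero_link bx wx b0 wK.
  have dx := deg_big bx.
  set Z := [set v in N x | _] in ZY.
  have YZ v : v \in Y -> [/\ v \in N x, beta <= w v & v \notin Z].
    move=> vY; split; [exact: (subsetP YN)|exact: wY|].
    by rewrite inE negb_and orbC -lt0n (leq_trans b0) // wY.
  (* As [#|Z| <= #|Y|], shifting the share of the zeros to [Y] keeps the total decrease at [#|N x|]
     or more, that is, above two thirds of [m]. *)
  pose g v := (v \in N x) + (v \in Y) - (v \in Z).
  have ZN v : v \in Z -> v \in N x /\ w v = 0 by rewrite inE => /andP[? /eqP].
  have NZ v : v \in N x -> v \notin Z -> 0 < w v.
    by move=> vN; rewrite !inE /= in vN *; rewrite vN lt0n.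
  have YZN v : (v \in Y) + (v \in Z) <= (v \in N x).
    case: (boolP (v \in Y)) => [/YZ[-> _ /negPf->] //|_].
    by case: (boolP (v \in Z)) => [/ZN[-> _]|].
  have gE : \sum_v g v + #|Z| = #|N x| + #|Y|.
    rewrite -!sum_nat_mem -!big_split; apply: eq_bigr => v _; rewrite /g /=.
    by have := YZN v; lia.
  (* Vertices of [Y] lose 2, which presupposes that [beta] is at least 2. For [beta = 1] a count
     suffices: both [N x] without [Z] and [Y] have at most [\sum_v w v] elements, so [#|N x|] is at
     most twice this sum. *)
  case: (ltnP 1 beta) => b1; last first.
    have : #|N x| <= \sum_v w v + #|Z|.
      rewrite -!sum_nat_mem -big_split; apply: leq_sum => v _ /=.
      by move: (NZ v); case: (v \in N x) => // /(_ isT); case: (v \in Z); lia.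
    have : #|Y| <= \sum_v w v.
      rewrite -!sum_nat_mem; apply: leq_sum => v _ /=.
      by move: (YZ v); case: (v \in Y) => // /(_ isT) [_]; lia.
    have be : beta = 1 by lia.
    by move: cex; rewrite be muln1; lia.
  have gw v : g v <= w v.
    rewrite /g; move: (YZ v) (ZN v) (NZ v).
    case: (v \in Y) => [/(_ isT)[-> + /negPf->]|_]; first by lia.
    case: (v \in Z) => [/(_ isT)[-> _] //|_].
    by case: (v \in N x) => // /(_ isT isT).
  have bal : \sum_v (w v - g v) + \sum_v g v = \sum_v w v + 0.
    have := @sum_balance w (fun v => w v - g v) g (fun=> 0) _.
    by rewrite sum_nat_const muln0; apply=> v; have := gw v; lia.
  have : m * (beta - 2) <= 3 * \sum_v (w v - g v).
    apply: IH; first by lia.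
    move=> a b c Kabc; have [kab kac kbc] := K_link x Kabc.
    have := wK _ _ _ Kabc; move: (gw a) (gw b) (gw c).
    have {kab}: F x a -> F x b -> beta <= w a + w b.
      by move=> h1 h2; have := wK _ _ _ (kab h1 h2); rewrite wx.
    have {kac}: F x a -> F x c -> beta <= w a + w c.
      by move=> h1 h2; have := wK _ _ _ (kac h1 h2); rewrite wx.
    have {kbc}: F x b -> F x c -> beta <= w b + w c.
      by move=> h1 h2; have := wK _ _ _ (kbc h1 h2); rewrite wx.
    (* A vertex of [Y] alone pays for its triangle. Without one, losses occur only in [N x], where
       any two vertices of the triangle have total weight at least [beta]. *)
    have gt2 v : (g v <= 1 /\ (~~ F x v -> g v = 0)) \/ beta <= w v.
      rewrite /g; case: (boolP (v \in Y)) => vY; first by right; case: (YZ _ vY).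
      left; rewrite addn0; have -> : F x v = (v \in N x) by rewrite inE.
      by case: (v \in N x); case: (v \in Z).
    have g2 v : g v <= 2 by rewrite /g; case: (v \in N x); case: (v \in Y); lia.
    move: (gt2 a) (gt2 b) (gt2 c) (g2 a) (g2 b) (g2 c).
    case: (F x a); case: (F x b); case: (F x c); rewrite /=; lia.
  nia.
set Z := [set v | w v == 0] in Z0 xmax.
have cZ : #|Z| <= (r x).+1 by apply: card_rank_lt => z /xmax.
have dx := deg_small sx.
have Zm : 3 * #|Z| < m by move: sx; rewrite /big -ltnNge; lia.
(* Needed for triangles inside [N x], which may lose 3: their pairs have weight at least [beta], so
   they weigh at least [3 * beta / 2], and rounding up after subtracting 3 gives [beta - 1] only
   from [beta = 3] on. *)
have b3 : 2 < beta.
  have : m <= \sum_v w v + #|Z|.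
    rewrite -sum_nat_mem /m -sum1_card -big_split; apply: leq_sum => v _ /=.
    by rewrite inE; case: (w v).
  nia.
pose w' v := w v + ((v \in Z) && ~~ F x v) - ((v \notin Z) && F x v).
have bal : \sum_v w' v + #|N x| <= \sum_v w v + #|Z|.
  rewrite -!sum_nat_mem -!big_split; apply: leq_sum => v _ /=.
  rewrite /w' !inE; case: (F x v); case: eqP => //=; lia.
have : m * (beta - 1) <= 3 * \sum_v w' v.
  apply: IH; first by lia.
  move=> a b c Kabc; have [kab kac kbc] := K_link x Kabc.
  have := wK _ _ _ Kabc.
  have {kab}: F x a -> F x b -> beta <= w a + w b.
    by move=> h1 h2; have := wK _ _ _ (kab h1 h2); rewrite wx.
  have {kac}: F x a -> F x c -> beta <= w a + w c.
    by move=> h1 h2; have := wK _ _ _ (kac h1 h2); rewrite wx.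
  have {kbc}: F x b -> F x c -> beta <= w b + w c.
    by move=> h1 h2; have := wK _ _ _ (kbc h1 h2); rewrite wx.
  rewrite /w' !inE.
  case: (F x a); case: (F x b); case: (F x c); rewrite ?andbT ?andbF /=;
    case: (w a); case: (w b); case: (w c) => /=; lia.
nia.
Qed.

End Cover.

(** * Balanced loads and closed tours *)

Definition wt (w : J -> nat) (t : J * J * J) := w t.1.1 + w t.1.2 + w t.2.

Lemma sum_occ (w : J -> nat) t : \sum_v w v * occ t v = wt w t.
Proof.
have s a : \sum_v w v * (a == v) = w a.
  rewrite (bigD1 a) //= eqxx muln1 big1 ?addn0 // => v.
  by rewrite eq_sym => /negPf->; rewrite muln0.
by rewrite /occ /wt -!s -!big_split; apply: eq_bigr => v _; rewrite !mulnDr.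
Qed.

(* Always adding a triangle of minimal load keeps the sum of squared loads close
   to its minimum, so all loads stay close to their average. *)
Lemma greedy_loads (C : pred (J * J * J)) :
  (forall t, C t -> zstep F t t) ->
  (forall w : J -> nat, exists2 t, C t & m * wt w t <= 3 * \sum_v w v) ->
  forall n, exists c : J * J * J -> nat,
    [/\ forall t, 0 < c t -> C t, \sum_t c t = n,
        \sum_v \sum_t c t * occ t v = 3 * n
      & m * \sum_v (\sum_t c t * occ t v) ^ 2 <= 9 * n ^ 2 + 3 * n * m].
Proof.
move=> Ctri Cmin; elim=> [|n [c [cC cn cl cq]]].
  by exists (fun=> 0); split; rewrite ?muln0 //; rewrite big1 ?muln0 // => v _; rewrite big1.
pose x v := \sum_t c t * occ t v.
have [t Ct tmin] := Cmin x.
exists (fun u => c u + (u == t)).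
have xE v : \sum_u (c u + (u == t)) * occ u v = x v + occ t v.
  have -> : occ t v = \sum_u (u == t) * occ u v.
    rewrite (bigD1 t) //= eqxx mul1n big1 ?addn0 // => u /negPf->.
    by rewrite mul0n.
  by rewrite -big_split; apply: eq_bigr => u _; rewrite mulnDl.
have sx : \sum_v x v = 3 * n by [].
have so : \sum_v occ t v = 3.
  transitivity (wt (fun=> 1) t) => //; rewrite -sum_occ.
  by apply: eq_bigr => v _; rewrite mul1n.
split.
- by move=> u; case: eqP => [->|_] //; rewrite addn0 => /cC.
- rewrite big_split /= cn (bigD1 t) //= eqxx big1 ?addn0 ?addn1 // => u /negPf-> //.
- by under eq_bigr => v _ do rewrite xE; rewrite big_split /= sx so; lia.
under eq_bigr => v _ do rewrite xE.
have -> : \sum_v (x v + occ t v) ^ 2 = \sum_v x v ^ 2 + 2 * wt x t + 3.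
  rewrite -so -sum_occ big_distrr -!big_split; apply: eq_bigr => v _ /=.
  have := occ_tri v (Ctri t Ct); move: (occ t v) => [|[|//]] _; lia.
(* The left side grows by [m * (2 * W + 3)], and [m * W <= 9 * n]; this is exactly what the right
   side allows. *)
move: cq tmin; rewrite -/m sx -/(x _); move: (wt x t) => W.
have -> : \sum_v (\sum_t c t * occ t v) ^ 2 = \sum_v x v ^ 2 by [].
nia.
Qed.

(** Chebyshev: the hypotheses bound the sum of the squares of [m * x u - 3 * n] by [3 * n * m ^ 2],
    hence each of them by [D ^ 2]. The squares are expanded to stay within the natural numbers. *)
Lemma load_balance (x : J -> nat) n D v :
  \sum_v x v = 3 * n -> m * \sum_v x v ^ 2 <= 9 * n ^ 2 + 3 * n * m ->
  3 * n * m ^ 2 <= D ^ 2 -> m * x v <= 3 * n + D.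
Proof.
move=> sx sq hD; rewrite leqNgt; apply/negP => lt.
have : \sum_u (6 * n * m * x u) + (D ^ 2).+1 <= \sum_u (m ^ 2 * x u ^ 2 + 9 * n ^ 2).
  rewrite (bigD1 v) //= [X in _ <= X](bigD1 v) //=.
  have : \sum_(u | u != v) (6 * n * m * x u) <=
         \sum_(u | u != v) (m ^ 2 * x u ^ 2 + 9 * n ^ 2).
    apply: leq_sum => u _; have [+ _] := nat_Cauchy (m * x u) (3 * n).
    by rewrite !expnMn; lia.
  have : 6 * n * m * x v + D ^ 2 + 1 <= m ^ 2 * x v ^ 2 + 9 * n ^ 2.
    rewrite -expnMn -[6 * n * m * x v]mulnA; move: (m * x v) lt => z lt.
    have [e ->] : exists e, z = 3 * n + D + 1 + e by exists (z - (3 * n + D + 1)); lia.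
    nia.
  lia.
rewrite -big_distrr /= sx big_split /= -big_distrr sum_nat_const -/m /=.
nia.
Qed.

Lemma estep_sym : symmetric (estep).
Proof.
move=> t u; rewrite /estep (zstep_sym (adj_sym F) t u).
by case: (zstep F t t); case: (zstep F u u).
Qed.

Lemma short_path t u : connect estep t u -> zstep F t t ->
  exists p, [/\ path estep t p, last t p = u, all (fun v => zstep F v v) p
             & size p <= #|{: J * J * J}|].
Proof.
move=> /connectP[p pp ->] tt; case/shortenP: pp => p' pp' up _.
exists p'; split=> //; last first.
  by apply: (@leq_trans (size (t :: p'))) => //; rewrite -(card_uniqP up) max_card.
elim: p' t tt pp' {up} => //= v p' IH t tt /andP[/and3P[_ vv _] h].
by rewrite vv; apply: IH h.
Qed.

(** For each triangle t with [c t > 0], walk from [t0] to t, repeat t [c t] times (a triangle may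
    follow itself) and walk back. Each of the two repetition-free walks adds at most the number of
    ordered triangles to any load. *)
Lemma tour t0 (c : J * J * J -> nat) : zstep F t0 t0 ->
  (forall t, 0 < c t -> connect estep t0 t) ->
  exists L, [/\ path estep t0 L, last t0 L = t0, \sum_t c t <= size L &
    forall v, load L v <= \sum_t c t * occ t v + 2 * #|{: J * J * J}| ^ 2].
Proof.
move=> tt cC; set B := #|{: J * J * J}|.
suff H (ts : seq (J * J * J)) : exists L, [/\ path estep t0 L, last t0 L = t0,
    \sum_(t <- ts) c t <= size L &
    forall v, load L v <= \sum_(t <- ts) c t * occ t v + size ts * (2 * B)].
  have [L [pL lL sL hL]] := H (index_enum (J * J * J)%type).
  exists L; split=> // v; apply: leq_trans (hL v) _; rewrite leq_add2l.
  have -> : size (index_enum (J * J * J)%type) = B.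
    by rewrite /B cardT enumT.
  lia.
elim: ts => [|t ts [L [pL lL sL hL]]].
  by exists [::]; split=> // [|v]; rewrite /load !big_nil.
case: (posnP (c t)) => [c0|c0].
  exists L; split=> // [|v]; first by rewrite big_cons c0.
  by rewrite big_cons c0 mul0n /=; have := hL v; lia.
have [p [pp lp ap sp]] := short_path (cC _ c0) tt.
have tt' := connect_tri tt (cC _ c0).
have [q [pq lq aq sq]] : exists p, [/\ path estep t p, last t p = t0,
    all (fun v => zstep F v v) p & size p <= #|{: J * J * J}|].
  by apply: short_path => //; rewrite (sym_connect_sym estep_sym) cC.
exists (p ++ nseq (c t) t ++ q ++ L).
have pn : path estep t (nseq (c t) t).
  by elim: (c t) => //= k ->; rewrite /estep tt' andbT.
have ln : last t (nseq (c t) t) = t by elim: (c t).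
split.
- by rewrite !cat_path pp lp pn ln pq lq pL.
- by rewrite !last_cat lp ln lq.
- by rewrite !size_cat size_nseq big_cons; lia.
move=> v; rewrite !load_cat big_cons /=.
have -> : load (nseq (c t) t) v = c t * occ t v.
  by rewrite /load big_nseq iter_addn_0 mulnC.
have := hL v; have := load_size v ap; have := load_size v aq.
rewrite -/B in sp sq *; lia.
Qed.

Lemma good_tour : 0 < m -> exists t0 : J * J * J,
  [/\ zstep F t0 t0, big t0.1.1, big t0.1.2 & forall n D, 3 * n * m ^ 2 <= D ^ 2 ->
    exists L, [/\ path estep t0 L, last t0 L = t0, n <= size L &
      forall v, m * load L v <= 3 * n + D + m * (2 * #|{: J * J * J}| ^ 2)]].
Proof.
move=> m0; have [t0 /and3P[tt ba bb]] := big_triangle m0.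
exists t0; split=> // n D hD.
have bab : big t0.1.1 && big t0.1.2 by rewrite ba bb.
pose C t := connect estep t0 t.
have Cmin (w : J -> nat) : exists2 t, C t & m * wt w t <= 3 * \sum_v w v.
  have [t Ct tmin] := @arg_minnP _ t0 C (wt w) (connect0 _ _).
  (* [beta] is the weight of a lightest triangle; weights ignore the order, so it is a lower bound
     on all of [in_comp t0]. *)
  exists t => //; apply: (@cover_bound (in_comp t0)).
  - exact: compC12.
  - exact: compC23.
  - by move=> a b d e; apply: comp_swap.
  - by move=> a b d; apply: comp_big.
  by move=> a b d; case/or4P => [|||/or3P[]] /tmin; rewrite /wt /=; lia.
have [c [cC cn cl cq]] := greedy_loads (connect_tri tt) Cmin n.
have [L [pL lL sL hL]] := tour tt cC.
exists L; split=> //; first by rewrite -cn.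
move=> v; have := load_balance v cl cq hD; have := hL v; nia.
Qed.

End GoodGraph.


(** * Complete multipartite subhypergraphs *)

Lemma subset_of_card (T : finType) (A : {set T}) s : (s <= #|A|)%N ->
  exists2 B : {set T}, B \subset A & #|B| = s.
Proof.
case/card_geqP => l [ul sl lA]; exists [set x in l].
  by apply/subsetP => x; rewrite inE => /lA.
by rewrite cardsE (card_uniqP ul).
Qed.

Lemma pigeonhole (X Y : finType) (h : X -> Y) (H : {set X}) (P : {set Y}) y0 :
  y0 \in P -> (forall x, x \in H -> h x \in P) ->
  exists2 y, y \in P & (#|H| <= #|P| * #|[set x in H | h x == y]|)%N.
Proof.
move=> y0P hP.
have [y yP ymax] := arg_maxnP (fun y => #|[set x in H | h x == y]|) y0P.
exists y => //; rewrite -sum1_card (partition_big h (mem P)) //=.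
rewrite -sum_nat_const; apply: leq_sum => z /ymax; apply: leq_trans.
by rewrite -sum1_card; apply/eq_leq/eq_bigl => x; rewrite inE.
Qed.

Section Product.
Variables (I T : finType).
Implicit Types (U : I -> {set T}) (f : {ffun I -> T}).

Definition fam U : {set {ffun I -> T}} := [set f : {ffun I -> T} | [forall i, f i \in U i]].

Definition upd f i a : {ffun I -> T} := [ffun j => if j == i then a else f j].

Lemma famP U f : reflect (forall i, f i \in U i) (f \in fam U).
Proof. by rewrite inE; apply: forallP. Qed.

Lemma upd_same f i a : upd f i a i = a.
Proof. by rewrite ffunE eqxx. Qed.

Lemma upd_other f i j a : j != i -> upd f i a j = f j.
Proof. by rewrite ffunE => /negPf->. Qed.

Lemma upd_id f i : upd f i (f i) = f.
Proof. by apply/ffunP => j; rewrite ffunE; case: eqP => [->|]. Qed.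

Lemma upd_upd f i a b : upd (upd f i a) i b = upd f i b.
Proof. by apply/ffunP => j; rewrite !ffunE; case: eqP. Qed.

Lemma upd_fam U f i a : f \in fam U -> a \in U i -> upd f i a \in fam U.
Proof.
move=> /famP fU aU; apply/famP => j; rewrite ffunE.
by case: eqP => [->|_].
Qed.

Lemma upd_famE U f i a : a \in U i -> f i \in U i ->
  (upd f i a \in fam U) = (f \in fam U).
Proof.
move=> aU fiU; apply/idP/idP => h; last exact: upd_fam.
by rewrite -(upd_id f i) -(upd_upd f i a); apply: upd_fam.
Qed.

(** Redrawing one coordinate preserves the uniform distribution on [fam U]: exchanging [f i] with
    the new value is an involution on pairs. *)
Lemma resample (V : nmodType) U i (F : {ffun I -> T} -> V) :
  ((\sum_(f in fam U) F f) *+ #|U i| =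
   \sum_(f in fam U) \sum_(a in U i) F (upd f i a))%R.
Proof.
rewrite pair_big /=.
pose h (p : {ffun I -> T} * T) := (upd p.1 i p.2, p.1 i).
have hK : involutive h.
  by move=> [f a]; rewrite /h /= upd_same upd_upd upd_id.
transitivity (\sum_(p : {ffun I -> T} * T | (p.1 \in fam U) && (p.2 \in U i)) F p.1)%R.
  rewrite -(pair_big (mem (fam U)) (mem (U i)) (fun f _ => F f)) /=.
  rewrite -sumrMnl; apply: eq_bigr => f _.
  by rewrite sumr_const.
rewrite (reindex_inj (inv_inj hK)) /=; apply: eq_bigl => -[f a] /=.
case: (boolP (a \in U i)) => aU; last first.
  rewrite andbF; apply/negbTE; apply: contra aU => /andP[/famP/(_ i)].
  by rewrite upd_same.
case: (boolP (f i \in U i)) => fU; first by rewrite upd_famE.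
by rewrite andbF andbT; apply/esym/negbTE; apply: contra fU => /famP.
Qed.

End Product.

Section Erdos.
Variable R : realType.
Local Open Scope ring_scope.

Lemma sum_indic (X : finType) (A B : {set X}) : A \subset B ->
  \sum_(x in B) (x \in A)%:R = #|A|%:R :> R.
Proof.
move=> AB; rewrite -sum1_card natr_sum [RHS]big_mkcond [LHS]big_mkcond /=.
apply: eq_bigr => x _; case: (boolP (x \in A)) => [/(subsetP AB)->|] //.
by case: ifP.
Qed.

(** Many values at [i] have fibres of density at least [c / 2]; a bounded number w of them is enough
    for a proportion [c / 4] of all f to be compatible with at least [s] of the w values. There are
    only [2 ^ w] possible sets of compatible values, so one of them is shared by a positive
    proportion. Members of [H'] retain a value at [i], to be overwritten, so that all densities
    refer to the same [fam U]. *)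
Lemma erdos_step (c : R) (s : nat) : 0 < c -> exists (c' : R) (N1 : nat), 0 < c' /\
  forall (I T : finType) (U : I -> {set T}) (H : {set {ffun I -> T}}) i,
    (N1 <= #|U i|)%N -> H \subset fam U -> c * #|fam U|%:R <= #|H|%:R ->
    exists (A : {set T}) (H' : {set {ffun I -> T}}),
      [/\ A \subset U i, #|A| = s, H' \subset fam U,
          c' * #|fam U|%:R <= #|H'|%:R
        & forall f a, f \in H' -> a \in A -> upd f i a \in H].
Proof.
move=> c0.
have [w ws] : exists w : nat, s%:R <= w%:R * (c / 4).
  exists (Num.bound (s%:R / (c / 4))).
  rewrite -ler_pdivrMr; last by lra.
  apply/ltW; have := @archi_boundP R (s%:R / (c / 4)).
  by apply; rewrite divr_ge0 ?ler0n //; lra.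
have [N1 hN1] : exists N1 : nat, w%:R <= N1%:R * (c / 2).
  exists (Num.bound (w%:R / (c / 2))).
  rewrite -ler_pdivrMr; last by lra.
  apply/ltW; have := @archi_boundP R (w%:R / (c / 2)).
  by apply; rewrite divr_ge0 ?ler0n //; lra.
exists (c / 4 / (2 ^ w)%:R), (maxn N1 (maxn w s)); split.
  by rewrite divr_gt0 ?ltr0n ?expn_gt0 //; lra.
move=> I T U H i; rewrite !geq_max => /and3P[N1U wU sU] HU Hc.
set n := #|fam U|%:R in Hc *; have n0 : 0 <= n by rewrite ler0n.
pose P y := [set f in fam U | upd f i y \in H].
have sumP (W : {set T}) : W \subset U i -> \sum_(y in W) #|P y|%:R =
    \sum_(f in fam U) #|[set y in W | upd f i y \in H]|%:R :> R.
  move=> WU; rewrite (eq_bigr (fun y => \sum_(f in fam U) (upd f i y \in H)%:R)).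
    rewrite exchange_big; apply: eq_bigr => f _ /=.
    rewrite -(@sum_indic _ _ W); last by apply/subsetP => y; rewrite inE => /andP[].
    by apply: eq_bigr => y yW; rewrite inE yW.
  move=> y _; rewrite -(@sum_indic _ _ (fam U)).
    by apply: eq_bigr => f fU; rewrite inE fU.
  by apply/subsetP => f; rewrite inE => /andP[].
have P_le y : #|P y|%:R <= n.
  by rewrite ler_nat subset_leq_card //; apply/subsetP => f; rewrite inE => /andP[].
have sumPU : \sum_(y in U i) #|P y|%:R = #|U i|%:R * #|H|%:R :> R.
  rewrite -[#|H|%:R](sum_indic HU) mulr_natl resample exchange_big.
  apply: eq_bigr => y yU; rewrite -(@sum_indic _ _ (fam U)).
    by apply: eq_bigr => f fU; rewrite inE fU.
  by apply/subsetP => f; rewrite inE => /andP[].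
pose Y := [set y in U i | c / 2 * n <= #|P y|%:R].
have YU : Y \subset U i by apply/subsetP => y; rewrite inE => /andP[].
have [W WY Ww] : exists2 W : {set T}, W \subset Y & #|W| = w.
  apply: subset_of_card; rewrite -(ler_nat R).
  case: (ltrP 0 n) => [n1|n1]; last first.
    have n00 : n = 0 by lra.
    have -> : Y = U i.
      by apply/setP => y; rewrite inE n00 mulr0 ler0n andbT.
    by rewrite ler_nat.
  have : #|U i|%:R * (c * n) <= #|Y|%:R * n + #|U i|%:R * (c / 2 * n).
    apply: (@le_trans _ _ (#|U i|%:R * #|H|%:R)); first by rewrite ler_wpM2l.
    rewrite -sumPU (big_setID Y) /= (setIidPr YU); apply: lerD.
      by rewrite mulr_natl -sumr_const; apply: ler_sum.
    apply: (@le_trans _ _ (\sum_(y in U i :\: Y) (c / 2 * n))).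
      apply: ler_sum => y; rewrite !inE => /andP[+ yU]; rewrite yU /=.
      by rewrite -ltNge => /ltW.
    rewrite sumr_const -(mulr_natl (c / 2 * n)); apply: ler_wpM2r.
      by rewrite mulr_ge0 //; lra.
    by rewrite ler_nat subset_leq_card // subsetDl.
  have : N1%:R * (c / 2) * n <= #|U i|%:R * (c / 2) * n.
    apply: ler_wpM2r => //; apply: ler_wpM2r; [lra | by rewrite ler_nat].
  have : w%:R * n <= N1%:R * (c / 2) * n by rewrite ler_wpM2r.
  move=> h1 h2 h3; rewrite -(ler_pM2r n1); lra.
pose D f := [set y in W | upd f i y \in H].
pose H1 := [set f in fam U | (s <= #|D f|)%N].
have H1n : c / 4 * n <= #|H1|%:R.
  have [w0|w0] := posnP w.
    have c4 : 0 < c / 4 by lra.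
    have s0 : s = 0%N.
      by move: ws; rewrite w0 mul0r lern0 => /eqP.
    have -> : H1 = fam U by apply/setP => f; rewrite inE s0 leq0n andbT.
    rewrite -/n; apply: le_trans (_ : #|H|%:R <= _); last by rewrite ler_nat subset_leq_card.
    by apply: le_trans Hc; apply: ler_wpM2r => //; lra.
  (* Count pairs of an f and a compatible value in [W]: an f in [H1] contributes at most w, any
     other at most [s]. *)
  have : w%:R * (c / 2 * n) <= w%:R * #|H1|%:R + s%:R * n.
    apply: (@le_trans _ _ (\sum_(y in W) #|P y|%:R)).
      rewrite -Ww mulr_natl -sumr_const; apply: ler_sum => y /(subsetP WY).
      by rewrite inE => /andP[].
    rewrite sumP ?(subset_trans WY) // (big_setID H1) /=.
    have -> : fam U :&: H1 = H1 by apply/setIidPr/subsetP => f; rewrite inE => /andP[].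
    apply: lerD.
      rewrite [_ * #|H1|%:R]mulrC mulr_natl -sumr_const; apply: ler_sum => f _.
      by rewrite -Ww ler_nat subset_leq_card //; apply/subsetP => y; rewrite inE => /andP[].
    apply: (@le_trans _ _ (\sum_(f in fam U :\: H1) s%:R)).
      apply: ler_sum => f; rewrite in_setD => /andP[+ fU]; rewrite inE fU /= -ltnNge => h.
      by rewrite ler_nat ltnW.
    rewrite sumr_const -(mulr_natr (s%:R)); apply: ler_wpM2l => //.
    by rewrite ler_nat subset_leq_card // subsetDl.
  have : s%:R * n <= w%:R * (c / 4) * n by rewrite ler_wpM2r.
  have wp : 0 < w%:R :> R by rewrite ltr0n.
  move=> h1 h2; rewrite -(ler_pM2l wp); lra.
have D_W f : f \in H1 -> D f \in powerset W.
  by move=> _; rewrite inE; apply/subsetP => y; rewrite inE => /andP[].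
have W0 : set0 \in powerset W by rewrite inE sub0set.
have [S SW hS] := pigeonhole W0 D_W.
rewrite card_powerset Ww in hS.
have WUi := subset_trans WY YU.
have main : c / 4 / (2 ^ w)%:R * n <= #|[set f in H1 | D f == S]|%:R.
  rewrite mulrAC ler_pdivrMr ?ltr0n ?expn_gt0 //.
  apply: le_trans H1n _; rewrite -natrM ler_nat mulnC.
  exact: hS.
(* By [main] the fibre can be empty only if [fam U] is empty, and then [H' = set0] will do. *)
have [fib0|[f fS]] := set_0Vmem [set f in H1 | D f == S].
  have [A AU As] : exists2 A : {set T}, A \subset U i & #|A| = s.
    exact: subset_of_card.
  exists A, set0; split => //; first exact: sub0set.
    by rewrite -fib0.
  by move=> f a; rewrite inE.
have [A AS As] : exists2 A : {set T}, A \subset S & #|A| = s.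
  apply: subset_of_card; move: fS; rewrite !inE => /andP[/andP[_ h] /eqP <-].
  exact: h.
exists A, [set f in H1 | D f == S]; split => //.
- by apply: subset_trans AS (subset_trans _ WUi); rewrite inE in SW.
- by apply/subsetP => g; rewrite !inE => /andP[/andP[]].
move=> g a; rewrite inE => /andP[_ /eqP gS] /(subsetP AS); rewrite -gS.
by rewrite inE => /andP[].
Qed.

(** [js] lists the coordinates that are to be enlarged; all others are frozen at a base point [f0],
    which is chosen at the end of the recursion, when [H] is only known to be non-empty. *)
Lemma erdos_list k (r : nat) (c : R) : 0 < c -> exists N0 : nat,
  forall (I T : finType) (U : I -> {set T}) (H : {set {ffun I -> T}}) (js : seq I),
    uniq js -> size js = k -> (forall i, N0 <= #|U i|)%N -> (0 < #|fam U|)%N ->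
    H \subset fam U -> c * #|fam U|%:R <= #|H|%:R ->
    exists (A : I -> {set T}) (f0 : {ffun I -> T}),
      (forall i, i \in js -> A i \subset U i /\ #|A i| = r) /\
        (forall g : {ffun I -> T}, (forall i, i \in js -> g i \in A i) ->
            (forall i, i \notin js -> g i = f0 i) -> g \in H).
Proof.
elim: k c => [|k IH] c c0.
  exists 0%N => I T U H [] // _ _ _ U0 HU Hc.
  have : (0 < #|H|)%N.
    rewrite -(ltr_nat R); apply: lt_le_trans Hc; rewrite mulr_gt0 // ltr0n //.
  case/card_gt0P => f fH; exists (fun=> set0), f; split=> // g _ gf.
  by rewrite (_ : g = f) //; apply/ffunP => i; apply: gf.
have [c' [N1 [c'0 hN1]]] := erdos_step r c0.
have [N0 hN0] := IH c' c'0.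
exists (maxn N0 N1) => I T U H [|i js] //= /andP[ijs ujs] [sjs] hU U0 HU Hc.
have hU0 j : (N0 <= #|U j|)%N by apply: leq_trans (leq_maxl _ _) (hU j).
have hU1 j : (N1 <= #|U j|)%N by apply: leq_trans (leq_maxr _ _) (hU j).
have [A [H' [AU Ar HU' Hc' hA]]] := hN1 I T U H i (hU1 i) HU Hc.
have [B [f0 [hB hg]]] := hN0 I T U H' js ujs sjs hU0 U0 HU' Hc'.
pose C j := if j == i then A else B j.
have Ci j : j \in js -> C j = B j.
  by rewrite /C; case: eqP => // -> h; rewrite h in ijs.
exists C, f0; split=> [j|g gC gf].
  rewrite inE; case/predU1P => [->|jjs]; first by rewrite /C eqxx.
  by rewrite Ci //; apply: hB.
(* By induction [g] with its value at [i] reset to [f0 i] lies in [H'], and [g i] belongs to [A]. *)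
rewrite -(upd_id g i) -(upd_upd g i (f0 i)); apply: hA; last first.
  by have := gC i (mem_head _ _); rewrite /C eqxx.
apply: hg => j jjs.
  have ji : j != i by apply: contraNneq ijs => <-.
  by rewrite upd_other // -Ci // gC // inE jjs orbT.
rewrite ffunE; case: eqP => [->//|/eqP ji]; apply: gf.
by rewrite inE negb_or ji.
Qed.

Lemma erdos_multipartite k (r : nat) (c : R) : 0 < c -> exists N0 : nat,
  forall (I T : finType) (U : I -> {set T}) (H : {set {ffun I -> T}}),
    #|I| = k -> (forall i, N0 <= #|U i|)%N -> (0 < #|fam U|)%N ->
    H \subset fam U -> c * #|fam U|%:R <= #|H|%:R ->
    exists A : I -> {set T},
      (forall i, A i \subset U i /\ #|A i| = r) /\ fam A \subset H.
Proof.
move=> c0; have [N0 hN0] := erdos_list k r c0.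
exists N0 => I T U H Ik hU U0 HU Hc.
have [A [f0 [hA hg]]] := hN0 I T U H (enum I) (enum_uniq _) (etrans (esym (cardE _)) Ik) hU U0 HU Hc.
exists A; split=> [i|]; first by apply: hA; rewrite mem_enum.
apply/subsetP => g /famP gA; apply: hg => i; first by move=> _; apply: gA.
by rewrite mem_enum.
Qed.

End Erdos.


(** * Random transversals *)

Section Sampling.
Variable R : realType.
Local Open Scope ring_scope.

Lemma markov4 (X : finType) (A : {set X}) (Z : X -> R) (E : R) : 0 < E ->
  (forall x, x \in A -> 0 <= Z x) -> \sum_(x in A) Z x <= E * #|A|%:R ->
  #|[set x in A | 4 * E < Z x]|%:R <= #|A|%:R / 4 :> R.
Proof.
move=> E0 Z0 sZ; set B := [set x in A | _].
have BA : B \subset A by apply/subsetP => x; rewrite inE => /andP[].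
have : \sum_(x in B) (4 * E) <= \sum_(x in A) Z x.
  rewrite [X in _ <= X](big_setID B) /= (setIidPr BA) -[X in X <= _]addr0.
  apply: lerD; last by apply: sumr_ge0 => x; rewrite inE => /andP[_ /Z0].
  by apply: ler_sum => x; rewrite inE => /andP[_ /ltW].
rewrite sumr_const -(mulr_natr (4 * E)) => h.
rewrite ler_pdivlMr // -(ler_pM2l E0); lra.
Qed.

Variables (T I : finType) (G : sgraph T).
Implicit Types (U S : I -> {set T}) (f : {ffun I -> T}).

Let N v := [set y | G v y].

(* If all [U i] have size [u], this is [#|I|] times the density of the neighbourhood
   of [v] in their union. *)
Definition mdeg U (u : nat) v : R := (\sum_i #|N v :&: U i|)%:R / u%:R.

Let y U u v i f : R := (G v (f i))%:R - #|N v :&: U i|%:R / u%:R.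

Definition dev U u v f : R := \sum_i y U u v i f.

Lemma devE U u v f : dev U u v f = #|[set i | G v (f i)]|%:R - mdeg U u v.
Proof.
rewrite /dev /y /mdeg sumrB natr_sum mulr_suml; congr (_ - _).
by rewrite -sum1_card natr_sum [RHS]big_mkcond /=; apply: eq_bigr => i _; rewrite inE; case: ifP.
Qed.

Section Uniform.
Variables (U : I -> {set T}) (u : nat).
Hypothesis u0 : (0 < u)%N.
Hypothesis cardU : forall i, #|U i| = u.

Let ur : 0 < u%:R :> R. Proof. by rewrite ltr0n. Qed.

Lemma y_le1 v i f : y U u v i f ^+ 2 <= 1.
Proof.
have : 0 <= #|N v :&: U i|%:R / u%:R :> R by rewrite divr_ge0.
have : #|N v :&: U i|%:R / u%:R <= 1 :> R.
  by rewrite ler_pdivrMr // mul1r ler_nat -(cardU i) subset_leq_card // subsetIr.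
by rewrite /y; case: (G _ _) => /=; nra.
Qed.

Lemma y_mean v i f : \sum_(a in U i) y U u v i (upd f i a) = 0.
Proof.
rewrite /y sumrB sumr_const cardU -(mulr_natr (_ / _)) divfK ?gt_eqF //.
apply/eqP; rewrite subr_eq0; apply/eqP.
rewrite -sum1_card natr_sum /= big_mkcond [RHS]big_mkcond /=; apply: eq_bigr => a _.
by rewrite upd_same !inE andbC; case: (a \in U i) => //=; case: (G v a).
Qed.

Lemma resample_zero (F : {ffun I -> T} -> R) i :
  (forall f, \sum_(a in U i) F (upd f i a) = 0) -> \sum_(f in fam U) F f = 0.
Proof.
move=> F0; have := resample U i F; rewrite [X in _ = X]big1 => [|f _]; last exact: F0.
by move/eqP; rewrite cardU mulrn_eq0 => /orP[/eqP u00|/eqP//]; have := u0; rewrite u00.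
Qed.

Lemma marginal (F : T -> R) i :
  \sum_(f in fam U) F (f i) = #|fam U|%:R / u%:R * \sum_(a in U i) F a.
Proof.
have := resample U i (fun f => F (f i)); rewrite cardU.
under [X in _ = X]eq_bigr => f _ do under eq_bigr => a _ do rewrite upd_same.
rewrite sumr_const -(mulr_natr (\sum_(f in _) _)) -[RHS]mulr_natl => h.
by rewrite mulrAC -h mulfK // gt_eqF.
Qed.

(** The vertex [p f] is either fixed or the chosen vertex [f k]. Of two different coordinates at
    least one is not [k]; redrawing it affects neither [p f] nor the other factor, and its own
    factor has mean zero. So only the diagonal terms remain. *)
Lemma second_moment (p : {ffun I -> T} -> T) k :
  (forall f i a, i != k -> p (upd f i a) = p f) ->
  \sum_(f in fam U) (dev U u (p f) f) ^+ 2 <= #|I|%:R * #|fam U|%:R.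
Proof.
move=> pk.
have sq f : dev U u (p f) f ^+ 2 =
    \sum_i \sum_j y U u (p f) i f * y U u (p f) j f.
  by rewrite expr2 /dev big_distrl /=; apply: eq_bigr => i _; rewrite big_distrr.
under eq_bigr => f _ do rewrite sq.
rewrite exchange_big /=.
have ortho i j : i != j -> i != k ->
    \sum_(f in fam U) y U u (p f) i f * y U u (p f) j f = 0.
  move=> ij ik; apply: (@resample_zero _ i) => f.
  transitivity ((\sum_(a in U i) y U u (p f) i (upd f i a)) * y U u (p f) j f).
    rewrite big_distrl; apply: eq_bigr => a _ /=; rewrite pk //; congr (_ * _).
    by rewrite /y upd_other // eq_sym.
  by rewrite y_mean mul0r.
have -> : #|I|%:R * #|fam U|%:R = \sum_(i : I) #|fam U|%:R :> R.
  by rewrite sumr_const mulr_natl.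
apply: ler_sum => i _; rewrite exchange_big (bigD1 i) //= [X in _ + X]big1 ?addr0.
  rewrite -sumr_const; apply: ler_sum => f _; rewrite -expr2; exact: y_le1.
move=> j ji; have [ik|ik] := eqVneq i k; last by apply: ortho; rewrite // eq_sym.
under eq_bigr => f _ do rewrite mulrC.
by apply: ortho; rewrite // -ik.
Qed.

(** The first bound makes the removal of blow-ups harmless, the second gives large degrees inside
    the transversal, and in the third [h] will be the drift accumulated by the strata. Each bound is
    four times a bound for the mean, so each fails for at most a quarter of the transversals. *)
Definition typical (h : T -> R) (Eh : R) f :=
  [&& \sum_v dev U u v f ^+ 2 <= 4 * (#|I|%:R * #|T|%:R),
      \sum_k dev U u (f k) f ^+ 2 <= 4 * (#|I|%:R * #|I|%:R)
    & \sum_k h (f k) <= 4 * Eh].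

Lemma typical_dense (h : T -> R) (Eh : R) : (0 < #|I|)%N -> (0 < #|T|)%N ->
  (forall v, 0 <= h v) -> 0 < Eh -> \sum_i \sum_(a in U i) h a <= Eh * u%:R ->
  #|fam U|%:R <= 4 * #|[set f in fam U | typical h Eh f]|%:R :> R.
Proof.
move=> I0 T0 h0 Eh0 sh.
have IT0 : 0 < #|I|%:R * #|T|%:R :> R by rewrite mulr_gt0 ?ltr0n.
have II0 : 0 < #|I|%:R * #|I|%:R :> R by rewrite mulr_gt0 ?ltr0n.
have [k0 _] : exists k0 : I, k0 \in I by apply/card_gt0P.
have b1 : \sum_(f in fam U) \sum_v dev U u v f ^+ 2 <=
    (#|I|%:R * #|T|%:R) * #|fam U|%:R.
  rewrite exchange_big /= mulrAC -[X in _ * X]sumr_const mulr_sumr.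
  by apply: ler_sum => v _; rewrite mulr1; apply: (second_moment (k := k0) (p := fun=> v)).
have b2 : \sum_(f in fam U) \sum_k dev U u (f k) f ^+ 2 <=
    (#|I|%:R * #|I|%:R) * #|fam U|%:R.
  rewrite exchange_big /= mulrAC -[X in _ * X]sumr_const mulr_sumr.
  apply: ler_sum => k _; rewrite mulr1.
  apply: (second_moment (k := k) (p := fun f => f k)) => f i a ik.
  by rewrite upd_other // eq_sym.
have b3 : \sum_(f in fam U) \sum_k h (f k) <= Eh * #|fam U|%:R.
  rewrite exchange_big /=; under eq_bigr => k _ do rewrite marginal.
  rewrite -mulr_sumr mulrAC ler_pdivrMr // mulrC mulrAC.
  by apply: ler_wpM2r.
have m1 := markov4 IT0 (fun f _ => sumr_ge0 _ (fun v _ => sqr_ge0 (dev U u v f))) b1.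
have m2 := markov4 II0 (fun f _ => sumr_ge0 _ (fun v _ => sqr_ge0 (dev U u (f v) f))) b2.
have m3 := markov4 Eh0 (fun f _ => sumr_ge0 _ (fun k _ => h0 (f k))) b3.
set B1 := [set _ in _ | _] in m1; set B2 := [set _ in _ | _] in m2.
set B3 := [set _ in _ | _] in m3; set H := [set _ in _ | _].
have : (#|fam U| <= #|H| + (#|B1| + (#|B2| + #|B3|)))%N.
  apply: (@leq_trans #|H :|: (B1 :|: (B2 :|: B3))|).
    apply: subset_leq_card; apply/subsetP => f fU.
    by have := fU; rewrite !inE => ->; rewrite /typical /= !ltNge; do 3!case: (_ <= _).
  do 2!(apply: leq_trans (leq_card_setU _ _) _; rewrite leq_add2l).
  exact: leq_card_setU.
rewrite -(ler_nat R) !natrD; lra.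
Qed.

Lemma typical_dev h Eh f (gamma : R) : 0 < gamma -> (0 < #|I|)%N ->
  4 <= gamma ^+ 2 * #|I|%:R -> typical h Eh f ->
  \sum_v `|dev U u v f| <= 2 * gamma * #|I|%:R * #|T|%:R.
Proof.
move=> g0 I0 gI /and3P[t1 _ _].
have M0 : 0 < #|I|%:R :> R by rewrite ltr0n.
have gM : 0 < gamma * #|I|%:R by rewrite mulr_gt0.
(* The arithmetic-geometric mean inequality, weighted so that [4 <= gamma ^+ 2 * #|I|%:R] makes both
   terms contribute equally at most. *)
have le (d : R) : `|d| <= gamma * #|I|%:R + d ^+ 2 / (gamma * #|I|%:R).
  rewrite -(ler_pM2r gM) mulrDl divfK ?gt_eqF // -(real_normK (num_real d)).
  have := sqr_ge0 (`|d| - gamma * #|I|%:R); have := normr_ge0 d; nra.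
apply: le_trans (ler_sum _ (fun v _ => le (dev U u v f))) _.
rewrite big_split /= sumr_const -(mulr_natr (_ * _)) -mulr_suml.
have : (\sum_v dev U u v f ^+ 2) / (gamma * #|I|%:R) <= gamma * #|I|%:R * #|T|%:R.
  rewrite ler_pdivrMr //; apply: le_trans t1 _.
  have T0 : 0 <= #|T|%:R :> R by [].
  have : 4 * (#|I|%:R * #|T|%:R) <= gamma ^+ 2 * #|I|%:R * (#|I|%:R * #|T|%:R) :> R.
    by apply: ler_wpM2r gI; rewrite mulr_ge0.
  by move=> h1; apply: le_trans h1 _; rewrite le_eqVlt; apply/orP; left; apply/eqP; ring.
lra.
Qed.

End Uniform.

(** [mdeg S s v] is the average over [fam S] of the number of neighbours of v in a transversal, so
    its distance from [mdeg U u v] is at most the average deviation. *)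
Lemma fam_dev U u S s (D : R) : (0 < s)%N -> (0 < #|fam S|)%N ->
  (forall i, #|S i| = s) ->
  (forall f, f \in fam S -> \sum_v `|dev U u v f| <= D) ->
  \sum_v `|mdeg S s v - mdeg U u v| <= D.
Proof.
move=> s0 famS cS hD.
have c0 : 0 < #|fam S|%:R :> R by rewrite ltr0n.
have avg v : (mdeg S s v - mdeg U u v) * #|fam S|%:R = \sum_(f in fam S) dev U u v f.
  under eq_bigr => f _ do rewrite devE.
  rewrite sumrB sumr_const -(mulr_natr (mdeg U u v)) mulrBl; congr (_ - _).
  have e f : #|[set i | G v (f i)]|%:R = \sum_i (G v (f i))%:R :> R.
    by rewrite -sum1_card natr_sum big_mkcond /=; apply: eq_bigr => i _; rewrite inE; case: ifP.
  under [RHS]eq_bigr => f _ do rewrite e.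
  rewrite exchange_big /=.
  under [RHS]eq_bigr => i _ do rewrite (marginal s0 cS (fun a => (G v a)%:R)).
  rewrite -mulr_sumr /mdeg natr_sum [LHS]mulrC [LHS]mulrCA [LHS]mulrC; congr (_ * _).
  apply: eq_bigr => i _; rewrite -sum1_card natr_sum /= big_mkcond [RHS]big_mkcond /=.
  by apply: eq_bigr => a _; rewrite !inE andbC; case: (a \in S i) => //=; case: (G v a).
rewrite -(ler_pM2r c0) mulr_suml.
apply: (@le_trans _ _ (\sum_v \sum_(f in fam S) `|dev U u v f|)).
  apply: ler_sum => v _; rewrite -[#|fam S|%:R](ger0_norm (ltW c0)) -normrM avg.
  exact: ler_norm_sum.
rewrite exchange_big /= mulr_natr -sumr_const.
by apply: ler_sum => f /hD.
Qed.

(** A quarter of all transversals are typical, and the most frequent of the [2 ^ (#|I| * #|I|)]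
    adjacency patterns retains the density that the multipartite theorem requires. As all members of
    [fam S] have the same pattern, any two clusters are joined completely or not at all. *)
Lemma typical_blowup (U : I -> {set T}) u s (h : T -> R) (Eh : R) :
  (forall i, #|U i| = u) -> (0 < u)%N -> (0 < s)%N ->
  (forall (H : {set {ffun I -> T}}), H \subset fam U ->
     ((4 * 2 ^ (#|I| * #|I|))%:R)^-1 * #|fam U|%:R <= #|H|%:R :> R ->
    exists A : I -> {set T},
      (forall i, A i \subset U i /\ #|A i| = s) /\ fam A \subset H) ->
  (0 < #|I|)%N -> (0 < #|T|)%N ->
  (forall v, 0 <= h v) -> 0 < Eh -> \sum_i \sum_(a in U i) h a <= Eh * u%:R ->
  exists (S : I -> {set T}) f,
    [/\ forall i, S i \subset U i, forall i, #|S i| = s, f \in fam S,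
        forall g, g \in fam S -> typical U u h Eh g
      & forall i j a b, i != j -> a \in S i -> b \in S j -> G a b = G (f i) (f j)].
Proof.
move=> cU u0 s0 erd I0 T0 h0 Eh0 sh.
have dens := typical_dense u0 cU I0 T0 h0 Eh0 sh.
set H := [set f in fam U | _] in dens.
pose ty (f : {ffun I -> T}) := [set p : I * I | G (f p.1) (f p.2)].
have [z _ hz] := @pigeonhole _ _ ty H setT set0 (in_setT _) (fun _ _ => in_setT _).
rewrite -powersetT card_powerset cardsT card_prod in hz.
set H' := [set x in H | ty x == z] in hz.
have H'U : H' \subset fam U by apply/subsetP => f; rewrite !inE => /andP[/andP[]].
have [|S [hS SH]] := erd H' H'U.
  rewrite ler_pdivrMl ?ltr0n ?muln_gt0 ?expn_gt0 //.
  apply: le_trans dens _; rewrite natrM -mulrA; apply: ler_wpM2l => //.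
  by rewrite -natrM ler_nat.
have cS i : #|S i| = s by case: (hS i).
have [pt hpt] : exists pt : {ffun I -> T}, pt \in fam S.
  have ne i : exists a, a \in S i by apply/card_gt0P; rewrite cS.
  exists [ffun i => xchoose (ne i)]; apply/famP => i; rewrite ffunE.
  exact: xchooseP.
exists S, pt; split=> //.
- by move=> i; case: (hS i).
- by move=> g /(subsetP SH); rewrite !inE => /andP[/andP[]].
move=> i j a b ij aS bS.
pose g := upd (upd pt i a) j b.
have gS : g \in fam S by rewrite !upd_fam.
have := subsetP SH _ gS; have := subsetP SH _ hpt.
rewrite !inE => /andP[_ /eqP e1] /andP[_ /eqP e2].
have : ((i, j) \in ty g) = ((i, j) \in ty pt) by rewrite e1 e2.
by rewrite !inE /= /g upd_same upd_other // upd_same.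
Qed.

End Sampling.


(** * Covering by blow-ups *)

Section Nibble.
Variable R : realType.
Local Open Scope ring_scope.

Lemma count_large (X : finType) (Z : X -> R) (a E : R) : (forall x, 0 <= Z x) ->
  0 <= a -> \sum_x Z x <= E -> #|[set x | a < Z x]|%:R * a <= E.
Proof.
move=> Z0 a0; apply: le_trans; rewrite mulr_natl -sumr_const.
rewrite [X in _ <= X](bigID (mem [set x | a < Z x])) /= -[X in X <= _]addr0.
apply: lerD; last exact: sumr_ge0.
by apply: ler_sum => x; rewrite inE => /ltW.
Qed.

Lemma sum_disjoint (I T : finType) (U : I -> {set T}) (h : T -> R) :
  (forall v, 0 <= h v) -> (forall i j v, v \in U i -> v \in U j -> i = j) ->
  \sum_i \sum_(a in U i) h a <= \sum_v h v.
Proof.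
move=> h0 dU; under eq_bigr => i _ do rewrite big_mkcond /=.
rewrite exchange_big; apply: ler_sum => v _ /=.
case: (pickP (fun i => v \in U i)) => [i vi|none]; last first.
  by rewrite big1 // => i _; rewrite none.
rewrite (bigD1 i) //= vi big1 ?addr0 // => j ji.
by case: ifP => // vj; rewrite (dU _ _ _ vi vj) eqxx in ji.
Qed.

Lemma card_bigcup_disjoint (T : finType) (B : nat -> {set T}) b s :
  (forall p, (p < b)%N -> #|B p| = s) ->
  (forall p q, (p < b)%N -> (q < b)%N -> p != q -> [disjoint B p & B q]) ->
  #|\bigcup_(p < b) B p| = (b * s)%N.
Proof.
elim: b => [|b IH] cB dB; first by rewrite big_ord0 cards0.
rewrite big_ord_recr /= cardsU (_ : _ :&: _ = set0) ?cards0 ?subn0.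
  rewrite IH ?cB // => [|p pb|p q pb qb]; first by rewrite mulSn addnC.
    by apply: cB; apply: leqW.
  by apply: dB; apply: leqW.
apply/eqP; rewrite setI_eq0 disjoint_sym; apply/bigcup_disjointP => p _.
by apply: dB; [|exact: leqW (ltn_ord p)|rewrite gtn_eqF].
Qed.

Definition full (T : finType) (G : sgraph T) (I : finType) (S : I -> {set T}) i j :=
  (i != j) && [forall a in S i, forall b in S j, G a b].

Variables (T : finType) (G : sgraph T) (M N : nat) (V : 'I_M -> {set T}).
Variables (eps g g1 : R) (s N0 : nat).
Hypotheses (M0 : (0 < M)%N) (N0' : (0 < N)%N) (s0 : (0 < s)%N) (T0 : (0 < #|T|)%N).
Hypothesis cV : forall i, #|V i| = N.
Hypothesis dV : forall i j v, v \in V i -> v \in V j -> i = j.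
Hypotheses (eps0 : 0 < eps) (g_gt0 : 0 < g) (g1_gt0 : 0 < g1).
Hypothesis TMN : (#|T| <= 2 * M * N)%N.
Hypothesis hg1 : 16 * g1 <= eps ^+ 2 * g ^+ 2.
Hypothesis Mg1 : 4 <= g1 ^+ 2 * M%:R.
Hypothesis Mg : 4 <= g ^+ 3 * M%:R.
Hypothesis NN0 : N0%:R <= eps * N%:R.
Hypothesis erd : forall (U : 'I_M -> {set T}) (H : {set {ffun 'I_M -> T}}),
  (forall i, N0 <= #|U i|)%N -> (0 < #|fam U|)%N -> H \subset fam U ->
  ((4 * 2 ^ (M * M))%:R)^-1 * #|fam U|%:R <= #|H|%:R :> R ->
  exists A : 'I_M -> {set T},
    (forall i, A i \subset U i /\ #|A i| = s) /\ fam A \subset H.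

(** Sampling deviation and drift of the strata each cost [g * M] in the degree of [a], and each
    excludes at most [g * M] indices from [J]. *)
Definition good_block (S : 'I_M -> {set T}) := exists J : {set 'I_M},
  (1 - 2 * g) * M%:R <= #|J|%:R /\
  forall k, k \in J -> exists2 a, a \in S k &
    mdeg R G V N a - 2 * g * M%:R <= #|[set l | full G S k l]|%:R.

Lemma nibble_step (U : 'I_M -> {set T}) u :
  (forall i, U i \subset V i) -> (forall i, #|U i| = u) -> eps * N%:R <= u%:R ->
  \sum_v `|mdeg R G U u v - mdeg R G V N v| <= 2 * g1 / eps * M%:R * #|T|%:R ->
  exists S : 'I_M -> {set T},
    [/\ forall i, S i \subset U i, forall i, #|S i| = s, good_block S
      & \sum_v `|mdeg R G S s v - mdeg R G U u v| <= 2 * g1 * M%:R * #|T|%:R].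
Proof.
move=> UV cU uN hh.
have Nr : 0 < N%:R :> R by rewrite ltr0n.
have Mr : 0 < M%:R :> R by rewrite ltr0n.
have Tr : 0 < #|T|%:R :> R by rewrite ltr0n.
have ur : 0 < u%:R :> R by apply: lt_le_trans uN; rewrite mulr_gt0.
have u0 : (0 < u)%N by rewrite -(ltr0n R).
set h := fun v => `|mdeg R G U u v - mdeg R G V N v|.
have h0 v : 0 <= h v by exact: normr_ge0.
(* Bounds the mean of the drift summed over a random transversal: the strata are disjoint, so the
   drift summed over them is at most the total drift. *)
pose Eh := 2 * g1 / eps * M%:R * #|T|%:R / u%:R.
have Eh0 : 0 < Eh by rewrite /Eh !mulr_gt0 ?invr_gt0.
have sh : \sum_i \sum_(a in U i) h a <= Eh * u%:R.
  rewrite /Eh divfK ?gt_eqF //; apply: le_trans hh; apply: sum_disjoint => //.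
  by move=> i j v /(subsetP (UV i)) + /(subsetP (UV j)); apply: dV.
have N0u : (N0 <= u)%N by rewrite -(ler_nat R); apply: le_trans uN.
have famU0 : (0 < #|fam U|)%N.
  have ne i : exists a, a \in U i by apply/card_gt0P; rewrite cU.
  apply/card_gt0P; exists [ffun i => xchoose (ne i)]; apply/famP => i.
  by rewrite ffunE; apply: xchooseP.
have [||S [f [SU cS fS typ hom]]] := @typical_blowup R T 'I_M G U u s h Eh cU u0 s0 _ _ T0 h0 Eh0 sh.
- by move=> H; rewrite card_ord; apply: erd => // i; rewrite cU.
- by rewrite card_ord.
have g1M : 4 <= g1 ^+ 2 * #|'I_M|%:R by rewrite card_ord.
have I0 : (0 < #|'I_M|)%N by rewrite card_ord.
exists S; split=> //; last first.
  apply: (fam_dev s0 _ cS) => [|x xS]; first by apply/card_gt0P; exists f.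
  have := typical_dev g1_gt0 I0 g1M (typ x xS).
  by rewrite card_ord.
have /and3P[_ tB tC] := typ f fS.
rewrite card_ord in tB.
have gM : 0 < g * M%:R by rewrite mulr_gt0.
have B1 := @count_large _ _ ((g * M%:R) ^+ 2) _ (fun k => sqr_ge0 (dev R G U u (f k) f)) (sqr_ge0 _) tB.
have B2 := @count_large _ _ (g * M%:R) _ (fun k => h0 (f k)) (ltW gM) tC.
set X1 := [set _ | _] in B1; set X2 := [set _ | _] in B2.
(* The origin of [Mg] and [hg1]: there are at most [4 / g ^+ 2] indices in [X1] and
   [4 * Eh / (g * M)] in [X2], where [Eh] is at most [4 * g1 * M ^+ 2 / eps ^+ 2]. *)
have c1 : #|X1|%:R <= g * M%:R.
  rewrite -(ler_pM2r (exprn_gt0 2 gM)); apply: le_trans B1 _.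
  rewrite -[_ * _ ^+ 2]exprS.
  have : 4 * M%:R ^+ 2 <= g ^+ 3 * M%:R * M%:R ^+ 2 by apply: ler_wpM2r; rewrite ?sqr_ge0.
  have -> : (g * M%:R) ^+ 3 = g ^+ 3 * M%:R * M%:R ^+ 2 by ring.
  by rewrite -expr2.
have c2 : #|X2|%:R <= g * M%:R.
  rewrite -(ler_pM2r gM); apply: le_trans B2 _.
  have TM : #|T|%:R <= 2 * M%:R * N%:R :> R by rewrite -!natrM ler_nat.
  have : Eh * (eps * N%:R) <= 2 * g1 / eps * M%:R * (2 * M%:R * N%:R).
    apply: (@le_trans _ _ (Eh * u%:R)); first by apply: ler_wpM2l => //; apply: ltW.
    rewrite /Eh divfK ?gt_eqF //; apply: ler_wpM2l => //.
    by rewrite !mulr_ge0 ?invr_ge0 // ltW.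
  have -> : 2 * g1 / eps * M%:R * (2 * M%:R * N%:R) = (4 * g1 / eps * M%:R ^+ 2) * N%:R by ring.
  rewrite mulrA ler_pM2r // -ler_pdivlMr // => hE.
  have : 4 * (4 * g1 / eps * M%:R ^+ 2 / eps) <= g ^+ 2 * M%:R ^+ 2.
    have -> : 4 * (4 * g1 / eps * M%:R ^+ 2 / eps) = 16 * g1 / eps ^+ 2 * M%:R ^+ 2.
      by field; rewrite gt_eqF.
    apply: ler_wpM2r; first exact: sqr_ge0.
    by rewrite ler_pdivrMr ?exprn_gt0 // (mulrC (g ^+ 2)).
  have -> : g * M%:R * (g * M%:R) = g ^+ 2 * M%:R ^+ 2 by ring.
  lra.
exists (~: (X1 :|: X2)); split.
  have : (M <= #|~: (X1 :|: X2)| + (#|X1| + #|X2|))%N.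
    rewrite -[X in (X <= _)%N]card_ord -(cardsC (X1 :|: X2)) addnC leq_add2l.
    exact: leq_card_setU.
  rewrite -(ler_nat R) !natrD; lra.
move=> k; rewrite !inE negb_or -!leNgt => /andP[kB kC].
exists (f k); first by move/famP: fS.
have kB' : `|dev R G U u (f k) f| <= g * M%:R.
  rewrite leNgt; apply/negP => lt; move: kB; apply/negP; rewrite -ltNge.
  rewrite -[X in _ < X](real_normK (num_real _)) ltr_pXn2r ?nnegrE //.
  exact: ltW.
have : (#|[set l | G (f k) (f l)]| <= #|[set l | full G S k l]|)%N.
  apply: subset_leq_card; apply/subsetP => l; rewrite !inE /full => kl.
  have kl' : k != l by apply/negP => /eqP e; rewrite e adj_irrefl in kl.
  rewrite kl' /=; apply/forallP => a; apply/implyP => aS.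
  by apply/forallP => b; apply/implyP => bS; rewrite (hom k l a b kl' aS bS).
move: kB' kC; rewrite devE /h -(ler_nat R) !ler_norml => /andP[+ _] /andP[+ _].
lra.
Qed.

Definition residual (B : nat -> 'I_M -> {set T}) b i :=
  V i :\: \bigcup_(p < b) B p i.

(* The neighbourhood densities drift by at most the same amount in each step, so
   the residual strata stay typical until few vertices are left. *)
Lemma nibble b : eps * N%:R <= N%:R - b%:R * s%:R ->
  exists B : nat -> 'I_M -> {set T},
    [/\ forall p i, (p < b)%N -> B p i \subset V i /\ #|B p i| = s,
        forall p q i, (p < b)%N -> (q < b)%N -> p != q -> [disjoint B p i & B q i],
        forall p, (p < b)%N -> good_block (B p)
      & \sum_v `|mdeg R G (residual B b) (N - b * s) v - mdeg R G V N v| <=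
          b%:R * (s%:R * (2 * g1 * M%:R * #|T|%:R) / (eps * N%:R))].
Proof.
have Nr : 0 < N%:R :> R by rewrite ltr0n.
have Mr : 0 < M%:R :> R by rewrite ltr0n.
have Tr : 0 < #|T|%:R :> R by rewrite ltr0n.
have eN : 0 < eps * N%:R by rewrite mulr_gt0.
elim: b => [|b IH] hb.
  exists (fun _ _ => set0); split=> //.
  rewrite mul0r big1 // => v _; rewrite /mdeg mul0n subn0.
  rewrite (eq_bigr (fun i => #|[set y | G v y] :&: V i|)) ?subrr ?normr0 // => i _.
  by rewrite /residual big_ord0 setD0.
have hb' : eps * N%:R <= N%:R - b%:R * s%:R.
  by apply: le_trans hb _; rewrite -natr1 mulrDl mul1r; have : 0 <= s%:R :> R by []; lra.
have [B [hB1 hB2 hB3 hB4]] := IH hb'.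
have bsN : (b.+1 * s <= N)%N.
  by rewrite -(ler_nat R) natrM; apply: ltW; lra.
set U := residual B b; set u := (N - b * s)%N.
have UV i : U i \subset V i by exact: subsetDl.
have cU i : #|U i| = u.
  rewrite cardsD cV (setIidPr _); last first.
    by apply/bigcupsP => p _; case: (hB1 p i (ltn_ord p)).
  rewrite (@card_bigcup_disjoint _ (fun p => B p i) b s) //.
    by move=> p pb; case: (hB1 p i pb).
  by move=> p q pb qb; apply: hB2.
have uN : eps * N%:R <= u%:R.
  by rewrite /u natrB ?natrM //; apply: leq_trans bsN; rewrite leq_mul2r leqnSn orbT.
have drift : \sum_v `|mdeg R G U u v - mdeg R G V N v| <= 2 * g1 / eps * M%:R * #|T|%:R.
  apply: le_trans hB4 _.
  (* The number of steps is at most [N / s], which cancels the factor [s / N] in the drift of a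
     single step. *)
  have bs : b%:R * s%:R <= N%:R :> R by lra.
  have -> : b%:R * (s%:R * (2 * g1 * M%:R * #|T|%:R) / (eps * N%:R)) =
            (b%:R * s%:R) * (2 * g1 / eps * M%:R * #|T|%:R / N%:R).
    by field; rewrite !gt_eqF.
  apply: le_trans (ler_wpM2r _ bs) _; first by rewrite !mulr_ge0 ?invr_ge0 // ltW.
  by rewrite mulrC divfK // gt_eqF.
have [S [SU cS gS hS]] := nibble_step UV cU uN drift.
have BS p i : (p < b)%N -> [disjoint B p i & S i].
  move=> pb; rewrite disjoint_subset; apply/subsetP => x xB; rewrite inE.
  apply/negP => /(subsetP (SU i)); rewrite /U /residual inE => /andP[/negP + _].
  by apply; apply/bigcupP; exists (Ordinal pb).
pose B' p := if p == b then S else B p.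
have B'b : B' b = S by rewrite /B' eqxx.
have B'p p : (p < b)%N -> B' p = B p by move=> pb; rewrite /B' ltn_eqF.
have U'E i : residual B' b.+1 i = U i :\: S i.
  rewrite /residual big_ord_recr /= B'b (eq_bigr (fun p : 'I_b => B p i)).
    by rewrite /U /residual setDDl.
  by move=> p _; rewrite B'p.
exists B'; split.
- move=> p i; rewrite ltnS leq_eqVlt => /predU1P[->|pb].
    by rewrite B'b cS; split=> //; apply: subset_trans (SU i) (UV i).
  by rewrite B'p //; apply: hB1.
- move=> p q i; rewrite ltnS leq_eqVlt => /predU1P[->|pb];
    rewrite ltnS leq_eqVlt => /predU1P[->|qb] pq.
  + by rewrite eqxx in pq.
  + by rewrite B'b (B'p _ qb) disjoint_sym; apply: BS.
  + by rewrite B'b (B'p _ pb); apply: BS.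
  by rewrite (B'p _ pb) (B'p _ qb); apply: hB2.
- move=> p; rewrite ltnS leq_eqVlt => /predU1P[->|pb]; first by rewrite B'b.
  by rewrite B'p //; apply: hB3.
have uu : (N - b.+1 * s)%N = (u - s)%N by rewrite /u mulSn addnC subnDA.
have su : (s <= u)%N.
  have bs0 : (b * s <= N)%N by apply: leq_trans bsN; rewrite leq_mul2r leqnSn orbT.
  by rewrite /u leq_subRL // addnC -mulSn.
have us : eps * N%:R <= u%:R - s%:R.
  rewrite /u natrB ?natrM; last by apply: leq_trans bsN; rewrite leq_mul2r leqnSn orbT.
  by move: hb; rewrite -natr1; lra.
have us0 : 0 < u%:R - s%:R :> R by apply: lt_le_trans us.
have ur : 0 < u%:R :> R by apply: lt_le_trans uN.
have sr : 0 < s%:R :> R by rewrite ltr0n.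
(* The density in [U] is the average, weighted by sizes, of the densities in [S] and in the rest. *)
have step v : mdeg R G (residual B' b.+1) (N - b.+1 * s) v - mdeg R G U u v =
    s%:R / (u%:R - s%:R) * (mdeg R G U u v - mdeg R G S s v).
  rewrite /mdeg uu natrB //.
  have -> : (\sum_i #|[set y | G v y] :&: residual B' b.+1 i|)%:R =
    (\sum_i #|[set y | G v y] :&: U i|)%:R - (\sum_i #|[set y | G v y] :&: S i|)%:R :> R.
    rewrite !natr_sum -sumrB; apply: eq_bigr => i _.
    rewrite U'E setIDA cardsD -setIA (setIidPr (SU i)) natrB //.
    by rewrite subset_leq_card // setIS.
  by field; rewrite !gt_eqF.
have sum_step : \sum_v `|mdeg R G (residual B' b.+1) (N - b.+1 * s) v - mdeg R G U u v| <=
    s%:R * (2 * g1 * M%:R * #|T|%:R) / (eps * N%:R).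
  under eq_bigr => v _ do rewrite step normrM distrC.
  rewrite -mulr_sumr ger0_norm; last by rewrite divr_ge0 // ltW.
  have D0 : 0 <= 2 * g1 * M%:R * #|T|%:R by rewrite !mulr_ge0 // ltW.
  apply: le_trans (ler_wpM2l _ hS) _; first by rewrite divr_ge0 // ltW.
  rewrite mulrAC; apply: ler_wpM2l; first by rewrite mulr_ge0 // ltW.
  by rewrite lef_pV2 ?posrE.
rewrite -natr1 mulrDl mul1r.
apply: le_trans (lerD hB4 sum_step); rewrite -big_split; apply: ler_sum => v _ /=.
by rewrite addrC; apply: le_trans (ler_normD _ _); rewrite addrA subrK.
Qed.

End Nibble.


(** * Chains of triangles between blow-ups *)

Lemma fam_ex (I T : finType) (U : I -> {set T}) : (forall i, 0 < #|U i|) ->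
  exists f, f \in fam U.
Proof.
move=> U0; have ne i : exists a, a \in U i by apply/card_gt0P.
exists [ffun i => xchoose (ne i)]; apply/famP => i.
by rewrite ffunE; apply: xchooseP.
Qed.

Definition complete (T : finType) (G : sgraph T) (A B : {set T}) :=
  [forall a in A, forall b in B, G a b].

Lemma completeP (T : finType) (G : sgraph T) (A B : {set T}) :
  reflect (forall a b, a \in A -> b \in B -> G a b) (complete G A B).
Proof.
apply: (iffP forallP) => [h a b aA bB|h a].
  by have /implyP/(_ aA)/forallP/(_ b)/implyP := h a; apply.
by apply/implyP => aA; apply/forallP => b; apply/implyP; apply: h.
Qed.

Lemma completeS (T : finType) (G : sgraph T) (A B A' B' : {set T}) :
  A' \subset A -> B' \subset B -> complete G A B -> complete G A' B'.
Proof.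
move=> /subsetP hA /subsetP hB /completeP h; apply/completeP => a b aA bB.
by apply: h; [apply: hA | apply: hB].
Qed.

Lemma complete_sym (T : finType) (G : sgraph T) : symmetric (complete G).
Proof.
move=> A B; apply/completeP/completeP => h a b aA bB; rewrite adj_sym; exact: h.
Qed.

Lemma three_disjoint_subsets (T : finType) (X Y Z : {set T}) r :
  #|X| = 3 * r -> #|Y| = 3 * r -> #|Z| = 3 * r ->
  exists X' Y' Z' : {set T},
    [/\ [/\ X' \subset X, Y' \subset Y & Z' \subset Z],
        [/\ #|X'| = r, #|Y'| = r & #|Z'| = r]
      & [/\ [disjoint X' & Y'], [disjoint X' & Z'] & [disjoint Y' & Z']]].
Proof.
move=> cX cY cZ.
have [X' XS cX'] : exists2 A : {set T}, A \subset X & #|A| = r.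
  by apply: subset_of_card; lia.
have [Y' YS cY'] : exists2 A : {set T}, A \subset Y :\: X' & #|A| = r.
  apply: subset_of_card; rewrite cardsD.
  have := subset_leq_card (subsetIr Y X'); lia.
have [Z' ZS cZ'] : exists2 A : {set T}, A \subset Z :\: (X' :|: Y') & #|A| = r.
  apply: subset_of_card; rewrite cardsD.
  have := subset_leq_card (subsetIr Z (X' :|: Y')).
  have [+ _] := leq_card_setU X' Y'; lia.
exists X', Y', Z'; move: YS ZS; rewrite !subsetD [[disjoint Z' & _]]disjoints_subset.
rewrite setCU subsetI -!disjoints_subset => /andP[? ?] /and3P[? ? ?].
by split; split; rewrite // disjoint_sym.
Qed.

Local Notation o k := (@Ordinal 8 k isT).

(* The blow-up of a chain of triangles leading from the edge (0,1) to the edge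
   (2,3) by replacing one vertex at a time:
   (0,1,5), (4,1,5), (4,1,6), (4,3,6), (4,3,7), (2,3,7). *)
Definition link (T : finType) (G : sgraph T) r (A B C D : {set T})
    (S : 'I_8 -> {set T}) : Prop :=
  [/\ forall i, #|S i| = r,
      [/\ S (o 0) \subset A, S (o 1) \subset B, S (o 2) \subset C & S (o 3) \subset D],
      [/\ [disjoint S (o 5) & S (o 6)], [disjoint S (o 5) & S (o 7)]
        & [disjoint S (o 6) & S (o 7)]] &
      [/\ complete G (S (o 4)) (S (o 1)) && complete G (S (o 4)) (S (o 3)),
          [&& complete G (S (o 5)) (S (o 0)), complete G (S (o 5)) (S (o 1)) &
              complete G (S (o 5)) (S (o 4))],
          [&& complete G (S (o 6)) (S (o 1)), complete G (S (o 6)) (S (o 4)) &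
              complete G (S (o 6)) (S (o 3))] &
          [&& complete G (S (o 7)) (S (o 4)), complete G (S (o 7)) (S (o 3)) &
              complete G (S (o 7)) (S (o 2))]]].

Section Connection.
Variable R : realType.
Local Open Scope ring_scope.

(** Since [P] ignores coordinate [k], redrawing that coordinate keeps [P], and a proportion [c] of
    the values yields [Q]. *)
Lemma extend_count (I T : finType) (U : I -> {set T}) k (c : R)
    (P Q : pred {ffun I -> T}) :
  (0 < #|U k|)%N -> (forall f a, P (upd f k a) = P f) ->
  (forall f, f \in fam U -> P f ->
     c * #|U k|%:R <= #|[set a in U k | Q (upd f k a)]|%:R) ->
  c * #|[set f in fam U | P f]|%:R <= #|[set f in fam U | P f && Q f]|%:R.
Proof.
move=> U0 Pk PQ.
have Ur : 0 < #|U k|%:R :> R by rewrite ltr0n.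
have sub (Z : pred {ffun I -> T}) : [set f in fam U | Z f] \subset fam U.
  by apply/subsetP => f; rewrite inE => /andP[].
rewrite -(ler_pM2r Ur) -(sum_indic R (sub P)) -(sum_indic R (sub (fun f => P f && Q f))).
rewrite [X in _ <= X]mulr_natr resample mulrAC mulr_sumr.
apply: ler_sum => f fU.
have -> : \sum_(a in U k) (upd f k a \in [set f in fam U | P f && Q f])%:R =
   (P f)%:R * #|[set a in U k | Q (upd f k a)]|%:R :> R.
  rewrite -(@sum_indic R _ _ (U k)); last by apply/subsetP => a; rewrite inE => /andP[].
  rewrite mulr_sumr; apply: eq_bigr => a aU; rewrite [upd f k a \in _]in_set upd_fam // Pk in_set aU /=.
  by case: (P f); case: (Q _); rewrite /= ?mulr0 ?mul0r ?mulr1.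
rewrite in_set fU /=; move: (PQ f fU); case: (P f) => [/(_ isT)|_]; last by rewrite mulr0 mul0r.
by rewrite mulr1 mul1r.
Qed.

(** A random choice of vertices 4 to 7 succeeds with probability at least [eta ^+ 4]: three big
    vertices have at least 3 eta n common neighbours, of which W removes at most eta n / 2. Vertex 4
    must itself be big to serve in the later steps; 1 and 3 have at least (1/3 + 2 eta) n common
    neighbours, at most n / 3 of them not big. *)
Lemma connection (eta : R) (r : nat) : 0 < eta ->
  exists N0 : nat, forall (T : finType) (G : sgraph T) (A B C D W : {set T}),
  let n := #|T| in
  let bigv := [set v | (2 / 3 + eta) * n%:R <= (degree G v)%:R] in
  (3 * #|~: bigv| <= n)%N -> #|W|%:R <= eta / 2 * n%:R -> (N0 <= #|~: W|)%N ->
  (N0 <= #|A|)%N -> (N0 <= #|B|)%N -> (N0 <= #|C|)%N -> (N0 <= #|D|)%N ->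
  A :|: B :|: C :|: D \subset bigv ->
  exists2 S : 'I_8 -> {set T}, link G r A B C D S &
    forall i : 'I_8, (3 < i)%N -> [disjoint S i & W].
Proof.
move=> e0; have e40 : 0 < eta ^+ 4 by rewrite exprn_gt0.
(* Sets 5, 6 and 7 all come from the complement of W and may overlap; triple size leaves room for
   disjoint subsets of size [r]. *)
have [N0 hN0] := erdos_multipartite 8 (3 * r) e40.
exists (maxn N0 1) => T G A B C D W n bigv smallc Wc.
rewrite !geq_max => /andP[W0 W1] /andP[A0 A1] /andP[B0 B1] /andP[C0 C1] /andP[D0 D1] big.
pose U (i : 'I_8) := nth set0 [:: A; B; C; D; ~: W; ~: W; ~: W; ~: W] i.
have Uc (P : {set T} -> Prop) : P A -> P B -> P C -> P D -> P (~: W) -> forall i, P (U i).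
  by move=> pA pB pC pD pW [[|[|[|[|[|[|[|[|//]]]]]]]] i] /=.
have U1 i : (0 < #|U i|)%N by apply: (Uc (fun X => (0 < #|X|)%N)).
have U0 i : (N0 <= #|U i|)%N by apply: (Uc (fun X => (N0 <= #|X|)%N)).
have [f0 f0U] := fam_ex U1.
have nr : 0 <= n%:R :> R by [].
have NW : #|~: W|%:R <= n%:R :> R by rewrite ler_nat max_card.
pose N v := [set y | G v y].
have Nb v : v \in bigv -> (2 / 3 + eta) * n%:R <= #|N v|%:R by rewrite inE.
have capI (X Y : {set T}) : #|X|%:R + #|Y|%:R - n%:R <= #|X :&: Y|%:R :> R.
  rewrite lerBlDr -!natrD ler_nat; exact: card_setI_ge.
have capW (X : {set T}) : #|X|%:R - #|W|%:R <= #|X :&: ~: W|%:R :> R.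
  rewrite lerBlDr -natrD ler_nat -setDE -{1}(cardsID W X) addnC leq_add2l.
  exact: subset_leq_card (subsetIr _ _).
have capB (X : {set T}) : #|X|%:R - n%:R / 3 <= #|X :&: bigv|%:R :> R.
  have h : #|X|%:R <= #|X :&: bigv|%:R + #|~: bigv|%:R :> R.
    rewrite -natrD ler_nat -{1}(cardsID bigv X) leq_add2l setDE.
    exact: subset_leq_card (subsetIr _ _).
  have : 3 * #|~: bigv|%:R <= n%:R :> R by rewrite -natrM ler_nat.
  lra.
have fb f : f \in fam U -> [/\ f (o 0) \in bigv, f (o 1) \in bigv, f (o 2) \in bigv & f (o 3) \in bigv].
  move=> /famP fU; have := (fU (o 0), fU (o 1), fU (o 2), fU (o 3)); rewrite /U /=.
  by move=> [[[h1 h2] h3] h4]; split; apply: (subsetP big); rewrite !in_setU ?h1 ?h2 ?h3 ?h4 ?orbT.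
have common3 x y z : x \in bigv -> y \in bigv -> z \in bigv ->
    eta * #|~: W|%:R <= #|(N x :&: N y :&: N z) :&: ~: W|%:R.
  move=> /Nb hx /Nb hy /Nb hz.
  have := capI (N x) (N y); have := capI (N x :&: N y) (N z).
  have := capW (N x :&: N y :&: N z).
  have : eta * #|~: W|%:R <= eta * n%:R by rewrite ler_pM2l.
  nra.
pose Q4 (f : {ffun 'I_8 -> T}) :=
  [&& f (o 4) \in bigv, G (f (o 1)) (f (o 4)) & G (f (o 3)) (f (o 4))].
pose Q5 (f : {ffun 'I_8 -> T}) :=
  [&& G (f (o 0)) (f (o 5)), G (f (o 1)) (f (o 5)) & G (f (o 4)) (f (o 5))].
pose Q6 (f : {ffun 'I_8 -> T}) :=
  [&& G (f (o 1)) (f (o 6)), G (f (o 4)) (f (o 6)) & G (f (o 3)) (f (o 6))].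
pose Q7 (f : {ffun 'I_8 -> T}) :=
  [&& G (f (o 4)) (f (o 7)), G (f (o 3)) (f (o 7)) & G (f (o 2)) (f (o 7))].
have s4 : eta * #|[set f in fam U | predT f]|%:R <= #|[set f in fam U | predT f && Q4 f]|%:R.
  apply: (@extend_count _ _ U (o 4)) => // f /fb[b0 b1 b2 b3] _.
  apply: (@le_trans _ _ #|(N (f (o 1)) :&: N (f (o 3))) :&: bigv :&: ~: W|%:R).
    have := Nb _ b1; have := Nb _ b3; have := capI (N (f (o 1))) (N (f (o 3))).
    have := capB (N (f (o 1)) :&: N (f (o 3))).
    have := capW (N (f (o 1)) :&: N (f (o 3)) :&: bigv).
    have : eta * #|~: W|%:R <= eta * n%:R by rewrite ler_pM2l.
    rewrite /U /=; nra.
  rewrite ler_nat; apply: subset_leq_card; apply/subsetP => a.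
  rewrite !inE /U /= /Q4 upd_same !upd_other // => /andP[/andP[/andP[-> ->] ab] ->].
  by rewrite /= inE ab.
have s5 : eta * #|[set f in fam U | predT f && Q4 f]|%:R <=
    #|[set f in fam U | (predT f && Q4 f) && Q5 f]|%:R.
  apply: (@extend_count _ _ U (o 5)) => // [f a|f /fb[b0 b1 b2 b3] /andP[_ /and3P[b4 _ _]]].
    by rewrite /Q4 !upd_other.
  apply: le_trans (common3 _ _ _ b0 b1 b4) _.
  rewrite ler_nat; apply: subset_leq_card; apply/subsetP => a.
  by rewrite !inE /U /= /Q5 upd_same !upd_other // -!andbA => /and4P[-> -> -> ->].
have s6 : eta * #|[set f in fam U | (predT f && Q4 f) && Q5 f]|%:R <=
    #|[set f in fam U | ((predT f && Q4 f) && Q5 f) && Q6 f]|%:R.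
  apply: (@extend_count _ _ U (o 6)) => // [f a|f /fb[b0 b1 b2 b3] /andP[/andP[_ /and3P[b4 _ _]] _]].
    by rewrite /Q4 /Q5 !upd_other.
  apply: le_trans (common3 _ _ _ b1 b4 b3) _.
  rewrite ler_nat; apply: subset_leq_card; apply/subsetP => a.
  by rewrite !inE /U /= /Q6 upd_same !upd_other // -!andbA => /and4P[-> -> -> ->].
have s7 : eta * #|[set f in fam U | ((predT f && Q4 f) && Q5 f) && Q6 f]|%:R <=
    #|[set f in fam U | (((predT f && Q4 f) && Q5 f) && Q6 f) && Q7 f]|%:R.
  apply: (@extend_count _ _ U (o 7)) => // [f a|f /fb[b0 b1 b2 b3] /andP[/andP[/andP[_ /and3P[b4 _ _]] _] _]].
    by rewrite /Q4 /Q5 /Q6 !upd_other.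
  apply: le_trans (common3 _ _ _ b4 b3 b2) _.
  rewrite ler_nat; apply: subset_leq_card; apply/subsetP => a.
  by rewrite !inE /U /= /Q7 upd_same !upd_other // -!andbA => /and4P[-> -> -> ->].
set H := [set f in fam U | _ && Q7 f] in s7.
have HU : H \subset fam U by apply/subsetP => f; rewrite inE => /andP[].
have Hd : eta ^+ 4 * #|fam U|%:R <= #|H|%:R.
  have e : [set f in fam U | predT f] = fam U by apply/setP => f; rewrite inE andbT.
  rewrite e in s4; apply: le_trans s7; rewrite exprS -mulrA ler_pM2l //.
  apply: le_trans s6; rewrite exprS -mulrA ler_pM2l //.
  by apply: le_trans s5; rewrite exprS -mulrA ler_pM2l.
have [|S0 [hS0 S0H]] := hN0 'I_8 T U H (card_ord 8) U0 _ HU Hd.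
  by apply/card_gt0P; exists f0.
have cS0 i : #|S0 i| = (3 * r)%N by case: (hS0 i).
have [S [SS cS dS]] : exists S : 'I_8 -> {set T}, [/\ forall i, S i \subset S0 i,
    forall i, #|S i| = r & [/\ [disjoint S (o 5) & S (o 6)], [disjoint S (o 5) & S (o 7)]
          & [disjoint S (o 6) & S (o 7)]]].
  have [X5 [X6 [X7 [[h5 h6 h7] [c5 c6 c7] dX]]]] :=
    three_disjoint_subsets (cS0 (o 5)) (cS0 (o 6)) (cS0 (o 7)).
  have sub i : exists2 X : {set T}, X \subset S0 i & #|X| = r.
    by apply: subset_of_card; rewrite cS0 leq_pmull.
  have [X0 h0 c0] := sub (o 0); have [X1 h1 c1] := sub (o 1).
  have [X2 h2 c2] := sub (o 2); have [X3 h3 c3] := sub (o 3).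
  have [X4 h4 c4] := sub (o 4).
  exists (fun i : 'I_8 => nth set0 [:: X0; X1; X2; X3; X4; X5; X6; X7] i).
  have ordE k (i j : (k < 8)%N) : Ordinal i = Ordinal j by apply: val_inj.
  split=> //; move=> [[|[|[|[|[|[|[|[|//]]]]]]]] i] //=; by rewrite (ordE _ i isT).
have SU i : S i \subset U i by apply: subset_trans (SS i) _; case: (hS0 i).
have adjS (i j : 'I_8) : i != j -> (forall f, f \in H -> G (f i) (f j)) ->
    complete G (S j) (S i).
  move=> ij hG; apply/completeP => b a bS aS; rewrite adj_sym.
  have r0 : (0 < r)%N by rewrite -(cS j); apply/card_gt0P; exists b.
  have [f fS] := @fam_ex _ _ S (fun i => eq_ind_r (fun k => 0 < k)%N r0 (cS i)).
  have gS : upd (upd f i a) j b \in fam S by rewrite !upd_fam.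
  have gH : upd (upd f i a) j b \in H.
    by apply: (subsetP S0H); apply/famP => k; apply: (subsetP (SS k)); move/famP: gS.
  by have := hG _ gH; rewrite upd_same upd_other // upd_same.
have HQ f : f \in H -> [/\ Q4 f, Q5 f, Q6 f & Q7 f].
  by rewrite in_set => /andP[_ /andP[/andP[/andP[/andP[_ ->] ->] ->] ->]].
exists S; last first.
  move=> i i3; rewrite disjoints_subset; apply: subset_trans (SU i) _.
  by case: i i3 => [[|[|[|[|[|[|[|[|?]]]]]]]] ?] ?; rewrite /U /=.
split=> //; split; do ?[apply/andP; split | apply/and3P; split]; apply: adjS => // f /HQ[];
    by rewrite /Q4 /Q5 /Q6 /Q7 => /and3P[? ? ?] /and3P[? ? ?] /and3P[? ? ?] /and3P[? ? ?].
Qed.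

End Connection.


(** * From closed walks on clusters to triangle cycles *)

Section Embedding.
Local Open Scope nat_scope.

Definition proj (A : Type) (t : A * A * A) (j : 'I_3) : A :=
  nth t.2 [:: t.1.1; t.1.2] j.

Lemma zstep_proj (A : Type) (e : A -> A -> bool) t u j j' :
  zstep e t u -> j != j' -> e (proj t j) (proj u j').
Proof.
case: t u => [[a b] c] [[a' b'] c'] /= /and5P[h1 h2 h3 h4 /andP[h5 h6]].
by case: j j' => [[|[|[|//]]] ?] [[|[|[|//]]] ?].
Qed.

Lemma cycle_nth (A : Type) (e : rel A) (L : seq A) x0 i :
  cycle e L -> i < size L -> e (nth x0 L i) (nth x0 L (i.+1 %% size L)).
Proof.
case: L => // x p /= /(pathP x0) h il.
have := h i; rewrite size_rcons => /(_ il).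
rewrite -rcons_cons !nth_rcons /= il; rewrite ltnS leq_eqVlt in il.
case/predU1P: il => [->|ip]; first by rewrite ltnn eqxx modnn.
by rewrite ip modn_small.
Qed.

(** A position receives the element of its set whose index is that of the position among all
    positions with the same label. *)
Lemma inject_labels (P T : finType) (A : eqType) (phi : P -> A) (S : A -> {set T}) (x0 : T) :
  (forall p, #|[set q | phi q == phi p]| <= #|S (phi p)|) ->
  (forall p q, phi p != phi q -> [disjoint S (phi p) & S (phi q)]) ->
  exists2 f : P -> T, injective f & forall p, f p \in S (phi p).
Proof.
move=> cS dS.
pose ix p := index p (enum [set q | phi q == phi p]).
have ixlt p : ix p < size (enum (S (phi p))).
  rewrite -cardE; apply: leq_trans (cS p).
  by rewrite /ix cardE index_mem mem_enum inE.
have fS p : nth x0 (enum (S (phi p))) (ix p) \in S (phi p).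
  by rewrite -mem_enum mem_nth.
exists (fun p => nth x0 (enum (S (phi p))) (ix p)) => // p q e.
have phi_eq : phi p = phi q.
  apply/eqP; apply/negPn/negP => /dS; rewrite disjoint_subset => /subsetP/(_ _ (fS p)).
  by rewrite inE e fS.
move: e; rewrite /= phi_eq => /eqP; rewrite nth_uniq ?enum_uniq //; last first.
  by rewrite -phi_eq.
move=> /eqP; rewrite /ix phi_eq => e.
rewrite -(@nth_index _ p p (enum [set q' | phi q' == phi q])); last first.
  by rewrite mem_enum inE phi_eq.
by rewrite e nth_index // mem_enum inE.
Qed.

Lemma load_nth (A : eqType) (L : seq (A * A * A)) t0 a :
  #|[set p : 'I_(size L) * 'I_3 | proj (nth t0 L p.1) p.2 == a]| = load L a.
Proof.
rewrite -sum1_card big_mkcond /= /load (big_nth t0) big_mkord.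
transitivity (\sum_(i < size L) \sum_(j < 3) (proj (nth t0 L i) j == a : nat)).
  by rewrite pair_bigA /=; apply: eq_bigr => p _; rewrite inE; case: (_ == a).
apply: eq_bigr => i _; rewrite !big_ord_recl big_ord0 /proj /= /occ.
by rewrite addn0 addnA.
Qed.

Lemma embed_tricycle (A : eqType) (T : finType) (G : sgraph T)
    (S : A -> {set T}) (L : seq (A * A * A)) :
  0 < size L ->
  cycle (zstep (fun a b => complete G (S a) (S b))) L ->
  all (fun t => zstep (fun a b => complete G (S a) (S b)) t t) L ->
  (forall a, load L a <= #|S a|) ->
  (forall a b, 0 < load L a -> 0 < load L b -> a != b -> [disjoint S a & S b]) ->
  contains G (tricycle (size L)).
Proof.
move=> L0 cyc tri ld dS.
have [t0 Lt0] : exists t0, t0 \in L by case: L L0 {cyc tri ld dS} => // t; exists t; rewrite mem_head.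
pose phi (p : 'I_(size L) * 'I_3) := proj (nth t0 L p.1) p.2.
have lphi p : 0 < load L (phi p).
  by rewrite -(load_nth L t0); apply/card_gt0P; exists p; rewrite inE.
have [x0 _] : exists x0, x0 \in S (phi (Ordinal L0, ord0)).
  by apply/card_gt0P; apply: leq_trans (lphi _) (ld _).
have [|p q pq|f finj fS] := @inject_labels _ _ _ phi S x0.
- by move=> p; apply: leq_trans (ld _); rewrite -(load_nth L t0).
- by apply: dS.
exists f => // x y /andP[xy].
have key u v : zstep (fun a b => complete G (S a) (S b)) (nth t0 L u) (nth t0 L v) ->
   forall (hu : u = x.1) (hv : v = y.1), G (f x) (f y).
  move=> st hu hv; have := zstep_proj st xy; rewrite hu hv => /completeP; apply; exact: fS.
case/or3P => /eqP e.
- apply: (key x.1 y.1) => //; rewrite e; apply: (allP tri); exact: mem_nth.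
- apply: (key x.1 y.1) => //; rewrite e /=; apply: cycle_nth => //.
- apply: (key x.1 y.1) => //; rewrite e /= zstep_sym; last by move=> a b; exact: complete_sym.
  apply: cycle_nth => //.
Qed.

End Embedding.


(** * Disjoint choice of the chains and concatenation of walks *)

Section Avoidance.
Local Open Scope nat_scope.

Lemma card_bigcup_le (I T : finType) (P : pred I) (F : I -> {set T}) :
  #|\bigcup_(i | P i) F i| <= \sum_(i | P i) #|F i|.
Proof.
elim/big_rec2: _ => [|i k A _ IH]; first by rewrite cards0.
by have [+ _] := leq_card_setU (F i) A; lia.
Qed.

Lemma sum_card_disjoint (C T : finType) (S : C -> {set T}) (X : {set T}) :
  (forall c c', c != c' -> [disjoint S c & S c']) ->
  \sum_c #|S c :&: X| <= #|X|.
Proof.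
move=> dS.
rewrite (eq_bigr (fun c => \sum_(x in X) (x \in S c : nat))); last first.
  move=> c _; rewrite -sum1_card big_mkcond [RHS]big_mkcond /=.
  by apply: eq_bigr => x _; rewrite inE andbC; case: (x \in X); case: (x \in S c).
rewrite exchange_big -sum1_card; apply: leq_sum => x _ /=.
case: (pickP (fun c => x \in S c)) => [c xc|none]; last first.
  by rewrite big1 // => c _; rewrite none.
rewrite (bigD1 c) //= xc big1 // => c' cc'.
by rewrite (disjointFr (dS _ _ _) xc) // eq_sym.
Qed.

(* Clusters that have already lost [z] vertices are avoided from then on, and
   there are few of them. *)
Lemma greedy_avoid (T C : finType) (Q : nat -> {set T} -> Prop) (main : C -> {set T})
    (Res : {set T}) b e y z w :
  (forall c c', c != c' -> [disjoint main c & main c']) ->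
  (forall c, #|main c| <= y * z) ->
  (forall p (W : {set T}), p < b -> #|W| <= w ->
     exists E, [/\ Q p E, #|E| <= e & [disjoint E & W]]) ->
  #|Res| + e * b + y * (e * b) <= w ->
  exists E : nat -> {set T},
    [/\ forall p, p < b -> Q p (E p) /\ [disjoint E p & Res],
        forall p p', p < b -> p' < b -> p != p' -> [disjoint E p & E p']
      & forall c, #|main c :&: \bigcup_(p < b) E p| <= z + e].
Proof.
move=> dm cm hQ hw.
suff H j : j <= b -> exists E : nat -> {set T},
    [/\ forall p, p < j -> Q p (E p) /\ [disjoint E p & Res],
        forall p p', p < j -> p' < j -> p != p' -> [disjoint E p & E p'],
        #|\bigcup_(p < j) E p| <= e * j
      & forall c, #|main c :&: \bigcup_(p < j) E p| <= z + e].
  by have [E [h1 h2 _ h4]] := H b (leqnn b); exists E.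
elim: j => [|j IH] jb.
  exists (fun=> set0); split=> //; first by rewrite big_ord0 cards0.
  by move=> c; rewrite big_ord0 setI0 cards0.
have [E [hE dE cE lE]] := IH (ltnW jb).
set X := \bigcup_(p < j) E p in cE lE.
pose D := \bigcup_(c | z <= #|main c :&: X|) main c.
(* The at most [y * z] vertices of an avoided cluster are charged to the at least [z] vertices it
   has lost, [y] to each. *)
have cD : #|D| <= y * #|X|.
  apply: (@leq_trans (\sum_(c | z <= #|main c :&: X|) #|main c|)).
    exact: card_bigcup_le.
  apply: (@leq_trans (\sum_c y * #|main c :&: X|)).
    rewrite [X in _ <= X](bigID (fun c => z <= #|main c :&: X|)) /=.
    apply: leq_trans (leq_addr _ _); apply: leq_sum => c zc.
    by apply: leq_trans (cm c) _; rewrite leq_mul2l zc orbT.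
  by rewrite -big_distrr /= leq_mul2l sum_card_disjoint ?orbT.
have [E' [QE' cE' dE']] : exists E', [/\ Q j E', #|E'| <= e & [disjoint E' & Res :|: X :|: D]].
  apply: hQ => //.
  have [u1 _] := leq_card_setU (Res :|: X) D.
  have [u2 _] := leq_card_setU Res X.
  have Xeb : #|X| <= e * b by apply: leq_trans cE _; rewrite leq_mul2l (ltnW jb) orbT.
  have yX : y * #|X| <= y * (e * b) by rewrite leq_mul2l Xeb orbT.
  lia.
move: dE'; rewrite !disjoints_subset !setCU !subsetI -!disjoints_subset -andbA.
move=> /and3P[dR dX dD].
pose E1 p := if p == j then E' else E p.
have E1j : E1 j = E' by rewrite /E1 eqxx.
have E1p p : p < j -> E1 p = E p by move=> pj; rewrite /E1 ltn_eqF.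
have XE : \bigcup_(p < j.+1) E1 p = X :|: E'.
  rewrite big_ord_recr /= E1j; congr (_ :|: _); apply: eq_bigr => p _.
  by rewrite E1p.
have EX p : p < j -> [disjoint E' & E p].
  move=> pj; move: dX; rewrite !disjoints_subset => /subset_trans; apply.
  by rewrite setCS; apply: (bigcup_sup (Ordinal pj)).
have spl p : p < j.+1 -> p = j \/ p < j by rewrite ltnS leq_eqVlt => /predU1P.
exists E1; split.
- by move=> p /spl[->|pj]; rewrite ?E1j // E1p //; apply: hE.
- move=> p p' /spl[->|pj] /spl[->|pj']; rewrite ?E1j ?eqxx // ?E1p //.
  + by move=> _; apply: EX.
  + by move=> _; rewrite disjoint_sym; apply: EX.
  + exact: dE.
- by rewrite XE mulnS; have [+ _] := leq_card_setU X E'; lia.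
move=> c; rewrite XE setIUr.
have [+ _] := leq_card_setU (main c :&: X) (main c :&: E').
have := subset_leq_card (subsetIr (main c) E').
case: (ltnP #|main c :&: X| z) => [lt|ge]; first lia.
have -> : main c :&: E' = set0.
  apply/eqP; rewrite setI_eq0 disjoint_sym; move: dD.
  rewrite !disjoints_subset => /subset_trans; apply.
  by rewrite setCS; apply: (bigcup_sup c).
by rewrite cards0; have := lE c; lia.
Qed.

Lemma load_pos_flatten (A : eqType) (seg : nat -> seq (A * A * A)) (ps : seq nat) a n :
  uniq ps -> (forall p p', p \in ps -> p' \in ps -> 0 < load (seg p) a ->
     0 < load (seg p') a -> p = p') ->
  (forall p, p \in ps -> load (seg p) a <= n) ->
  load (flatten [seq seg p | p <- ps]) a <= n.
Proof.
elim: ps => [|p ps IH] /=; first by rewrite /load big_nil.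
move=> /andP[pps ups] own ld; rewrite load_cat.
have [|p0] := posnP (load (seg p) a).
  move=> ->; apply: IH => // [p1 p2 h1 h2|p1 h1]; last by apply: ld; rewrite inE h1 orbT.
  by apply: own; rewrite inE ?h1 ?h2 orbT.
have -> : load (flatten [seq seg p' | p' <- ps]) a = 0.
  have z q : q \in ps -> load (seg q) a = 0.
    move=> qps; apply/eqP; rewrite -leqn0 leqNgt; apply/negP => q0.
    have e : p = q by apply: own; rewrite ?inE ?eqxx ?qps ?orbT.
    by rewrite e qps in pps.
  elim: (ps) z => [|q qs IHq] z /=; first by rewrite /load big_nil.
  by rewrite load_cat z ?mem_head // IHq // => q' h; rewrite z // inE h orbT.
by rewrite addn0 ld // mem_head.
Qed.

Lemma load_le3 (A : eqType) (L : seq (A * A * A)) a : load L a <= 3 * size L.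
Proof.
elim: L => [|t L IH]; first by rewrite /load big_nil.
rewrite /load big_cons /= mulnS; apply: leq_add IH; rewrite /occ.
by do 3!case: (_ == a).
Qed.

Lemma cycle_flatten (A : Type) (e : rel A) (hd : nat -> A) (rest : nat -> seq A) b :
  0 < b -> (forall p, p < b -> path e (hd p) (rest p)) ->
  (forall p, p.+1 < b -> e (last (hd p) (rest p)) (hd p.+1)) ->
  e (last (hd b.-1) (rest b.-1)) (hd 0) ->
  cycle e (flatten [seq hd p :: rest p | p <- iota 0 b]).
Proof.
case: b => // b _ hp hs h0.
suff H k : k <= b -> path e (hd 0) (rest 0 ++ flatten [seq hd p :: rest p | p <- iota 1 k])
    /\ last (hd 0) (rest 0 ++ flatten [seq hd p :: rest p | p <- iota 1 k]) =
       last (hd k) (rest k).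
  by have [h1 h2] := H b (leqnn b); rewrite /= rcons_path h1 h2.
elim: k => [|k IH] kb; first by rewrite /= cats0 hp.
have [h1 h2] := IH (ltnW kb).
have -> : iota 1 k.+1 = iota 1 k ++ [:: k.+1] by rewrite -(addn1 k) iotaD add1n addn1.
rewrite map_cat flatten_cat catA; set F := rest 0 ++ _ in h1 h2 *.
rewrite cat_path last_cat h1 h2 /= cats0.
by rewrite hs // hp.
Qed.

End Avoidance.


Section Labels.
Local Open Scope nat_scope.

Definition map3 (A B : Type) (f : A -> B) (t : A * A * A) : B * B * B :=
  (f t.1.1, f t.1.2, f t.2).

Definition all3 (A : Type) (P : pred A) (t : A * A * A) :=
  [&& P t.1.1, P t.1.2 & P t.2].

Lemma load_map (A B : eqType) (f : A -> B) (L : seq (A * A * A)) a :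
  injective f -> load (map (map3 f) L) (f a) = load L a.
Proof.
move=> fi; rewrite /load big_map; apply: eq_bigr => t _.
by rewrite /occ /= !(inj_eq fi).
Qed.

Lemma load_all3 (A : eqType) (P : pred A) (L : seq (A * A * A)) a :
  all (all3 P) L -> 0 < load L a -> P a.
Proof.
elim: L => [|t L IH] /=; first by rewrite /load big_nil.
move=> /andP[/and3P[h1 h2 h3] h]; rewrite /load big_cons /= addn_gt0.
case/orP => [|/(IH h)//]; rewrite /occ !addn_gt0 !lt0b.
by case/orP => [/orP[]|] /eqP <-.
Qed.

Lemma path_zstep_map (A B : Type) (e : A -> A -> bool) (e' : B -> B -> bool)
    (f : A -> B) t L : (forall a b, e a b -> e' (f a) (f b)) ->
  path (zstep e) t L -> path (zstep e') (map3 f t) (map (map3 f) L).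
Proof.
move=> h; elim: L t => //= u L IH t /andP[tu /IH->]; rewrite andbT.
move: t u tu => [[a b] c] [[a' b'] c'] /= /and5P[h1 h2 h3 h4 /andP[h5 h6]].
by rewrite !h.
Qed.

Lemma zstep_map (A B : Type) (e : A -> A -> bool) (e' : B -> B -> bool)
    (f : A -> B) t u : (forall a b, e a b -> e' (f a) (f b)) ->
  zstep e t u -> zstep e' (map3 f t) (map3 f u).
Proof.
move=> h tu; have := @path_zstep_map _ _ _ _ _ t [:: u] h.
by rewrite /= tu !andbT; apply.
Qed.

End Labels.

(** * Joining the tours of all blocks to one closed walk *)

Section Assemble.
Local Open Scope nat_scope.

Local Notation o k := (@Ordinal 8 k isT).
Local Notation i3 k := (@Ordinal 3 k isT).

Variables (T : finType) (G : sgraph T) (M b y z w : nat).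
Variables (B : nat -> 'I_M -> {set T}) (Pc : nat -> 'I_M -> 'I_3 -> {set T}).
Variables (t0 : nat -> 'I_M * 'I_M * 'I_M) (L : nat -> seq ('I_M * 'I_M * 'I_M)).

Let nx p := if p.+1 == b then 0 else p.+1.
Let pv p := if p == 0 then b.-1 else p.-1.
Let ta p := (t0 p).1.1.
Let tb p := (t0 p).1.2.
Let tc p := (t0 p).2.

(* Each cluster [B p k] contains a main piece (0) and two small pieces reserved for
   the chains leaving (1) and entering (2) block [p].  A segment has, besides the
   tour [L p], nine triangles, which contribute at most 27 to any load; a chain uses
   four new sets of 27 vertices, whence 108. *)
Hypothesis b0 : 0 < b.
Hypothesis PB : forall p k tau, p < b -> Pc p k tau \subset B p k.
Hypothesis dP : forall p k tau p' k' tau', p < b -> p' < b ->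
  (p, k, tau) != (p', k', tau') -> [disjoint Pc p k tau & Pc p' k' tau'].
Hypothesis cP0 : forall p k, p < b -> #|Pc p k (i3 0)| = y * z.
Hypothesis cP : forall p k (tau : 'I_3), p < b -> 0 < tau -> 27 <= #|Pc p k tau|.
Hypothesis t0_tri : forall p, p < b -> zstep (full G (B p)) (t0 p) (t0 p).
Hypothesis L_path : forall p, p < b -> path (zstep (full G (B p))) (t0 p) (L p).
Hypothesis L_tri : forall p, p < b ->
  all (fun t => zstep (full G (B p)) t t) (L p).
Hypothesis L_last : forall p, p < b -> last (t0 p) (L p) = t0 p.
Hypothesis L_load : forall p k, p < b -> load (L p) k + 27 + (z + 108) <= y * z.
Let Res := \bigcup_(p < b) \bigcup_(k : 'I_M) (Pc p k (i3 1) :|: Pc p k (i3 2)).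
Hypothesis linkP : forall p (W : {set T}), p < b -> #|W| <= w ->
  exists2 S : 'I_8 -> {set T},
    link G 27 (Pc p (ta p) (i3 1)) (Pc p (tb p) (i3 1))
      (Pc (nx p) (ta (nx p)) (i3 2)) (Pc (nx p) (tb (nx p)) (i3 2)) S &
    forall i : 'I_8, 3 < i -> [disjoint S i & W].
Hypothesis hw : #|Res| + 108 * b + y * (108 * b) <= w.

Lemma nx_lt p : p < b -> nx p < b.
Proof. by rewrite /nx => pb; case: eqP => // /eqP ne; rewrite ltn_neqAle ne. Qed.

Lemma pv_lt p : p < b -> pv p < b.
Proof.
rewrite /pv => pb; case: eqP => _; first by rewrite ltn_predL.
by apply: leq_ltn_trans (leq_pred _) pb.
Qed.

Lemma pv_nx p : p < b -> pv (nx p) = p.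
Proof. by rewrite /nx /pv => pb; case: (p.+1 =P b) => [e|_] //=; rewrite -e. Qed.

Lemma nx_pv p : p < b -> nx (pv p) = p.
Proof.
rewrite /pv /nx => pb; case: (p =P 0) => [->|/eqP p0]; first by rewrite prednK // eqxx.
by rewrite prednK ?lt0n // ltn_eqF.
Qed.

Let links p S := link G 27 (Pc p (ta p) (i3 1)) (Pc p (tb p) (i3 1))
      (Pc (nx p) (ta (nx p)) (i3 2)) (Pc (nx p) (tb (nx p)) (i3 2)) S.

Lemma links_exist : exists S : nat -> 'I_8 -> {set T},
  [/\ forall p, p < b -> links p (S p),
      forall p (i : 'I_8), p < b -> 3 < i -> [disjoint S p i & Res],
      forall p p' (i i' : 'I_8), p < b -> p' < b -> p != p' -> 3 < i -> 3 < i' ->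
        [disjoint S p i & S p' i']
    & forall p k, p < b ->
        #|Pc p k (i3 0) :&: \bigcup_(q < b) \bigcup_(i : 'I_8 | 3 < i) S q i| <= z + 108].
Proof.
pose main (c : 'I_b * 'I_M) := Pc c.1 c.2 (i3 0).
pose Q p E := exists2 S, links p S & E = \bigcup_(i : 'I_8 | 3 < i) S i.
have dmain c c' : c != c' -> [disjoint main c & main c'].
  move=> cc; apply: dP => //; apply: contraNneq cc => -[h1 h2].
  by apply/eqP; case: c c' h1 h2 => [c1 c2] [c1' c2'] /= /val_inj -> ->.
have Qex p (W : {set T}) : p < b -> #|W| <= w ->
    exists E, [/\ Q p E, #|E| <= 108 & [disjoint E & W]].
  move=> pb /(linkP pb)[S lS dS]; exists (\bigcup_(i : 'I_8 | 3 < i) S i); split.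
  - by exists S.
  - apply: (@leq_trans (\sum_(i : 'I_8 | 3 < i) #|S i|)).
      exact: card_bigcup_le.
    case: lS => cS _ _ _; under eq_bigr => i _ do rewrite cS.
    rewrite sum_nat_const -[108]/(4 * 27) leq_mul2r /= -sum1_card big_mkcond /=.
    by rewrite !big_ord_recl big_ord0.
  by rewrite disjoint_sym; apply/bigcup_disjointP => i /dS; rewrite disjoint_sym.
have cmain c : #|main c| <= y * z by rewrite cP0.
have [E [h1 h2 h3]] := greedy_avoid dmain cmain Qex hw.
have [S hS] : exists S : nat -> 'I_8 -> {set T}, forall p, p < b ->
    links p (S p) /\ E p = \bigcup_(i : 'I_8 | 3 < i) S p i.
  have ex p : exists S, p < b -> links p S /\ E p = \bigcup_(i : 'I_8 | 3 < i) S i.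
    case: (ltnP p b) => [pb|]; last by exists (fun=> set0).
    by have [[S lS eS] _] := h1 p pb; exists S.
  by have [S hS] := choice ex; exists S.
have SE p (i : 'I_8) : p < b -> 3 < i -> S p i \subset E p.
  by move=> pb i3; rewrite (hS p pb).2; apply: bigcup_sup.
exists S; split.
- by move=> p /hS[].
- move=> p i pb i3; have [_ d] := h1 p pb.
  exact: disjointWl (SE p i pb i3) d.
- move=> p p' i i' pb pb' pp i3 i3'.
  by apply: disjointW (SE p i pb i3) (SE p' i' pb' i3') (h2 _ _ pb pb' pp).
move=> p k pb; have := h3 (Ordinal pb, k); rewrite /main /=.
by rewrite (eq_bigr (fun q : 'I_b => \bigcup_(i : 'I_8 | 3 < i) S q i)) // => q _; apply: (hS q _).2.
Qed.

Section Walk.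
Variable S : nat -> 'I_8 -> {set T}.
Hypothesis S_link : forall p, p < b -> links p (S p).
Hypothesis S_res : forall p (i : 'I_8), p < b -> 3 < i -> [disjoint S p i & Res].
Hypothesis S_dis : forall p p' (i i' : 'I_8), p < b -> p' < b -> p != p' ->
  3 < i -> 3 < i' -> [disjoint S p i & S p' i'].
Let X := \bigcup_(q < b) \bigcup_(i : 'I_8 | 3 < i) S q i.
Hypothesis S_main : forall p k, p < b -> #|Pc p k (i3 0) :&: X| <= z + 108.

Let label := ((nat * 'I_M * 'I_3) + (nat * 'I_8))%type.

(** The adjacencies of a chain hold only between the sets of size 27 supplied by [link], so the
    reserved pieces at both ends are cut down to these sets; main pieces give up whatever the chains
    of all blocks have taken. *)
Definition slot (x : label) : {set T} :=
  match x with
  | inl (p, k, tau) =>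
    if val tau == 0 then Pc p k tau :\: X else
    if val tau == 1 then
      (if k == ta p then S p (o 0) else if k == tb p then S p (o 1) else Pc p k tau)
    else
      (if k == ta p then S (pv p) (o 2)
       else if k == tb p then S (pv p) (o 3) else Pc p k tau)
  | inr (p, i) => S p i
  end.

(** The segment that owns a label. The pieces for entering block q belong to the preceding segment
    [pv q], whose chain ends there. *)
Definition label_in (p : nat) (x : label) : bool :=
  match x with
  | inl (q, k, tau) => (q < b) && ((if val tau == 2 then pv q else q) == p)
  | inr (q, i) => [&& q < b, q == p & 3 < i]
  end.

Let E (x x' : label) := complete G (slot x) (slot x').

Lemma slot_piece p k tau : p < b -> slot (inl (p, k, tau)) \subset Pc p k tau.
Proof.
move=> pb; have [_ [h0 h1 _ _] _ _] := S_link pb.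
have [_ [_ _ h2 h3] _ _] := S_link (pv_lt pb); rewrite nx_pv // in h2 h3.
rewrite /slot; case: tau => [[|[|[|//]]] ht] /=.
- exact: subsetDl.
- rewrite (_ : Ordinal ht = i3 1); last exact: val_inj.
  case: eqP => [->|_]; first exact: h0.
  by case: eqP => [->|_].
rewrite (_ : Ordinal ht = i3 2); last exact: val_inj.
case: eqP => [->|_]; first exact: h2.
by case: eqP => [->|_].
Qed.

Lemma E_full p k k' tau tau' : p < b -> full G (B p) k k' ->
  E (inl (p, k, tau)) (inl (p, k', tau')).
Proof.
move=> pb /andP[_ h]; apply: completeS h;
  by apply: subset_trans (slot_piece _ _ pb) (PB _ _ pb).
Qed.

Lemma complete_disjoint (A C : {set T}) : complete G A C -> [disjoint A & C].
Proof.
move/completeP => h; rewrite disjoint_subset; apply/subsetP => x xA; rewrite inE.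
by apply/negP => xC; have := h _ _ xA xC; rewrite adj_irrefl.
Qed.

(** Set 4 is complete to sets 5, 6 and 7, hence disjoint from them because G has no loops; the other
    pairs are disjoint by [link]. *)
Lemma S_dis_same p (i i' : 'I_8) : p < b -> i != i' -> 3 < i -> 3 < i' ->
  [disjoint S p i & S p i'].
Proof.
move=> pb; have [_ _ [d56 d57 d67] [_ h5 h6 h7]] := S_link pb.
have /and3P[_ _ /complete_disjoint d54] := h5.
have /and3P[_ /complete_disjoint d64 _] := h6.
have /and3P[/complete_disjoint d74 _ _] := h7.
have oE k (l l' : (k < 8)) : Ordinal l = Ordinal l' by apply: val_inj.
case: i i' => [[|[|[|[|[|[|[|[|//]]]]]]]] li] [[|[|[|[|[|[|[|[|//]]]]]]]] li'] //= _ _ _;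
  rewrite ?(oE _ li isT) ?(oE _ li' isT) //; by rewrite disjoint_sym.
Qed.

Lemma S_sub_X p (i : 'I_8) : p < b -> 3 < i -> S p i \subset X.
Proof.
move=> pb i3; apply: subset_trans (bigcup_sup (Ordinal pb) isT).
exact: (@bigcup_sup _ _ i (fun i : 'I_8 => 3 < i) (S p)).
Qed.

Lemma piece_res p k (tau : 'I_3) : p < b -> val tau != 0 -> Pc p k tau \subset Res.
Proof.
move=> pb ht; apply: subset_trans (bigcup_sup (Ordinal pb) isT).
apply: subset_trans (bigcup_sup k isT); case: tau ht => [[|[|[|//]]] l] //= _.
  by rewrite (_ : Ordinal l = i3 1) ?subsetUl //; apply: val_inj.
by rewrite (_ : Ordinal l = i3 2) ?subsetUr //; apply: val_inj.
Qed.

Lemma slot_inl_inr p k tau p' (i : 'I_8) : p < b -> p' < b -> 3 < i ->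
  [disjoint slot (inl (p, k, tau)) & S p' i].
Proof.
move=> pb pb' i3; case: (eqVneq (val tau) 0) => [t0'|t0'].
  rewrite /slot t0' eqxx disjoint_sym disjoint_subset.
  apply/subsetP => x xS; rewrite !inE negb_and negbK.
  by rewrite (subsetP (S_sub_X pb' i3) _ xS).
rewrite disjoint_sym; apply: disjointWr (S_res pb' i3).
exact: subset_trans (slot_piece _ _ pb) (piece_res _ pb t0').
Qed.

Lemma slot_disjoint p p' x x' : label_in p x -> label_in p' x' -> x != x' ->
  [disjoint slot x & slot x'].
Proof.
case: x x' => [[[q k] tau]|[q i]] [[[q' k'] tau']|[q' i']] /=.
- move=> /andP[qb _] /andP[qb' _] ne.
  apply: disjointW (slot_piece k tau qb) (slot_piece k' tau' qb') _.
  by apply: dP => //; apply: contraNneq ne => ->.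
- by move=> /andP[qb _] /and3P[qb' _ i3] _; apply: slot_inl_inr.
- by move=> /and3P[qb' _ i3] /andP[qb _] _; rewrite disjoint_sym; apply: slot_inl_inr.
move=> /and3P[qb _ i3] /and3P[qb' _ i3'] ne.
case: (eqVneq q q') => [e|qq]; last exact: S_dis.
rewrite -e; apply: S_dis_same => //; apply: contraNneq ne => ->.
by rewrite e.
Qed.

Let mainl p (k : 'I_M) : label := inl (p, k, i3 0).
Let exitl p (k : 'I_M) : label := inl (p, k, i3 1).
Let entryl p (k : 'I_M) : label := inl (p, k, i3 2).
Let lk p i : label := inr (p, i).

(** The six triangles of the chain, with exits in the roles of 0 and 1 and entries in those of 2 and
    3. The first and the last triangle lead from the main pieces to the exits and from the entries
    to the next tour. *)
Definition linkage p : seq (label * label * label) :=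
  let q := nx p in
  [:: (exitl p (ta p), exitl p (tb p), mainl p (tc p));
      (exitl p (ta p), exitl p (tb p), lk p (o 5));
      (lk p (o 4), exitl p (tb p), lk p (o 5));
      (lk p (o 4), exitl p (tb p), lk p (o 6));
      (lk p (o 4), entryl q (tb q), lk p (o 6));
      (lk p (o 4), entryl q (tb q), lk p (o 7));
      (entryl q (ta q), entryl q (tb q), lk p (o 7));
      (entryl q (ta q), entryl q (tb q), entryl q (tc q))].

Definition start p := map3 (mainl p) (t0 p).
Definition rest p := map (map3 (mainl p)) (L p) ++ linkage p.

Lemma E_symm x x' : E x x' = E x' x.
Proof. exact: complete_sym. Qed.

Lemma t0_full p : p < b -> [/\ full G (B p) (ta p) (tb p),
  full G (B p) (ta p) (tc p) & full G (B p) (tb p) (tc p)].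
Proof.
move=> /t0_tri; rewrite /ta /tb /tc; case: (t0 p) => [[a c] d] /=.
by case/and5P => ? ? _ ? _.
Qed.

Lemma slot_link p : p < b -> [/\ slot (exitl p (ta p)) = S p (o 0),
  slot (exitl p (tb p)) = S p (o 1), slot (entryl (nx p) (ta (nx p))) = S p (o 2) &
  slot (entryl (nx p) (tb (nx p))) = S p (o 3)].
Proof.
move=> pb; have [/andP[n1 _] _ _] := t0_full pb.
have [/andP[n2 _] _ _] := t0_full (nx_lt pb).
rewrite /slot /= !eqxx pv_nx //.
by rewrite [tb p == _]eq_sym (negPf n1) [tb (nx p) == _]eq_sym (negPf n2).
Qed.

Lemma linkage_path p : p < b ->
  path (zstep E) (start p) (linkage p) &&
  zstep E (last (start p) (linkage p)) (start (nx p)) /\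
  all (fun t => zstep E t t) (linkage p).
Proof.
move=> pb; have qb := nx_lt pb.
have [f1 f2 f3] := t0_full pb; have [g1 g2 g3] := t0_full qb.
have ff x y' tau tau' := @E_full p x y' tau tau' pb.
have gg x y' tau tau' := @E_full (nx p) x y' tau tau' qb.
have f1' tau tau' := ff _ _ tau tau' f1. have f2' tau tau' := ff _ _ tau tau' f2.
have f3' tau tau' := ff _ _ tau tau' f3.
have g1' tau tau' := gg _ _ tau tau' g1. have g2' tau tau' := gg _ _ tau tau' g2.
have g3' tau tau' := gg _ _ tau tau' g3.
have f1s tau tau' : E (inl (p, tb p, tau)) (inl (p, ta p, tau')) by rewrite E_symm.
have f2s tau tau' : E (inl (p, tc p, tau)) (inl (p, ta p, tau')) by rewrite E_symm.
have f3s tau tau' : E (inl (p, tc p, tau)) (inl (p, tb p, tau')) by rewrite E_symm.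
have g1s tau tau' : E (inl (nx p, tb (nx p), tau)) (inl (nx p, ta (nx p), tau')) by rewrite E_symm.
have g2s tau tau' : E (inl (nx p, tc (nx p), tau)) (inl (nx p, ta (nx p), tau')) by rewrite E_symm.
have g3s tau tau' : E (inl (nx p, tc (nx p), tau)) (inl (nx p, tb (nx p), tau')) by rewrite E_symm.
have [_ _ _ [/andP[h41 h43] /and3P[h50 h51 h54] /and3P[h61 h64 h63] /and3P[h74 h73 h72]]] :=
  S_link pb.
have [e0 e1 e2 e3] := slot_link pb.
have k41 : E (lk p (o 4)) (exitl p (tb p)) by rewrite /E e1.
have k43 : E (lk p (o 4)) (entryl (nx p) (tb (nx p))) by rewrite /E e3.
have k50 : E (lk p (o 5)) (exitl p (ta p)) by rewrite /E e0.
have k51 : E (lk p (o 5)) (exitl p (tb p)) by rewrite /E e1.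
have k54 : E (lk p (o 5)) (lk p (o 4)) by [].
have k61 : E (lk p (o 6)) (exitl p (tb p)) by rewrite /E e1.
have k64 : E (lk p (o 6)) (lk p (o 4)) by [].
have k63 : E (lk p (o 6)) (entryl (nx p) (tb (nx p))) by rewrite /E e3.
have k74 : E (lk p (o 7)) (lk p (o 4)) by [].
have k73 : E (lk p (o 7)) (entryl (nx p) (tb (nx p))) by rewrite /E e3.
have k72 : E (lk p (o 7)) (entryl (nx p) (ta (nx p))) by rewrite /E e2.
have sy x x' : E x x' -> E x' x by rewrite E_symm.
have k41s := sy _ _ k41. have k43s := sy _ _ k43. have k50s := sy _ _ k50. have k51s := sy _ _ k51.
have k54s := sy _ _ k54. have k61s := sy _ _ k61. have k64s := sy _ _ k64. have k63s := sy _ _ k63.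
have k74s := sy _ _ k74. have k73s := sy _ _ k73. have k72s := sy _ _ k72.
rewrite /linkage /start /map3 /= -/(ta p) -/(tb p) -/(tc p).
rewrite -/(ta (nx p)) -/(tb (nx p)) -/(tc (nx p)).
rewrite ?f1' ?f2' ?f3' ?g1' ?g2' ?g3' ?f1s ?f2s ?f3s ?g1s ?g2s ?g3s /=.
by split; rewrite ?k41 ?k41s ?k43 ?k43s ?k50 ?k50s ?k51 ?k51s ?k54 ?k54s
  ?k61 ?k61s ?k64 ?k64s ?k63 ?k63s ?k74 ?k74s ?k73 ?k73s ?k72 ?k72s.
Qed.

Lemma seg_labels p : p < b -> all (all3 (label_in p)) (start p :: rest p).
Proof.
move=> pb; have qb := nx_lt pb.
rewrite /= all_cat all_map /all3 /start /= pb eqxx /=.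
rewrite (_ : all _ (L p) = true) /=; last first.
  by apply/allP => t _; rewrite /= pb eqxx.
by rewrite ?pb ?qb ?pv_nx // ?eqxx.
Qed.

Lemma slot_card p x : label_in p x ->
  (if x is inl (_, _, tau) then val tau != 0 else true) -> 27 <= #|slot x|.
Proof.
case: x => [[[q k] tau]|[q i]] /=; last first.
  by case/and3P => qb _ _ _; case: (S_link qb) => ->.
move=> /andP[qb _] /negPf t0'; rewrite t0'.
have [c1 _ _ _] := S_link qb; have [c2 _ _ _] := S_link (pv_lt qb).
case: ifP => _.
  case: eqP => _; first by rewrite c1.
  by case: eqP => _; [rewrite c1 | apply: cP; rewrite // lt0n t0'].
case: eqP => _; first by rewrite c2.
by case: eqP => _; [rewrite c2 | apply: cP; rewrite // lt0n t0'].
Qed.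

(** A label outside the main pieces occurs only in the nine triangles around the tour, hence at most
    27 times. A main label also carries the load of the tour, and its slot has lost at most
    [z + 108] vertices. *)
Lemma seg_load p x : p < b -> load (start p :: rest p) x <= #|slot x|.
Proof.
move=> pb; have [->//|x0] := posnP (load (start p :: rest p) x).
have xin := load_all3 (seg_labels pb) x0.
have le27 := load_le3 (start p :: linkage p) x.
have split_load : load (start p :: rest p) x =
    load (start p :: linkage p) x + load (map (map3 (mainl p)) (L p)) x.
  rewrite -(cat1s (start p) (rest p)) -(cat1s (start p) (linkage p)) /rest !load_cat.
  by rewrite -addnA; congr (_ + _); rewrite addnC.
pose is_main (x : label) := if x is inl (_, _, tau) then val tau == 0 else false.
have [xm|xm] := boolP (is_main x); last first.
  have -> : load (start p :: rest p) x = load (start p :: linkage p) x.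
    rewrite split_load; have [->|] := posnP (load (map (map3 (mainl p)) (L p)) x).
      by rewrite addn0.
    move=> /(@load_all3 _ is_main); rewrite (negPf xm); case/(_ _)/notF.
    by apply/allP => t /mapP[u _ ->].
  apply: leq_trans le27 _; apply: (slot_card xin).
  by move: xm; rewrite /is_main; case: (x) => [[[? ?] ?]|].
case: x xm xin {x0 le27} split_load (load_le3 (start p :: linkage p) x) => [[[q k] tau]|//] /= t0'.
move=> /andP[_]; rewrite (eqP t0') /= => /eqP ->.
have -> : tau = i3 0 by apply/val_inj/eqP.
rewrite -/(mainl p k) load_map; last by move=> k1 k2 [].
move=> -> le27; have := L_load k pb.
rewrite /slot /= cardsD cP0 //; have := S_main k pb; lia.
Qed.

Lemma zstep_start p : p < b -> zstep E (start p) (start p).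
Proof.
by move=> pb; apply: zstep_map (t0_tri pb) => k k'; apply: E_full.
Qed.

Lemma walk_contains : exists l,
  \sum_(p < b) size (L p) <= l /\ contains G (tricycle l).
Proof.
pose W := flatten [seq start p :: rest p | p <- iota 0 b].
have sW : size W = \sum_(p < b) size (start p :: rest p).
  by rewrite /W size_flatten /shape -map_comp sumnE big_map -[X in iota 0 X]subn0 big_mkord.
have segE p : p < b -> path (zstep E) (start p) (rest p) /\
    zstep E (last (start p) (rest p)) (start (nx p)).
  move=> pb; have [/andP[h1 h2] _] := linkage_path pb.
  have pm : path (zstep E) (start p) (map (map3 (mainl p)) (L p)).
    by apply: path_zstep_map (L_path pb) => k k'; apply: E_full.
  have lm : last (start p) (map (map3 (mainl p)) (L p)) = start p.
    by rewrite /start last_map L_last.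
  by rewrite /rest cat_path last_cat pm lm.
exists (size W); split.
  by rewrite sW; apply: leq_sum => p _; rewrite /= /rest size_cat size_map; lia.
have le_load x : load W x <= #|slot x|.
  apply: load_pos_flatten; first exact: iota_uniq.
    move=> p p'; rewrite !mem_iota /= add0n => pb pb'.
    move=> /(load_all3 (seg_labels pb)) + /(load_all3 (seg_labels pb')).
    case: x => [[[q k] tau]|[q i]] /=; first by move=> /andP[_ /eqP <-] /andP[_ /eqP].
    by move=> /and3P[_ /eqP <- _] /and3P[_ /eqP].
  by move=> p; rewrite mem_iota => pb; apply: seg_load.
have in_label x : 0 < load W x -> exists p, label_in p x.
  move=> x0; pose any (x' : label) :=
    match x' with inl (q, _, _) => q < b | inr (q, i) => (q < b) && (3 < i) end.
  have : any x.
    apply: load_all3 x0; apply/allP => t /flattenP[s /mapP[p]].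
    rewrite mem_iota => pb -> /(allP (seg_labels pb)).
    have imp y' : label_in p y' -> any y'.
      case: y' => [[[q k] tau]|[q i]] /=; first by case/andP.
      by case/and3P => -> _ ->.
    by rewrite /all3 => /and3P[/imp -> /imp -> /imp ->].
  case: x {x0} => [[[q k] tau]|[q i]] /=.
    by move=> qb; exists (if val tau == 2 then pv q else q); rewrite qb eqxx.
  by move=> /andP[qb i3]; exists q; rewrite qb eqxx.
apply: (@embed_tricycle _ _ _ slot).
- rewrite sW -(prednK b0) big_ord_recl /=; lia.
- apply: cycle_flatten => //.
  + by move=> p /segE[].
  + move=> p pb; have [_] := segE p (ltnW pb).
    by rewrite /nx ltn_eqF.
  have bb : b.-1 < b by rewrite prednK.
  by have [_] := segE _ bb; rewrite /nx prednK // eqxx.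
- apply/allP => t /flattenP[s /mapP[p]]; rewrite mem_iota => pb ->.
  rewrite inE /rest mem_cat => /or3P[/eqP ->|/mapP[u uL ->]|tl].
  + exact: zstep_start.
  + apply: zstep_map (allP (L_tri pb) _ uL) => k k'; exact: E_full.
  + by have [_ /allP] := linkage_path pb; apply.
- exact: le_load.
by move=> x x' /in_label[p xp] /in_label[p' xp']; apply: slot_disjoint xp xp'.
Qed.

End Walk.

Lemma assemble : exists l,
  \sum_(p < b) size (L p) <= l /\ contains G (tricycle l).
Proof.
have [S [h1 h2 h3 h4]] := links_exist.
exact: (walk_contains h1 h2 h3 h4).
Qed.

End Assemble.


(** * Choice of the constants *)

Section Blocks.
Local Open Scope nat_scope.

Local Notation i3 k := (@Ordinal 3 k isT).

Lemma split_three (T : finType) (A : {set T}) s sig : #|A| = s + 2 * sig ->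
  exists P : 'I_3 -> {set T},
    [/\ forall t, P t \subset A, #|P (i3 0)| = s,
        forall t : 'I_3, 0 < t -> #|P t| = sig
      & forall t t', t != t' -> [disjoint P t & P t']].
Proof.
move=> cA.
have [X XA cX] : exists2 X : {set T}, X \subset A & #|X| = s.
  by apply: subset_of_card; lia.
have [Y YA cY] : exists2 Y : {set T}, Y \subset A :\: X & #|Y| = sig.
  by apply: subset_of_card; rewrite cardsD (setIidPr XA); lia.
have [YA' dYX] : Y \subset A /\ [disjoint Y & X] by apply/andP; rewrite -subsetD.
have [Z ZA cZ] : exists2 Z : {set T}, Z \subset A :\: (X :|: Y) & #|Z| = sig.
  apply: subset_of_card; rewrite cardsD (setIidPr _) ?subUset ?XA //.
  by have [+ _] := leq_card_setU X Y; lia.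
have [ZA' dZ] : Z \subset A /\ [disjoint Z & X :|: Y] by apply/andP; rewrite -subsetD.
move: dZ; rewrite disjoints_subset setCU subsetI -!disjoints_subset => /andP[dZX dZY].
exists (fun t => nth set0 [:: X; Y; Z] t); split=> //.
- by move=> [[|[|[|]]] ?].
- by move=> [[|[|[|]]] ?].
by move=> [[|[|[|//]]] ?] [[|[|[|//]]] ?] //= _; rewrite // disjoint_sym.
Qed.

(** [good_tour] is applied to the subgraph induced on [J]. Vertices keep their index in ['I_M] as
    rank, which is still injective though no longer contiguous. *)
Lemma block_tour M (F : sgraph 'I_M) (J : {set 'I_M}) : 0 < #|J| ->
  (forall k, k \in J -> #|J| + minn (3 * k.+1) #|J| < 3 * #|[set l in J | F k l]|) ->
  exists t0 : 'I_M * 'I_M * 'I_M,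
    [/\ zstep F t0 t0, #|J| <= 3 * (t0.1.1).+1, #|J| <= 3 * (t0.1.2).+1 &
      forall n D, 3 * n * #|J| ^ 2 <= D ^ 2 ->
      exists L, [/\ path (zstep F) t0 L, last t0 L = t0,
        all (fun t => zstep F t t) L, n <= size L &
        forall k, #|J| * load L k <= 3 * n + D + #|J| * (2 * (#|J| ^ 3) ^ 2)]].
Proof.
move=> J0 hJ.
pose K : finType := {k : 'I_M | k \in J}.
have Fs : symmetric (fun x y' : K => F (val x) (val y')) by move=> x y'; apply: adj_sym.
have Fi : irreflexive (fun x y' : K => F (val x) (val y')) by move=> x; apply: adj_irrefl.
pose F' := SGraph Fs Fi.
have cK : #|K| = #|J| by rewrite card_sig; apply: eq_card => x; rewrite inE.
have rinj : injective (fun x : K => val (val x)) by move=> x x' /val_inj /val_inj.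
have good (k : K) : #|K| + minn (3 * (val (val k)).+1) #|K| < 3 * degree F' k.
  rewrite cK (_ : degree F' k = #|[set l in J | F (val k) l]|); first exact: hJ (valP k).
  rewrite /degree -(card_imset _ val_inj); apply: eq_card => l; rewrite inE.
  apply/imsetP/andP => [[x + ->]|[lJ kl]]; first by rewrite inE; split=> //; apply: valP.
  by exists (Sub l lJ); rewrite ?inE // SubK.
have K0 : 0 < #|K| by rewrite cK.
have [t0 [tt b1 b2 hL]] := good_tour rinj good K0.
have vmap x y' : F' x y' -> F (val x) (val y') by [].
exists (map3 val t0); split.
- exact: zstep_map tt.
- by rewrite -cK.
- by rewrite -cK.
move=> n D; rewrite -cK => /hL [L [pL lL nL loadL]].
exists (map (map3 val) L); split.
- apply: path_zstep_map vmap _; apply: sub_path pL => t u.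
  by case/and3P.
- by rewrite last_map lL.
- rewrite all_map; elim: L (t0) pL {lL nL loadL} => //= u L IH t /andP[/and3P[_ uu _] /IH ->].
  by rewrite andbT; apply: zstep_map uu.
- by rewrite size_map.
move=> k; have [kJ|kJ] := boolP (k \in J).
  have -> : k = val (Sub k kJ : K) by rewrite SubK.
  rewrite load_map; last exact: val_inj.
  have := loadL (Sub k kJ); rewrite !card_prod.
  by rewrite (_ : #|K| ^ 3 = #|K| * #|K| * #|K|) // expnSr expnSr expn1.
have -> : load (map (map3 val) L) k = 0; last by rewrite muln0.
apply/eqP; rewrite -leqn0 leqNgt; apply/negP => /(@load_all3 _ (mem J)) h.
move/negP: kJ; apply; apply: h; apply/allP => t /mapP[u _ ->].
by rewrite /all3 /map3; apply/and3P; split; apply: valP.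
Qed.

Lemma strata (T : finType) (rk : T -> 'I_#|T|) M N : bijective rk -> (0 < N)%N ->
  (M * N <= #|T|)%N ->
  let V := fun i : 'I_M => [set x | rk x %/ N == i] in
  (forall i, #|V i| = N) /\ (forall i j x, x \in V i -> x \in V j -> i = j).
Proof.
move=> [v rkK vK] N0 MN V; split; last first.
  move=> i j x; rewrite !inE => /eqP h1 /eqP h2.
  by apply: val_inj; rewrite /= -h1 -h2.
move=> i.
have lt (k : 'I_N) : (i * N + k < #|T|)%N.
  apply: leq_trans MN; apply: (@leq_trans (i.+1 * N)).
    by rewrite mulSn addnC ltn_add2r.
  by rewrite leq_mul2r ltn_ord orbT.
rewrite -[RHS]card_ord -(card_imset (f := fun k : 'I_N => v (Ordinal (lt k))) predT); last first.
  move=> k k' /(can_inj vK) /(congr1 val) /= /eqP; rewrite eqn_add2l => /eqP e.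
  exact: val_inj.
apply: eq_card => x; rewrite inE; apply/eqP/imsetP => [h|[k _ ->]].
  exists (Ordinal (ltn_pmod (rk x) N0)) => //; rewrite -[LHS]rkK; congr v.
  by apply: val_inj; rewrite /= -h -divn_eq.
by rewrite vK /= divnMDl // divn_small // addn0.
Qed.

End Blocks.

Section Degrees.
Variable R : realType.
Local Open Scope ring_scope.

Lemma eta_good_rank (eta : R) (T : finType) (G : sgraph T) : (3 <= #|T|)%N ->
  0 <= eta -> eta_good eta G ->
  exists rk : T -> 'I_#|T|, bijective rk /\
    forall x, (1 / 3 + eta) * #|T|%:R + Num.min (rk x)%:R (#|T|%:R / 3) <= (degree G x)%:R.
Proof.
move=> T3 eta0 [v [[rk vK rkK] mono hv]]; exists rk; split; first by exists v.
move=> x; rewrite -{2}(rkK x); set k := rk x.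
case: (lerP k.+1%:R (#|T|%:R / 3 : R)) => [le|gt].
  apply: le_trans (hv k le); rewrite -addrA lerD2l ge_min.
  by rewrite -natr1; apply/orP; left; lra.
(* The last index covered by goodness; the summand 1 in [eta_good] makes up for rounding down n /
   3. *)
pose j := (#|T| %/ 3).-1.
have j1 : j.+1 = (#|T| %/ 3)%N by rewrite /j prednK // divn_gt0.
have jT : (j < #|T|)%N by rewrite j1 leq_div.
have le3 : j.+1%:R <= #|T|%:R / 3 :> R.
  by rewrite j1 ler_pdivlMr // -natrM ler_nat leq_trunc_div.
have ge3 : #|T|%:R / 3 <= j.+1%:R + 1 :> R.
  rewrite j1 ler_pdivrMr // natr1 -natrM ler_nat.
  have := ltn_ceil #|T| (isT : (0 < 3)%N); lia.
have jk : (j <= k)%N.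
  have : (j.+1%:R < k.+1%:R :> R) by apply: le_lt_trans le3 gt.
  by rewrite ltr_nat ltnS => /ltnW.
have := hv (Ordinal jT) le3; have := mono (Ordinal jT) k jk.
rewrite -(ler_nat R) /= => h1 h2; apply: le_trans (le_trans h2 h1).
by rewrite -addrA lerD2l ge_min ge3 orbT.
Qed.

End Degrees.


(** * The construction for fixed constants *)

Section Core.
Variable R : realType.
Local Open Scope ring_scope.
Local Notation i3 k := (@Ordinal 3 k isT).

(** The loss [5 * gam] is made up of [gam] for vertices outside the strata, [2 * gam] for the
    degrees in a good block and [2 * gam] for the indices outside [J]. At least half of [eta]
    survives and pays for the off-by-one in [k.+1]. *)
Lemma good_arith (eta gam : R) (M m k d : nat) : (m <= M)%N ->
  10 * gam <= eta -> 2 < eta * M%:R ->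
  (1 / 3 + eta - 5 * gam) * M%:R + Num.min k%:R (M%:R / 3) <= d%:R ->
  (m + minn (3 * k.+1) m < 3 * d)%N.
Proof.
move=> mM ge eM hd.
have mMr : m%:R <= M%:R :> R by rewrite ler_nat.
have M0 : 0 <= M%:R :> R by [].
have h5 : 5 * gam * M%:R <= eta / 2 * M%:R by apply: ler_wpM2r => //; lra.
rewrite -(ltr_nat R) natrD natrM.
have [kM|kM] := lerP k%:R (M%:R / 3 : R).
  rewrite (min_idPl kM) in hd.
  have : (minn (3 * k.+1) m)%:R <= 3 * k%:R + 3 :> R.
    apply: (@le_trans _ _ (3 * k.+1)%:R); first by rewrite ler_nat geq_minl.
    by rewrite natrM -(addn1 k) natrD; lra.
  lra.
rewrite (min_idPr (ltW kM)) in hd.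
have : (minn (3 * k.+1) m)%:R <= m%:R :> R by rewrite ler_nat geq_minr.
lra.
Qed.

(** A tour of [m * (q - 2) * z] triangles with [D = m * z]: the average load is [3 * (q - 2) * z],
    and fluctuation and connecting walks cost at most [z] each. *)
Lemma tour_arith m M q z l : (0 < m)%N -> (m <= M)%N -> (3 <= q)%N -> (2 * M ^ 6 <= z)%N ->
  (m * l <= 3 * (m * (q - 2) * z) + m * z + m * (2 * (m ^ 3) ^ 2) ->
   l <= (3 * q - 4) * z)%N.
Proof.
move=> m0 mM q3 zM h.
have h6 : (2 * (m ^ 3) ^ 2 <= z)%N.
  by apply: leq_trans zM; rewrite -expnM leq_mul2l leq_exp2r.
have {}h : (m * l <= m * (3 * ((q - 2) * z) + z + 2 * (m ^ 3) ^ 2))%N.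
  by apply: leq_trans h _; rewrite !mulnDr; lia.
rewrite leq_pmul2l // in h; apply: leq_trans h _.
have -> : (3 * q - 4 = 3 * (q - 2) + 2)%N by lia.
by rewrite mulnDl; lia.
Qed.

Lemma square_arith m M q z : (m <= M)%N -> (3 * M * q <= z)%N ->
  (3 * (m * (q - 2) * z) * m ^ 2 <= (m * z) ^ 2)%N.
Proof.
move=> mM zM.
have -> : (3 * (m * (q - 2) * z) * m ^ 2 = m ^ 2 * z * (3 * m * (q - 2)))%N by ring.
have -> : ((m * z) ^ 2 = m ^ 2 * z * z)%N by ring.
rewrite leq_mul2l; apply/orP; right; apply: leq_trans zM.
by rewrite -!mulnA leq_mul2l /= leq_mul // leq_subr.
Qed.

(** Of the reserve [4 * z], the chains take at most [z + 108] and the extra triangles 27; since 27 +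
    108 = 3 * 45, [z >= 45] suffices. *)
Lemma load_arith q z l : (3 <= q)%N -> (45 <= z)%N -> (l <= (3 * q - 4) * z)%N ->
  (l + 27 + (z + 108) <= 3 * q * z)%N.
Proof.
move=> q3 z45 h; have -> : (3 * q * z = (3 * q - 4) * z + 4 * z)%N.
  by rewrite -mulnDl subnK //; lia.
lia.
Qed.

(** There are five losses: [q - 2] for [q], the reserved pieces, the uncovered part of the strata,
    the vertices outside the strata, and the indices outside [J]. Four cost a factor [1 - e] and the
    uncovered part costs [1 - 2 * e]. *)
Lemma count_arith (e gam b M N q z sig l n : R) :
  0 < e -> e <= 1 / 10 -> 0 <= gam -> 2 * gam <= e -> 0 <= b -> 0 <= M -> 0 <= N ->
  0 <= q -> 0 <= z -> 0 <= n ->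
  2 <= e * q -> 2 * sig <= e * (3 * q * z) ->
  (1 - 2 * e) * N <= b * (3 * q * z + 2 * sig) ->
  n <= M * N + M -> M <= gam * n ->
  b * ((1 - 2 * gam) * M * ((q - 2) * z)) <= l ->
  (1 - 10 * e) * n <= 3 * l.
Proof.
move=> e0 e1 g0 ge b0 M0 N0 q0 z0 n0 eq sig_s bst nMN Mgn hl.
have s0 : 0 <= 3 * q * z by rewrite !mulr_ge0.
have x1 : (1 - e) * (3 * q * z) <= 3 * ((q - 2) * z).
  have : 2 * (3 * z) <= e * q * (3 * z) by apply: ler_wpM2r => //; rewrite mulr_ge0.
  lra.
have x2 : (1 - e) * (3 * q * z + 2 * sig) <= 3 * q * z.
  have : (1 - e) * (2 * sig) <= (1 - e) * (e * (3 * q * z)) by apply: ler_wpM2l => //; lra.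
  have : 0 <= e ^+ 2 * (3 * q * z) by rewrite mulr_ge0 // sqr_ge0.
  lra.
have x3 : (1 - e) * n <= M * N.
  have : 2 * gam * n <= e * n by apply: ler_wpM2r.
  have : 0 <= e * n by rewrite mulr_ge0 // ltW.
  lra.
have e2 : 0 <= 1 - e by lra.
have y1 : (1 - e) * ((1 - e) * ((1 - 2 * e) * N)) <= 3 * (b * ((q - 2) * z)).
  apply: (@le_trans _ _ ((1 - e) * ((1 - e) * (b * (3 * q * z + 2 * sig))))).
    by do 2!apply: ler_wpM2l => //.
  apply: (@le_trans _ _ ((1 - e) * (b * (3 * q * z)))).
    by apply: ler_wpM2l => //; rewrite mulrCA; apply: ler_wpM2l.
  by rewrite (mulrCA (1 - e)) (mulrCA 3); apply: ler_wpM2l.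
have y2 : (1 - e) * M * ((1 - e) * ((1 - e) * ((1 - 2 * e) * N))) <= 3 * l.
  apply: (@le_trans _ _ ((1 - e) * M * (3 * (b * ((q - 2) * z))))).
    by apply: ler_wpM2l => //; rewrite mulr_ge0.
  have -> : (1 - e) * M * (3 * (b * ((q - 2) * z))) =
            (1 - e) * (3 * (b * (M * ((q - 2) * z)))) by ring.
  have c0 : 0 <= b * (M * ((q - 2) * z)).
    by rewrite !mulr_ge0 //; nra.
  have : (1 - e) * (3 * (b * (M * ((q - 2) * z)))) <=
      (1 - 2 * gam) * (3 * (b * (M * ((q - 2) * z)))).
    by apply: ler_wpM2r; [rewrite mulr_ge0 | lra].
  have : (1 - 2 * gam) * (3 * (b * (M * ((q - 2) * z)))) =
     3 * (b * ((1 - 2 * gam) * M * ((q - 2) * z))) by ring.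
  lra.
have y3 : (1 - e) ^+ 3 * (1 - 2 * e) * ((1 - e) * n) <= 3 * l.
  apply: le_trans y2; have -> : (1 - e) * M * ((1 - e) * ((1 - e) * ((1 - 2 * e) * N))) =
    (1 - e) ^+ 3 * (1 - 2 * e) * (M * N) by ring.
  by apply: ler_wpM2l => //; rewrite mulr_ge0 ?exprn_ge0 //; lra.
apply: le_trans y3; rewrite mulrA; apply: ler_wpM2r => //.
have e20 : 0 <= e ^+ 2 by apply: sqr_ge0.
have e30 : 0 <= e ^+ 3 by rewrite exprn_ge0 // ltW.
have -> : (1 - e) ^+ 3 * (1 - 2 * e) * (1 - e) =
    (1 - 4 * e + 6 * e ^+ 2 - 4 * e ^+ 3 + e ^+ 4) * (1 - 2 * e) by ring.
nra.
Qed.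

Variables (T : finType) (G : sgraph T) (eta eps gam : R).
Variables (M N q z sig N0 C0 : nat) (rk : T -> 'I_#|T|).
Let n := #|T|.
Let eps1 := eps / 10.
Let g1 := eps1 ^+ 2 * gam ^+ 2 / 16.
Let s := (3 * q * z)%N.
Let st := (s + 2 * sig)%N.
Let V := fun i : 'I_M => [set x | rk x %/ N == i :> nat]%N.
Let bigv := [set v | (2 / 3 + eta / 2) * n%:R <= (degree G v)%:R].

Hypotheses (eta0 : 0 < eta) (eps0 : 0 < eps) (eps_le1 : eps <= 1).
Hypotheses (gam0 : 0 < gam) (gam_eta : 10 * gam <= eta) (gam_eps : 20 * gam <= eps).
Hypothesis rk_bij : bijective rk.
Hypothesis deg_rk : forall x,
  (1 / 3 + eta) * n%:R + Num.min (rk x)%:R (n%:R / 3) <= (degree G x)%:R.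
Hypotheses (M0 : (0 < M)%N) (N_gt0 : (0 < N)%N) (MN : (M * N <= n)%N) (nMN : (n <= M * N + M)%N).
Hypotheses (Mg1 : 4 <= g1 ^+ 2 * M%:R) (Mg3 : 4 <= gam ^+ 3 * M%:R) (Mg : 1 <= gam * M%:R).
Hypothesis Meta : 2 < eta * M%:R.
Hypotheses (q3 : (3 <= q)%N) (q_eps : 20 <= eps * q%:R).
Hypotheses (zMq : (3 * M * q <= z)%N) (zM : (2 * M ^ 6 <= z)%N) (z45 : (45 <= z)%N).
Hypotheses (sig27 : (27 <= sig)%N) (sigC : (C0 <= sig)%N).
Hypothesis sig_s : 2 * sig%:R <= eps / 10 * s%:R.
Hypothesis Wsmall : 2 * sig%:R * M%:R + 108 + 324 * q%:R <= eta / 4 * M%:R * s%:R.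
Hypotheses (N0N : N0%:R <= eps1 * N%:R) (Ngam : 1 <= gam * N%:R) (stN : st%:R <= eps / 10 * N%:R).
Hypothesis C0n : 2 * C0%:R <= n%:R :> R.
Hypothesis eta_le1 : eta <= 1.
Hypothesis erd : forall (U : 'I_M -> {set T}) (H : {set {ffun 'I_M -> T}}),
  (forall i, N0 <= #|U i|)%N -> (0 < #|fam U|)%N -> H \subset fam U ->
  ((4 * 2 ^ (M * M))%:R)^-1 * #|fam U|%:R <= #|H|%:R :> R ->
  exists A : 'I_M -> {set T},
    (forall i, A i \subset U i /\ #|A i| = st) /\ fam A \subset H.
Hypothesis conn : forall (A B C D W : {set T}),
  (3 * #|~: bigv| <= n)%N -> #|W|%:R <= eta / 2 / 2 * n%:R -> (C0 <= #|~: W|)%N ->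
  (C0 <= #|A|)%N -> (C0 <= #|B|)%N -> (C0 <= #|C|)%N -> (C0 <= #|D|)%N ->
  A :|: B :|: C :|: D \subset bigv ->
  exists2 S : 'I_8 -> {set T}, link G 27 A B C D S &
    forall i : 'I_8, (3 < i)%N -> [disjoint S i & W].

Lemma Nr : 0 < N%:R :> R. Proof. by rewrite ltr0n. Qed.
Lemma Mr : 0 < M%:R :> R. Proof. by rewrite ltr0n. Qed.
Lemma MNr : M%:R * N%:R <= n%:R :> R. Proof. by rewrite -natrM ler_nat. Qed.
Lemma nMNr : n%:R <= M%:R * N%:R + M%:R :> R. Proof. by rewrite -natrM -natrD ler_nat. Qed.

Lemma cV i : #|V i| = N. Proof. by have [h _] := strata rk_bij N_gt0 MN; apply: h. Qed.

Lemma dV i j x : x \in V i -> x \in V j -> i = j.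
Proof. by have [_ h] := strata rk_bij N_gt0 MN; apply: h. Qed.

Lemma rk_V i x : x \in V i -> (i * N <= rk x)%N.
Proof. by rewrite inE => /eqP <-; apply: leq_trunc_div. Qed.

Lemma deg_strata x :
  (degree G x <= \sum_i #|[set y | G x y] :&: V i| + M)%N.
Proof.
set X := [set y | G x y]; pose W := \bigcup_i V i.
have cW : #|W| = (M * N)%N.
  rewrite -sum1_card partition_disjoint_bigcup => [|i j ij].
    by under eq_bigr => i _ do rewrite sum1_card cV; rewrite sum_nat_const card_ord.
  rewrite disjoint_subset; apply/subsetP => y yi; rewrite inE; apply/negP => yj.
  by rewrite (dV yi yj) eqxx in ij.
rewrite /degree -/X -(cardsID W X); apply: leq_add.
  apply: leq_trans (card_bigcup_le _ _); apply: subset_leq_card.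
  apply/subsetP => y; rewrite inE => /andP[yX /bigcupP[i _ yi]].
  by apply/bigcupP; exists i; rewrite // inE yX.
apply: leq_trans (subset_leq_card (subsetDr _ _)) _.
by rewrite -(leq_add2l #|W|) cardsC cW.
Qed.

(** All ranks in [V k] are at least [k * N], and the at most [M] vertices outside the strata change
    the normalised degree by at most [M / N <= gam * M]. *)
Lemma mdeg_strata k a : a \in V k ->
  (1 / 3 + eta - gam) * M%:R + Num.min k%:R (M%:R / 3) <= mdeg R G V N a.
Proof.
move=> ak; have := deg_strata a; rewrite -(ler_nat R) natrD /mdeg.
set X := (\sum_i _)%:R => h1; have h2 := deg_rk a.
have kr : k%:R * N%:R <= (rk a)%:R :> R by rewrite -natrM ler_nat rk_V.
rewrite ler_pdivlMr ?Nr // mulrDl.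
have e : Num.min k%:R (M%:R / 3) * N%:R <= Num.min (rk a)%:R (n%:R / 3) :> R.
  rewrite le_min; apply/andP; split.
    by apply: le_trans kr; apply: ler_wpM2r; [exact: (ltW Nr) | rewrite ge_min lexx].
  apply: (@le_trans _ _ (M%:R / 3 * N%:R)); last by have := MNr; lra.
  by apply: ler_wpM2r; [exact: (ltW Nr) | rewrite ge_min lexx orbT].
have h3 : (1 / 3 + eta) * (M%:R * N%:R) <= (1 / 3 + eta) * n%:R.
  by apply: ler_wpM2l MNr => //; have := eta0; lra.
have h4 : M%:R * 1 <= M%:R * (gam * N%:R) by apply: ler_wpM2l => //; rewrite ltW // ?Nr ?Mr.
lra.
Qed.

(** Big indices of a block consist of big vertices of G: their ranks fall short of n / 3 by at most
    eta n / 2, so half of [eta] remains in the degree. *)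
Lemma big_strata k m a : (1 - 2 * gam) * M%:R <= m%:R -> (m <= 3 * k.+1)%N ->
  forall k' : 'I_M, k' = k :> nat -> a \in V k' -> a \in bigv.
Proof.
move=> hm mk k' kk ak; rewrite inE; apply: le_trans (deg_rk a).
have kr : k%:R * N%:R <= (rk a)%:R :> R by rewrite -natrM ler_nat -kk rk_V.
have hk : (1 - 2 * gam) * M%:R <= 3 * k%:R + 3.
  by apply: le_trans hm _; rewrite -(ler_nat R) natrM -(addn1 k) natrD in mk; lra.
have h1 : (1 - 2 * gam) * M%:R * N%:R <= (3 * k%:R + 3) * N%:R.
  by apply: ler_wpM2r => //; rewrite ltW // ?Nr ?Mr.
have h2 : 1 * N%:R <= gam * M%:R * N%:R by apply: ler_wpM2r => //; rewrite ltW // ?Nr ?Mr.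
have h3 : M%:R * 1 <= M%:R * (gam * N%:R) by apply: ler_wpM2l => //; rewrite ltW // ?Nr ?Mr.
have h4 : gam * (M%:R * N%:R) <= gam * n%:R by rewrite ler_pM2l ?MNr.
have := nMNr; have := MNr => mn nm.
have h5 : 10 * gam * n%:R <= eta * n%:R by apply: ler_wpM2r.
have n0 : 0 <= n%:R :> R by [].
have h6 : n%:R / 3 - eta / 2 * n%:R <= Num.min (rk a)%:R (n%:R / 3).
  have : 0 <= eta * n%:R by rewrite mulr_ge0 // ltW.
  by move=> en; rewrite le_min; apply/andP; split; lra.
lra.
Qed.

(** A vertex outside [bigv] has rank below n / 3 - eta n / 2; as eta n / 2 is at least 1, this gives
    the required bound on the rank plus one. *)
Lemma small_count : (3 * #|~: bigv| <= n)%N.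
Proof.
have n0 : 0 <= n%:R :> R by [].
have en : 2 <= eta * n%:R.
  have h : eta * M%:R <= eta * n%:R.
    apply: ler_wpM2l; first exact: ltW.
    by rewrite ler_nat; apply: leq_trans MN; rewrite leq_pmulr.
  by have := Meta; lra.
have rinj : injective (fun x => rk x : nat).
  by move=> x y' /val_inj /(bij_inj rk_bij).
have : (#|~: bigv| <= n %/ 3)%N.
  apply: (card_rank_lt rinj) => x; rewrite !inE -ltNge => /(le_lt_trans (deg_rk x)).
  rewrite leq_divRL // -(ler_nat R) natrM -(addn1 (rk x)) natrD.
  have [h1|h1] := lerP (rk x)%:R (n%:R / 3 : R).
    by move=> h2; lra.
  by move=> h2; lra.
by rewrite leq_divRL // mulnC.
Qed.

Definition block_data (S : 'I_M -> {set T})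
    (tL : ('I_M * 'I_M * 'I_M) * seq ('I_M * 'I_M * 'I_M)) : Prop :=
  let: (t, L) := tL in
  [/\ zstep (full G S) t t, S t.1.1 :|: S t.1.2 \subset bigv,
      path (zstep (full G S)) t L /\ last t L = t,
      all (fun t' => zstep (full G S) t' t') L &
      (forall k, load L k <= (3 * q - 4) * z)%N /\
      (1 - 2 * gam) * M%:R * ((q - 2) * z)%:R <= (size L)%:R].

Lemma block_walk (S : 'I_M -> {set T}) : (forall k, S k \subset V k) ->
  good_block G N V gam S -> exists tL, block_data S tL.
Proof.
move=> SV [J [cJ hJ]].
have fs : symmetric (full G S) by move=> i j; rewrite /full eq_sym -!/(complete _ _ _) complete_sym.
have fi : irreflexive (full G S) by move=> i; rewrite /full eqxx.
pose F := SGraph fs fi.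
have mM : (#|J| <= M)%N by rewrite -[X in (_ <= X)%N]card_ord max_card.
have J0 : (0 < #|J|)%N.
  rewrite -(ltr_nat R); apply: lt_le_trans cJ; rewrite mulr_gt0 ?Mr //.
  by have := gam_eps; have := eps_le1; lra.
have hF k : k \in J -> (#|J| + minn (3 * k.+1) #|J| < 3 * #|[set l in J | F k l]|)%N.
  move=> kJ; have [a ak ha] := hJ k kJ.
  apply: good_arith mM gam_eta Meta _.
  have hm := mdeg_strata (subsetP (SV k) _ ak).
  have : (#|[set l | full G S k l]| <= #|[set l in J | F k l]| + #|~: J|)%N.
    rewrite -(cardsID J [set l | full G S k l]); apply: leq_add.
      by apply: subset_leq_card; apply/subsetP => l; rewrite !inE andbC.
    by apply: subset_leq_card; rewrite setDE subsetIr.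
  have : (#|J| + #|~: J| = M)%N by rewrite cardsC card_ord.
  move=> /(congr1 (fun k => k%:R : R)); rewrite natrD => h1.
  rewrite -(ler_nat R) natrD => h2; lra.
have [t [tt b1 b2 hL]] := block_tour J0 hF.
have [L [pL lL aL nL ldL]] := hL _ _ (square_arith mM zMq).
exists (t, L); split=> //.
- apply/subsetP => x; rewrite inE => /orP[] /(subsetP (SV _)) xV.
    exact: (big_strata cJ b1 erefl xV).
  exact: (big_strata cJ b2 erefl xV).
- split=> [k|]; first by apply: (tour_arith J0 mM q3 zM); apply: ldL.
apply: (@le_trans _ _ (#|J| * (q - 2) * z)%:R); last by rewrite ler_nat.
by rewrite -mulnA [X in _ <= X]natrM; apply: ler_wpM2r.
Qed.

(** Take the integer part of [(1 - eps1) * N / st]; rounding loses at most one block, whose clusters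
    have size at most [eps / 10 * N]. *)
Lemma block_count : exists b : nat, eps1 * N%:R <= N%:R - b%:R * st%:R /\
  (1 - eps / 5) * N%:R <= b%:R * st%:R.
Proof.
have st0 : 0 < st%:R :> R.
  by rewrite ltr0n /st addn_gt0 muln_gt0 (leq_trans _ sig27) ?orbT.
have x0 : 0 <= (1 - eps1) * N%:R / st%:R.
  apply: divr_ge0 => //; apply: mulr_ge0 => //.
  by have := eps_le1; rewrite /eps1; lra.
have [b] : exists b : nat, b%:R <= (1 - eps1) * N%:R / st%:R < b.+1%:R.
  by eexists; apply: truncn_itv x0.
rewrite ler_pdivlMr // ltr_pdivrMr // -(addn1 b) natrD => /andP[h1 h2]; exists b.
by move: h1 h2 (stN); rewrite /eps1 => h1 h2 h3; split; lra.
Qed.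

Lemma contains_long_tricycle : exists l,
  (1 - eps) * n%:R <= (3 * l)%:R /\ contains G (tricycle l).
Proof.
have [b [hb1 hb2]] := block_count.
have st0 : (0 < st)%N by rewrite /st addn_gt0 muln_gt0 (leq_trans _ sig27) ?orbT.
have T0 : (0 < n)%N by apply: leq_trans MN; rewrite muln_gt0 M0.
have e10 : 0 < eps1 by rewrite /eps1 divr_gt0.
have g10 : 0 < g1.
  by rewrite /g1 divr_gt0 // mulr_gt0 // exprn_gt0.
have TMN : (n <= 2 * M * N)%N.
  apply: leq_trans nMN _; rewrite -mulnA mul2n -addnn leq_add2l.
  by rewrite leq_pmulr.
have hg1 : 16 * g1 <= eps1 ^+ 2 * gam ^+ 2 by rewrite /g1 mulrC divfK ?lexx // pnatr_eq0.
have [B [hB1 hB2 hB3 _]] := nibble G M0 N_gt0 st0 T0 cV dV e10 gam0 g10 TMN hg1 Mg1 Mg3 N0N erd hb1.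
(* [choice] asks for total functions, so indices from [b] on get dummy values, here and for the
   pieces below. *)
have exT p : exists tL, (p < b)%N -> block_data (B p) tL.
  have [pb|] := ltnP p b; last first.
    by move=> _; exists ((Ordinal M0, Ordinal M0, Ordinal M0), [::]).
  have BV k : B p k \subset V k by case: (hB1 p k pb).
  by have [tL h] := block_walk BV (hB3 p pb); exists tL.
have [tL htL] := choice exT.
have exP p : exists P : 'I_M -> 'I_3 -> {set T}, (p < b)%N -> forall k,
    [/\ forall t, P k t \subset B p k, #|P k (i3 0)| = s,
        forall t : 'I_3, (0 < t)%N -> #|P k t| = sig
      & forall t t', t != t' -> [disjoint P k t & P k t']].
  have [pb|] := ltnP p b; last by exists (fun _ _ => set0).
  have ex k := split_three (hB1 p k pb).2.
  by have [P hP] := choice ex; exists P => _ k; apply: hP.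
have [Pc hPc] := choice exP.
have bst : b%:R * st%:R <= N%:R :> R.
  have h : 0 <= eps1 * N%:R by rewrite mulr_ge0 // ltW.
  by move: hb1 h; move: (eps1 * _) => x; lra.
have sst : s%:R <= st%:R :> R by rewrite ler_nat leq_addr.
have b0 : (0 < b)%N.
  rewrite -(ltr0n R) -(pmulr_lgt0 _ (_ : 0 < st%:R)) ?ltr0n //.
  by apply: lt_le_trans hb2; rewrite mulr_gt0 ?Nr //; have := eps_le1; lra.
pose t0 p := (tL p).1; pose L p := (tL p).2.
have hL p : (p < b)%N -> block_data (B p) (t0 p, L p).
  by move=> pb; rewrite /t0 /L -surjective_pairing; apply: htL.
pose nx p := if p.+1 == b then 0%N else p.+1.
have nxb p : (p < b)%N -> (nx p < b)%N.
  by rewrite /nx => pb; case: eqP => // /eqP ne; rewrite ltn_neqAle ne.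
have PB p k tau : (p < b)%N -> Pc p k tau \subset B p k.
  by move=> pb; case: (hPc p pb k).
have dP p k tau p' k' tau' : (p < b)%N -> (p' < b)%N ->
    (p, k, tau) != (p', k', tau') -> [disjoint Pc p k tau & Pc p' k' tau'].
  move=> pb pb' ne; have [e|kk] := eqVneq k k'; last first.
    rewrite disjoint_subset; apply/subsetP => x xP; rewrite inE; apply/negP => xP'.
    have xk := subsetP (hB1 p k pb).1 _ (subsetP (PB p k tau pb) _ xP).
    have xk' := subsetP (hB1 p' k' pb').1 _ (subsetP (PB p' k' tau' pb') _ xP').
    by rewrite (dV xk xk') eqxx in kk.
  have [e'|pp] := eqVneq p p'; last first.
    by apply: disjointW (PB p k tau pb) (PB p' k' tau' pb') _; rewrite -e hB2.
  rewrite -e -e'; case: (hPc p pb k) => _ _ _; apply.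
  by apply: contraNneq ne => ->; rewrite e e'.
pose Res := \bigcup_(p < b) \bigcup_(k : 'I_M) (Pc p k (i3 1) :|: Pc p k (i3 2)).
pose w := (#|Res| + 108 * b + (3 * q) * (108 * b))%N.
have cRes : (#|Res| <= b * (M * (2 * sig)))%N.
  apply: leq_trans (card_bigcup_le _ _) _.
  apply: (@leq_trans (\sum_(p < b) M * (2 * sig))%N); last by rewrite sum_nat_const card_ord.
  apply: leq_sum => p _; apply: leq_trans (card_bigcup_le _ _) _.
  apply: (@leq_trans (\sum_(k < M) (2 * sig))%N); last by rewrite sum_nat_const card_ord.
  apply: leq_sum => k _; have [+ _] := leq_card_setU (Pc p k (i3 1)) (Pc p k (i3 2)).
  by case: (hPc p (ltn_ord p) k) => _ _ cs _; rewrite !cs // mul2n addnn.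
have bMs : b%:R * M%:R * s%:R <= n%:R :> R.
  apply: le_trans MNr; rewrite mulrAC [M%:R * _]mulrC; apply: ler_wpM2r => //.
  by apply: le_trans bst; apply: ler_wpM2l.
(* [Wsmall] is the cost of one block, multiplied here by [b]; 324 is 3 * 108, the factor 3 coming
   from [y = 3 * q]. *)
have wn : w%:R <= eta / 2 / 2 * n%:R.
  have : #|Res|%:R <= b%:R * (M%:R * (2 * sig%:R)) :> R by rewrite -!natrM ler_nat.
  rewrite /w !natrD !natrM => h1.
  have h2 : b%:R * (2 * sig%:R * M%:R + 108 + 324 * q%:R) <= b%:R * (eta / 4 * M%:R * s%:R).
    exact: ler_wpM2l.
  have h3 : eta / 4 * (b%:R * M%:R * s%:R) <= eta / 4 * n%:R.
    by apply: ler_wpM2l => //; rewrite divr_ge0 // ltW.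
  lra.
have linkP p (W : {set T}) : (p < b)%N -> (#|W| <= w)%N ->
  exists2 S : 'I_8 -> {set T},
    link G 27 (Pc p (t0 p).1.1 (i3 1)) (Pc p (t0 p).1.2 (i3 1))
      (Pc (nx p) (t0 (nx p)).1.1 (i3 2)) (Pc (nx p) (t0 (nx p)).1.2 (i3 2)) S &
    forall i : 'I_8, (3 < i)%N -> [disjoint S i & W].
  move=> pb Ww; have pb' := nxb p pb.
  have Wn : #|W|%:R <= eta / 2 / 2 * n%:R by apply: le_trans wn; rewrite ler_nat.
  have cPc p' k (tau : 'I_3) : (p' < b)%N -> (0 < tau)%N -> (C0 <= #|Pc p' k tau|)%N.
    by move=> pb1 tau0; case: (hPc p' pb1 k) => _ _ -> //.
  apply: conn => //; try exact: cPc.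
  - exact: small_count.
  - have : (#|W| + #|~: W| = n)%N by rewrite cardsC.
    move=> /(congr1 (fun k => k%:R : R)); rewrite natrD => h1.
    rewrite -(ler_nat R); have := C0n; have := eta_le1.
    have n0 : 0 <= n%:R :> R by [].
    move=> h2 h3; have : eta * n%:R <= 1 * n%:R by apply: ler_wpM2r.
    lra.
  have [_ + _ _ _] := hL p pb; have [_ + _ _ _] := hL _ pb'.
  rewrite !subUset => /andP[c1 c2] /andP[c3 c4].
  by apply/andP; split; [apply/andP; split; [apply/andP; split|]|];
    [apply: subset_trans c3 | apply: subset_trans c4 | apply: subset_trans c1
    | apply: subset_trans c2]; apply: PB.
have [|||||||l [hl cl]] := @assemble T G M b (3 * q) z w B Pc t0 L b0 PB dP _ _ _ _ _ _ _ linkP (leqnn _).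
- by move=> p k pb; case: (hPc p pb k) => _ -> _ _.
- by move=> p k tau pb tau0; case: (hPc p pb k) => _ _ -> //.
- by move=> p /hL[].
- by move=> p /hL[_ _ []].
- by move=> p /hL[].
- by move=> p /hL[_ _ []].
- move=> p k /hL[_ _ _ _ [h _]].
  by apply: load_arith q3 z45 (h k).
exists l; split=> //.
have hl' : b%:R * ((1 - 2 * gam) * M%:R * ((q - 2) * z)%:R) <= l%:R.
  apply: (@le_trans _ _ (\sum_(p < b) size (L p))%:R); last by rewrite ler_nat.
  rewrite natr_sum mulr_natl -[X in _ *+ X]card_ord -sumr_const.
  by apply: ler_sum => p _; case: (hL p (ltn_ord p)) => _ _ _ _ [].
have q2 : (q - 2)%:R = q%:R - 2 :> R by rewrite natrB // (leq_trans _ q3).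
rewrite natrM q2 in hl'; rewrite natrM.
have -> : 1 - eps = 1 - 10 * (eps / 10) by field.
have sE : s%:R = 3 * q%:R * z%:R :> R by rewrite /s !natrM.
have stE : st%:R = 3 * q%:R * z%:R + 2 * sig%:R :> R by rewrite /st natrD sE natrM.
apply: (count_arith (gam := gam) (b := b%:R) (M := M%:R) (N := N%:R) (q := q%:R)
  (z := z%:R) (sig := sig%:R)) => //.
- by have := eps_le1; lra.
- exact: ltW.
- by have := gam_eps; lra.
- by have := q_eps; lra.
- by have := sig_s; rewrite sE.
- by have := hb2; rewrite stE; lra.
- exact: nMNr.
apply: (@le_trans _ _ (gam * (M%:R * N%:R))); last by rewrite ler_pM2l // MNr.
by rewrite mulrCA -[X in X <= _]mulr1 ler_pM2l // Mr.
Qed.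

End Core.


(** * Choice of all constants and monotone thresholds *)

Section Asymptotic.
Variable R : realType.
Local Open Scope ring_scope.

Lemma nat_ge (x : R) : exists k : nat, x <= k%:R.
Proof.
have [x0|x0] := lerP 0 x; last by exists 0%N; apply: ltW.
by exists (Num.bound x); apply/ltW/archi_boundP.
Qed.

Lemma tricycle_card (T : finType) (G : sgraph T) l :
  contains G (tricycle l) -> (3 * l <= #|T|)%N.
Proof.
case=> f fi _; have := leq_card f fi.
by rewrite card_prod !card_ord mulnC.
Qed.

(** Both parameters are set to [eps]. The choices [gam], [g1], [M], [q], [sig], [z], [st], [N0],
    [N1] are made in this order, each depending only on earlier ones; in particular the reserved
    pieces must exceed the threshold [C0] of [connection] before [z] makes them negligible in the
    clusters. *)
Lemma good_contains (eps : R) : 0 < eps -> eps <= 1 -> exists n0 : nat,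
  forall (T : finType) (G : sgraph T), (n0 <= #|T|)%N -> eta_good eps G ->
  exists l : nat, (1 - eps) * #|T|%:R <= (3 * l)%:R /\ contains G (tricycle l).
Proof.
move=> e0 e1; pose gam := eps / 20.
have g0 : 0 < gam by rewrite divr_gt0.
pose g1 := (eps / 10) ^+ 2 * gam ^+ 2 / 16.
have g10 : 0 < g1 by rewrite divr_gt0 // mulr_gt0 // exprn_gt0 // divr_gt0.
have [M hM] := nat_ge (4 / g1 ^+ 2 + 4 / gam ^+ 3 + 1 / gam + 3 / eps).
have p1 : 0 < 4 / g1 ^+ 2 by rewrite divr_gt0 // exprn_gt0.
have p2 : 0 < 4 / gam ^+ 3 by rewrite divr_gt0 // exprn_gt0.
have p3 : 0 < 1 / gam by rewrite divr_gt0.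
have p4 : 0 < 3 / eps by rewrite divr_gt0.
have mul_ge (x a b : R) : 0 < x -> a / x <= b -> a <= x * b.
  by move=> x0; rewrite ler_pdivrMr // mulrC.
have Mg1 : 4 <= g1 ^+ 2 * M%:R by apply: mul_ge; [rewrite exprn_gt0 | lra].
have Mg3 : 4 <= gam ^+ 3 * M%:R by apply: mul_ge; [rewrite exprn_gt0 | lra].
have Mg : 1 <= gam * M%:R by apply: mul_ge; [|lra].
have Me : 2 < eps * M%:R.
  have h : 3 <= eps * M%:R by apply: mul_ge => //; lra.
  lra.
have M0 : (0 < M)%N by rewrite -(ltr0n R); lra.
have M1 : 1 <= M%:R :> R by rewrite ler1n.
have [q hq] := nat_ge (20 / eps + 3).
have p5 : 0 < 20 / eps by rewrite divr_gt0.
have q3 : (3 <= q)%N by rewrite -(ler_nat R); lra.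
have qe : 20 <= eps * q%:R by apply: mul_ge => //; lra.
have eta20 : 0 < eps / 2 by rewrite divr_gt0.
have [C0 hC0] := connection 27 eta20.
pose sig := maxn C0 27.
pose X : R := 2 * sig%:R * M%:R + 108 + 324 * q%:R.
have [z1 hz1] := nat_ge (20 * sig%:R / eps).
have [z2 hz2] := nat_ge (4 * X / eps).
pose z := (3 * M * q + 2 * M ^ 6 + 45 + z1 + z2)%N.
have zz1 : z1%:R <= z%:R :> R by rewrite ler_nat /z addnAC leq_addl.
have zz2 : z2%:R <= z%:R :> R by rewrite ler_nat /z leq_addl.
have q1 : 1 <= q%:R :> R by rewrite ler1n (leq_trans _ q3).
have z0 : 0 <= z%:R :> R by [].
pose s := (3 * q * z)%N; pose st := (s + 2 * sig)%N.
have sz : z%:R <= s%:R :> R.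
  by rewrite ler_nat /s leq_pmull // muln_gt0 (leq_trans _ q3).
have sig_s : 2 * sig%:R <= eps / 10 * s%:R.
  have : 20 * sig%:R <= eps * z%:R by apply: mul_ge => //; lra.
  have : eps * z%:R <= eps * s%:R by rewrite ler_pM2l.
  lra.
have Wsmall : X <= eps / 4 * M%:R * s%:R.
  have h1 : 4 * X <= eps * z%:R by apply: mul_ge => //; lra.
  have h2 : eps * z%:R <= eps * s%:R by rewrite ler_pM2l.
  have h3 : 1 * (eps * s%:R) <= M%:R * (eps * s%:R).
    by apply: ler_wpM2r => //; rewrite mulr_ge0 // ltW.
  lra.
have c0 : 0 < (4 * 2 ^ (M * M))%:R^-1 :> R by rewrite invr_gt0 ltr0n muln_gt0 expn_gt0.
have [N0 hN0] := erdos_multipartite M st c0.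
have [N1 hN1] := nat_ge (N0%:R / (eps / 10) + 1 / gam + st%:R / (eps / 10)).
have p6 : 0 <= N0%:R / (eps / 10) by rewrite divr_ge0 // divr_ge0 // ltW.
have p7 : 0 <= st%:R / (eps / 10) by rewrite divr_ge0 // divr_ge0 // ltW.
exists (M * N1.+1 + 2 * C0 + 3)%N => T G nT good.
pose N := (#|T| %/ M)%N.
have NN1 : (N1 < N)%N.
  by rewrite /N leq_divRL // mulnC; apply: leq_trans nT; rewrite -addnA leq_addr.
have Nge : N1%:R <= N%:R :> R by rewrite ler_nat ltnW.
have [rk [rkb rkd]] := eta_good_rank (leq_trans (leq_addl _ _) nT) (ltW e0) good.
apply: (@contains_long_tricycle R T G eps eps gam M N q z sig N0 C0 rk) => //.
- by rewrite /gam; lra.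
- by rewrite /gam; lra.
- by apply: leq_ltn_trans NN1.
- by rewrite mulnC leq_trunc_div.
- by rewrite mulnC {1}(divn_eq #|T| M) leq_add2l ltnW // ltn_pmod.
- by rewrite /z -!addnA leq_addr.
- by do 3!apply: leq_trans (leq_addr _ _); rewrite leq_addl.
- by do 2!apply: leq_trans (leq_addr _ _); rewrite leq_addl.
- by rewrite leq_maxr.
- by rewrite leq_maxl.
- by apply: mul_ge; [rewrite divr_gt0 | lra].
- by apply: mul_ge; [|lra].
- by rewrite -/s -/st; apply: mul_ge; [rewrite divr_gt0 | lra].
- rewrite -natrM ler_nat; apply: leq_trans nT.
  by rewrite addnAC leq_addl.
- by move=> U H; apply: hN0; rewrite card_ord.
- by move=> A B C D W h1 h2 h3 h4 h5 h6 h7 h8; apply: hC0.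
Qed.

Lemma eta_good_mono (x y : R) (T : finType) (G : sgraph T) : x <= y ->
  eta_good y G -> eta_good x G.
Proof.
move=> xy [v [vb mono hv]]; exists v; split=> // k hk.
apply: le_trans (hv k hk); rewrite -!addrA lerD2r; apply: ler_wpM2r => //.
by rewrite lerD2l.
Qed.

End Asymptotic.

Local Open Scope ring_scope.

Theorem lemma7p2 (R : realType) :
  exists (c0 : R) (f g : R -> R),
    [/\ 0 < c0 <= 1, hierarchy_fun f, hierarchy_fun g
      & forall (eta eps : R) (n : nat),
          0 < eta <= c0 -> 0 < eps <= f eta -> (0 < n)%N -> 1 / n%:R <= g eps ->
          forall (T : finType) (G : sgraph T),
            #|T| = n -> eta_good eta G ->
            exists l : nat,
              (1 - eps) * n%:R <= (3 * l)%:R /\ (3 * l <= n)%N /\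
              contains G (tricycle l)].
Proof.
(* [good_contains] gives no control on how the threshold varies with [eps]. It is used only at
   reciprocals of positive integers, where maxima over initial segments produce a monotone
   function. *)
have exN k : exists n0 : nat, forall (T : finType) (G : sgraph T), (n0 <= #|T|)%N ->
    eta_good (k.+1%:R^-1 : R) G ->
  exists l : nat, (1 - k.+1%:R^-1) * #|T|%:R <= (3 * l)%:R :> R /\ contains G (tricycle l).
  apply: good_contains; first by rewrite invr_gt0.
  by rewrite invf_le1 // ler1n.
have [n0 hn0] := choice exN.
have exK (x : R) : exists K : nat, 0 < x -> K%:R <= x^-1 < K.+1%:R.
  have [x0|_] := ltrP 0 x; last by exists 0%N.
  by have := ltW x0; rewrite -invr_ge0 => /truncn_itv h; eexists => _; apply: h.
have [K hK] := choice exK.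
pose mx k := \max_(i < k.+1) n0 i.
have mx_mono k k' : (k <= k')%N -> (mx k <= mx k')%N.
  move=> kk; apply/bigmax_leqP => i _.
  by apply: (leq_bigmax (Ordinal (leq_trans (ltn_ord i) (kk : k < k'.+1)%N))).
(* [f] can be the identity because only [eps <= eta] matters: with [K eps] the integer part of the
   reciprocal of [eps], goodness passes from [eta] down to the reciprocal of [(K eps).+1], and the
   conclusion passes up from there to [eps]. *)
exists 1, id, (fun x => (mx (K x)).+1%:R^-1); split.
- by rewrite ltr01 lexx.
- by [].
- split=> [x _|x y x0 xy y1]; first by rewrite invr_gt0 ltr0n invf_le1 // ler1n.
  rewrite lef_pV2 ?posrE // ler_nat ltnS; apply: mx_mono.
  have y0 := lt_le_trans x0 xy.
  have /andP[h1 _] := hK y y0; have /andP[_ h2] := hK x x0.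
  have : (K y)%:R < (K x).+1%:R :> R.
    by apply: le_lt_trans h1 (le_lt_trans _ h2); rewrite lef_pV2 ?posrE.
  by rewrite ltr_nat.
move=> eta eps n /andP[eta0 _] /andP[eps0 eps_eta] n_gt0 ng T G Tn good.
have /andP[_ hK2] := hK eps eps0; set k := K eps in hK2 ng.
have keps : k.+1%:R^-1 <= eps.
  by rewrite -[eps]invrK lef_pV2 ?posrE ?invr_gt0 // ltW.
have n0n : (n0 k <= #|T|)%N.
  have : (n0 k <= mx k)%N by apply: (leq_bigmax (Ordinal (ltnSn k))).
  move: ng; rewrite div1r lef_pV2 ?posrE ?ltr0n // ler_nat Tn => h1 h2.
  by apply: leq_trans h2 (ltnW h1).
have [l [hl cl]] := hn0 k T G n0n (eta_good_mono (le_trans keps eps_eta) good).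
exists l; split; last by split=> //; rewrite -Tn; apply: tricycle_card cl.
rewrite -Tn; apply: le_trans hl; apply: ler_wpM2r => //.
by rewrite lerD2l lerN2.
Qed.
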